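(* Let $\mathcal{A}_\hbar$ be a deformation quantisation of a Poisson algebra $A$ over $\mathbb{C}$, and let $G \simeq H \rtimes K$ be an algebraic group (with $H$, $K$ closed subgroups, $H$ normal in $G$, and Lie algebras $\mathfrak{g}, \mathfrak{h}, \mathfrak{k}$) which acts on $\mathcal{A}_\hbar$ with quantum comoment map $\Phi \colon \mathfrak{g} \to \mathcal{A}_\hbar$. Let $\gamma \in \mathfrak{g}^*$ be invariant under the co-adjoint action of $G$, and let $\gamma = (\eta, \kappa)$ under the identification $\mathfrak{g}^* \simeq \mathfrak{h}^* \times \mathfrak{k}^*$. Then there exists a natural action of $K$ on the quantum Hamiltonian reduction $\mathcal{A}_\hbar /\!/\!/_{\eta} H$ with an induced quantum comoment map $\Phi_K \colon \mathfrak{k} \to \mathcal{A}_\hbar /\!/\!/_{\eta} H$, and there is a natural homomorphism of algebras $$\bigl(\mathcal{A}_\hbar /\!/\!/_{\eta} H\bigr) /\!/\!/_{\kappa} K \longrightarrow \mathcal{A}_\hbar /\!/\!/_{\gamma} G .$$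
   Context: Deformation quantisation: let $A$ be a Poisson algebra with bracket $\{\cdot,\cdot\}$. A deformation quantisation of $A$ is an associative unital product $\star \colon A \otimes A \to A[[\hbar]]$ which, extended $\mathbb{C}[[\hbar]]$-bilinearly, is an associative product on $A[[\hbar]]$ continuous in the $\hbar$-adic topology, with $f \star g = fg + O(\hbar)$ and $f\star g - g \star f = \{f,g\}\hbar + O(\hbar^2)$ for $f,g\in A$; moreover, writing $f \star g = \sum_{k \ge 0} D_k(f,g)\hbar^k$, each $D_k$ is required to be a bidifferential operator of order at most $k$ in each variable. $\mathcal{A}_\hbar$ denotes $A[[\hbar]]$ with the product $\star$. Group actions and comoment maps: $G$ acts on $\mathcal{A}_\hbar$ by $\mathbb{C}[[\hbar]]$-algebra automorphisms (preserving the grading, when there is one); the action of $g$ is written $\mathrm{Ad}_g$. For $\xi \in \mathfrak{g}$ let $\xi_{\mathcal{A}}$ be the induced derivation of $\mathcal{A}_\hbar$. A quantum comoment map is a $G$-equivariant linear map $\Phi \colon \mathfrak{g} \to \mathcal{A}_\hbar$ with $\tfrac1\hbar[\Phi(\xi),\cdot] = \xi_{\mathcal{A}}$ for all $\xi\in\mathfrak{g}$. Let $U_\hbar(\mathfrak{g})$ be the universal enveloping algebra of $\mathfrak{g}\otimes\mathbb{C}[[\hbar]]$ with bracket $[x,y]_\hbar = \hbar[x,y]$; $\Phi$ is extended to $\Phi \colon U_\hbar(\mathfrak{g}) \to \mathcal{A}_\hbar$. The same definitions are used for the groups $H$ and $K$; $H$ acts by restriction, with quantum comoment map $\Phi_H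 = \Phi|_{\mathfrak{h}}$. Quantum Hamiltonian reduction: for $\gamma \in \mathfrak{g}^*$ fixed by the co-adjoint action, let $\mathcal{I}_\gamma$ be the two-sided ideal of $U_\hbar(\mathfrak{g})$ generated by $\{x - \gamma(x)\hbar : x \in \mathfrak{g}\}$, and set $$\mathcal{A}_\hbar /\!/\!/_{\gamma} G := \bigl(\mathcal{A}_\hbar / \mathcal{A}_\hbar \Phi(\mathcal{I}_\gamma)\bigr)^G,$$ with product $(a + \mathcal{A}_\hbar \Phi(\mathcal{I}_\gamma))(b + \mathcal{A}_\hbar \Phi(\mathcal{I}_\gamma)) = ab + \mathcal{A}_\hbar \Phi(\mathcal{I}_\gamma)$. The reductions by $H$ (at $\eta$, with $\Phi_H$) and by $K$ (at $\kappa$, acting on $\mathcal{A}_\hbar/\!/\!/_\eta H$, with $\Phi_K$) are defined by the same formula. Meaning of ''natural'' and ''induced'': the action of $K$ is $\mathrm{Ad}_k(a + \mathcal{A}_\hbar\Phi_H(\mathcal{I}_\eta)) = \mathrm{Ad}_k(a) + \mathcal{A}_\hbar\Phi_H(\mathcal{I}_\eta)$; the map $\Phi_K$ sends $y \in \mathfrak{k}$ to $\Phi(y) + \mathcal{A}_\hbar\Phi_H(\mathcal{I}_\eta)$; and the homomorphism is the one induced by the identity on representatives, sending $(a + \mathcal{A}_\hbar\Phi_H(\mathcal{I}_\eta)) + (\mathcal{A}_\hbar/\!/\!/_\eta H)\Phi_K(\mathcal{I}_\kappa)$ to $a + \mathcal{A}_\hbar\Phi(\mathcal{I}_\gamma)$.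 *)

(* Defs.v *)
From HB Require Import structures.
From mathcomp Require Import all_boot all_order all_algebra.
From mathcomp Require Import boolp classical_sets functions reals.
From mathcomp Require Import generic_quotient complex ring.

Set Implicit Arguments.
Unset Strict Implicit.
Unset Printing Implicit Defensive.

Import GRing.Theory.
Local Open Scope ring_scope.
Local Open Scope quotient_scope.

(* An algebra over [k] is a ring with a central ring morphism from [k]. The
   library's [algType] is not used because it excludes the zero algebra, and a
   quantum Hamiltonian reduction can be zero. *)
HB.mixin Record PzRing_isAlgOver (k : pzRingType) V of GRing.PzRing V := {
  inalg : k -> V;
  inalgD : {morph inalg : x y / x + y};
  inalgM : {morph inalg : x y / x * y};
  inalg1 : inalg 1 = 1;
  inalgC : forall c v, inalg c * v = v * inalg c }.

#[short(type="algOverType")]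
HB.structure Definition AlgOver (k : pzRingType) :=
  {V of GRing.PzRing V & PzRing_isAlgOver k V}.

Definition preserves_scalars (k : pzRingType) (B B' : algOverType k) (f : B -> B') : Prop :=
  forall c : k, f (inalg c) = inalg c.

Definition ser (V : Type) : Type := nat -> V.

HB.instance Definition _ (V : zmodType) := GRing.Zmodule.on (ser V).

Definition conv (U V : Type) (W : zmodType) (op : U -> V -> W)
    (a : ser U) (b : ser V) : ser W :=
  fun n => \sum_(i < n.+1) op (a i) (b (n - i)%N).

Definition sconst (V : zmodType) (v : V) : ser V :=
  fun n => if n is 0 then v else 0.

Section Conv.

Lemma serD (V : zmodType) (a b : ser V) n : (a + b) n = a n + b n.
Proof. by []. Qed.

Lemma conv_const_l (U V W : zmodType) (op : U -> V -> W) (u : U) b :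
  (forall v, op 0 v = 0) -> conv op (sconst u) b = (fun n => op u (b n)).
Proof.
move=> op0; apply/funext => n; rewrite /conv big_ord_recl subn0 big1 ?addr0 //.
Qed.

Lemma conv_rev (U V : Type) (W : zmodType) (op : U -> V -> W) a b n :
  conv op a b n = \sum_(i < n.+1) op (a (n - i)%N) (b i).
Proof.
rewrite /conv (reindex_inj rev_ord_inj) /=; apply: eq_bigr => i _.
by rewrite subSS subKn // -ltnS.
Qed.

Lemma conv_const_r (U V W : zmodType) (op : U -> V -> W) (v : V) a :
  (forall u, op u 0 = 0) -> conv op a (sconst v) = (fun n => op (a n) v).
Proof.
move=> op0; apply/funext => n; rewrite conv_rev big_ord_recl subn0 big1 ?addr0 //.
Qed.

Lemma sum_assoc (W : zmodType) (f : nat -> nat -> nat -> W) n :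
  \sum_(i < n.+1) \sum_(j < i.+1) f j (i - j)%N (n - i)%N =
  \sum_(i < n.+1) \sum_(j < (n - i).+1) f i j (n - i - j)%N.
Proof.
have e1 (i : 'I_n.+1) : \sum_(j < i.+1) f j (i - j)%N (n - i)%N =
    \sum_(j < n.+1 | (j <= i)%N) f j (i - j)%N (n - i)%N.
  by rewrite (big_ord_widen_cond n.+1 xpredT (fun j => f j (i - j)%N (n - i)%N)).
rewrite (eq_bigr _ (fun i _ => e1 i)) (exchange_big_dep xpredT) //=.
apply: eq_bigr => j _; rewrite -(big_mkord xpredT (fun k => f j k (n - j - k)%N)).
rewrite -(big_mkord (fun i => (j <= i)%N) (fun i => f j (i - j)%N (n - i)%N)).
have jn : (j <= n)%N by rewrite -ltnS.
rewrite (@big_cat_nat _ _ _ j) //= ?(leqW jn) // big1_seq ?add0r; last first.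
  by move=> i; rewrite mem_index_iota => /andP[ji /andP[_ ij]]; move: ij; rewrite ltnNge ji.
rewrite -{1}(add0n (nat_of_ord j)) big_addn -subSn //.
apply: eq_big => [i|i _]; first by rewrite leq_addl.
by rewrite addnK addnC subnDA.
Qed.

Lemma convA (U V W X Y Z : zmodType)
    (o1 : U -> V -> X) (o2 : X -> W -> Z) (o3 : V -> W -> Y) (o4 : U -> Y -> Z)
    a b c :
  (forall w, {morph o2^~ w : x y / x + y}) ->
  (forall w, o2 0 w = 0) ->
  (forall u, {morph o4 u : x y / x + y}) ->
  (forall u, o4 u 0 = 0) ->
  (forall u v w, o2 (o1 u v) w = o4 u (o3 v w)) ->
  conv o2 (conv o1 a b) c = conv o4 a (conv o3 b c).
Proof.
move=> o2D o20 o4D o40 E; apply/funext => n; rewrite /conv.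
transitivity (\sum_(i < n.+1) \sum_(j < i.+1) 
    o2 (o1 (a j) (b (i - j)%N)) (c (n - i)%N)).
  by apply: eq_bigr => i _; apply: (big_morph (o2^~ _) (o2D _) (o20 _)).
rewrite (sum_assoc (fun i j k => o2 (o1 (a i) (b j)) (c k))).
apply: eq_bigr => i _.
rewrite (big_morph (o4 (a i)) (o4D _) (o40 _)).
by apply: eq_bigr => j _; rewrite E.
Qed.

Lemma convDl (U V W : zmodType) (op : U -> V -> W) a b c :
  (forall v, {morph op^~ v : x y / x + y}) ->
  conv op (a + b) c = conv op a c + conv op b c.
Proof.
move=> opD; apply/funext => n; rewrite serD /conv -big_split.
by apply: eq_bigr => i _; rewrite serD opD.
Qed.

Lemma convDr (U V W : zmodType) (op : U -> V -> W) a b c :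
  (forall u, {morph op u : x y / x + y}) ->
  conv op a (b + c) = conv op a b + conv op a c.
Proof.
move=> opD; apply/funext => n; rewrite serD /conv -big_split.
by apply: eq_bigr => i _; rewrite serD opD.
Qed.

End Conv.

Section PowerSeriesRing.
Variable k : fieldType.
Notation fps := (ser k).

Let mul : fps -> fps -> fps := conv *%R.

Let mulA : associative mul.
Proof.
move=> a b c; symmetry; apply: convA => [w x y|w|u x y|u|u v w].
- exact: mulrDl.
- exact: mul0r.
- exact: mulrDr.
- exact: mulr0.
- by rewrite mulrA.
Qed.

Let mulC : commutative mul.
Proof.
move=> a b; apply/funext => n; rewrite /mul conv_rev.
by apply: eq_bigr => i _; rewrite mulrC.
Qed.

Let mul1 : left_id (sconst (1 : k)) mul.
Proof.
move=> a; rewrite /mul conv_const_l; last exact: mul0r.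
by apply/funext => n; rewrite mul1r.
Qed.

Let mulD : left_distributive mul +%R.
Proof. by move=> a b c; apply: convDl => v x y; apply: mulrDl. Qed.

Let oneN0 : sconst (1 : k) != 0.
Proof. by apply/eqP => /(congr1 (fun f : ser k => f 0)) /eqP; rewrite oner_eq0. Qed.

HB.instance Definition _ :=
  GRing.Zmodule_isComNzRing.Build (ser k) mulA mulC mul1 mulD oneN0.

Definition hbar : fps := fun n => (n == 1)%:R.

Lemma fpsM (a b : fps) : a * b = conv *%R a b. Proof. by []. Qed.
Lemma fps1 : (1 : fps) = sconst 1. Proof. by []. Qed.

End PowerSeriesRing.
Arguments hbar {k}.

Section PowerSeriesModule.
Variables (k : fieldType) (V : lmodType k).

Let scale : ser k -> ser V -> ser V := conv *:%R.

Let scaleA a b v : scale a (scale b v) = scale (a * b) v.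
Proof.
rewrite /scale fpsM; symmetry; apply: convA => [w x y|w|u x y|u|u x w].
- exact: scalerDl.
- exact: scale0r.
- exact: scalerDr.
- exact: scaler0.
- by rewrite scalerA.
Qed.

Let scale1 : left_id 1 scale.
Proof.
move=> v; rewrite /scale fps1 conv_const_l; last exact: scale0r.
by apply/funext => n; rewrite scale1r.
Qed.

Let scaleDr : right_distributive scale +%R.
Proof. by move=> c a b; apply: convDr => u x y; apply: scalerDr. Qed.

Let scaleDl v : {morph scale^~ v : a b / a + b}.
Proof. by move=> a b; apply: convDl => u x y; apply: scalerDl. Qed.

HB.instance Definition _ :=
  GRing.Zmodule_isLmodule.Build (ser k) (ser V) scaleA scale1 scaleDr scaleDl.

Lemma serZ (c : ser k) (v : ser V) : c *: v = conv *:%R c v. Proof. by []. Qed.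

End PowerSeriesModule.

Record poisson (k : fieldType) (A : comAlgType k) := Poisson {
  pbr :> A -> A -> A;
  pbr_lin : forall (c : k) f g h, pbr (c *: f + g) h = c *: pbr f h + pbr g h;
  pbr_alt : forall f, pbr f f = 0;
  pbr_jacobi : forall f g h, pbr f (pbr g h) + pbr g (pbr h f) + pbr h (pbr f g) = 0;
  pbr_leibniz : forall f g h, pbr f (g * h) = pbr f g * h + g * pbr f h }.

(* Differential operators of order at most [n] in the sense of Grothendieck
   (for a linear map [P]). *)
Fixpoint diffop (A : comPzRingType) (n : nat) (P : A -> A) : Prop :=
  match n with
  | 0 => forall a f, P (a * f) - a * P f = 0
  | n'.+1 => forall a, diffop n' (fun f => P (a * f) - a * P f)
  end.

(* The C[[hbar]]-bilinear hbar-adically continuous extension to A[[hbar]] of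
   f * g = \sum_k D k f g hbar^k. *)
Definition star_mul (A : zmodType) (D : nat -> A -> A -> A) (a b : ser A) :
    ser A :=
  fun n => \sum_(k < n.+1) conv (D k) a b (n - k)%N.

(* The unit of the star product is not required to be the unit of A. *)
Record defquant (k : fieldType) (A : comAlgType k) (br : poisson A) :=
    DefQuant {
  dq_coef : nat -> A -> A -> A;
  dq_one : ser A;
  dq_linl : forall n (c : k) f g h,
    dq_coef n (c *: f + g) h = c *: dq_coef n f h + dq_coef n g h;
  dq_linr : forall n (c : k) f g h,
    dq_coef n f (c *: g + h) = c *: dq_coef n f g + dq_coef n f h;
  dq_diffl : forall n g, diffop n (fun f => dq_coef n f g);
  dq_diffr : forall n f, diffop n (dq_coef n f);
  dq_coef0 : forall f g, dq_coef 0 f g = f * g;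
  dq_coef1 : forall f g, dq_coef 1 f g - dq_coef 1 g f = br f g;
  dq_mulA : associative (star_mul dq_coef);
  dq_mul1 : left_id dq_one (star_mul dq_coef);
  dq_1mul : right_id dq_one (star_mul dq_coef) }.

Definition Ahbar (k : fieldType) (A : comAlgType k) (br : poisson A)
  (Q : defquant br) : Type := ser A.

Section AhbarAlgebra.
Variables (k : fieldType) (A : comAlgType k) (br : poisson A).
Variable (Q : defquant br).
Let D := dq_coef Q.

HB.instance Definition _ := GRing.Lmodule.on (Ahbar Q).

Let DDl n g : {morph (D n)^~ g : x y / x + y}.
Proof. by move=> x y; have := dq_linl Q n 1 x y g; rewrite !scale1r. Qed.
Let DDr n f : {morph D n f : x y / x + y}.
Proof. by move=> x y; have := dq_linr Q n 1 f x y; rewrite !scale1r. Qed.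
Let D0l n g : D n 0 g = 0.
Proof. by apply: (addrI (D n 0 g)); rewrite -DDl !addr0. Qed.
Let D0r n f : D n f 0 = 0.
Proof. by apply: (addrI (D n f 0)); rewrite -DDr !addr0. Qed.
Let DZl n c f g : D n (c *: f) g = c *: D n f g.
Proof. by have := dq_linl Q n c f 0 g; rewrite -/D D0l !addr0. Qed.
Let DZr n c f g : D n f (c *: g) = c *: D n f g.
Proof. by have := dq_linr Q n c f g 0; rewrite -/D D0r !addr0. Qed.

Let mulDl : left_distributive (star_mul D) (@GRing.add (ser A)).
Proof.
move=> a b c; apply/funext => n; rewrite serD /star_mul -big_split.
by apply: eq_bigr => i _; rewrite convDl // => v x y; apply: DDl.
Qed.

Let mulDr : right_distributive (star_mul D) (@GRing.add (ser A)).
Proof.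
move=> a b c; apply/funext => n; rewrite serD /star_mul -big_split.
by apply: eq_bigr => i _; rewrite convDr // => v x y; apply: DDr.
Qed.

HB.instance Definition _ := GRing.Zmodule_isPzRing.Build (Ahbar Q)
  (dq_mulA Q) (dq_mul1 Q) (dq_1mul Q) mulDl mulDr.

Let sum_exch (f : nat -> nat -> A) n :
  \sum_(i < n.+1) \sum_(j < (n - i).+1) f i j =
  \sum_(j < n.+1) \sum_(i < (n - j).+1) f i j.
Proof.
have e (g : nat -> nat -> A) : \sum_(i < n.+1) \sum_(j < (n - i).+1) g i j =
    \sum_(i < n.+1) \sum_(j < n.+1 | (i + j <= n)%N) g i j.
  apply: eq_bigr => i _; have lein : (i <= n)%N by rewrite -ltnS.
  rewrite (big_ord_widen n.+1 (g i)) ?ltnS ?leq_subr //.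
  by apply: eq_bigl => j; rewrite ltnS leq_subRL.
rewrite e (e (fun j i => f i j)) (exchange_big_dep xpredT) //=.
by apply: eq_bigr => j _; apply: eq_bigl => i; rewrite addnC.
Qed.

Let convZl n (c : ser k) (a b : ser A) :
  conv (D n) (c *: a) b = c *: conv (D n) a b.
Proof.
rewrite !serZ; apply: convA => [w x y|w|u x y|u|u v w].
- exact: DDl.
- exact: D0l.
- exact: scalerDr.
- exact: scaler0.
- exact: DZl.
Qed.

Let conv_flip n (a b : ser A) : conv (D n) a b = conv (fun y x => D n x y) b a.
Proof. by apply/funext => m; rewrite conv_rev. Qed.

Let convZr n (c : ser k) (a b : ser A) :
  conv (D n) a (c *: b) = c *: conv (D n) a b.
Proof.
rewrite !conv_flip !serZ; apply: convA => [w x y|w|u x y|u|u v w].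
- exact: DDr.
- exact: D0r.
- exact: scalerDr.
- exact: scaler0.
- exact: DZr.
Qed.

Let scale_star (c : ser k) (a b : ser A) n :
  \sum_(i < n.+1) (c *: conv (D i) a b) (n - i)%N =
  (c *: (star_mul D a b : ser A)) n.
Proof.
rewrite serZ /conv /star_mul.
rewrite (sum_exch (fun i j => c j *: conv (D i) a b (n - i - j)%N)).
apply: eq_bigr => j _; rewrite scaler_sumr; apply: eq_bigr => i _.
by rewrite subnAC.
Qed.

Let starZl (c : ser k) (a b : Ahbar Q) : (c *: a) * b = c *: (a * b).
Proof.
apply/funext => n; rewrite -[RHS]scale_star; apply: eq_bigr => i _.
by rewrite convZl.
Qed.

Let starZr (c : ser k) (a b : Ahbar Q) : a * (c *: b) = c *: (a * b).
Proof.
apply/funext => n; rewrite -[RHS]scale_star; apply: eq_bigr => i _.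
by rewrite convZr.
Qed.

Let sc (c : ser k) : Ahbar Q := c *: (1 : Ahbar Q).

Let scD : {morph sc : x y / x + y}. Proof. by move=> x y; apply: scalerDl. Qed.
Let scM : {morph sc : x y / x * y}.
Proof. by move=> x y; rewrite /sc starZl mul1r scalerA. Qed.
Let sc1 : sc 1 = 1. Proof. exact: scale1r. Qed.
Let scC c v : sc c * v = v * sc c.
Proof. by rewrite /sc starZl starZr mul1r mulr1. Qed.

HB.instance Definition _ :=
  PzRing_isAlgOver.Build (ser k) (Ahbar Q) scD scM sc1 scC.

End AhbarAlgebra.
Definition alg_char (k : fieldType) (O : comAlgType k) (chi : O -> k) : Prop :=
  [/\ forall (c : k) f g, chi (c *: f + g) = c * chi f + chi g,
      forall f g, chi (f * g) = chi f * chi g & chi 1 = 1].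

(* An affine algebraic group over an algebraically closed field [k], as a
   variety: the group of points, the algebra of regular functions, finitely
   generated and reduced, and the evaluation of functions at points. *)
Record algGroup (k : fieldType) := AlgGroup {
  pts :> groupType;
  coord : comAlgType k;
  ev : pts -> coord -> k;
  ev_char : forall x, alg_char (ev x);
  ev_inj : forall x y, (forall f, ev x f = ev y f) -> x = y;
  ev_surj : forall chi, alg_char chi -> exists x, forall f, ev x f = chi f;
  coord_reduced : forall f, (forall x, ev x f = 0) -> f = 0;
  coord_fg : exists s : seq coord, forall P : coord -> Prop,
    (forall f, f \in s -> P f) -> P 1 ->
    (forall (c : k) f g, P f -> P g -> P (c *: f + g)) ->
    (forall f g, P f -> P g -> P (f * g)) -> forall f, P f;
  ev_mul : forall f, exists s : seq (coord * coord), forall x y,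
    ev (x * y)%g f = \sum_(p <- s) ev x p.1 * ev y p.2;
  ev_inv : forall f, exists f', forall x, ev x f' = ev x^-1%g f }.

Definition regular_map (k : fieldType) (G H : algGroup k) (phi : G -> H) : Prop :=
  forall f : coord H, exists f' : coord G, forall x, ev x f' = ev (phi x) f.

Record agHom (k : fieldType) (G H : algGroup k) := AgHom {
  hom_fun :> G -> H;
  homM : forall x y, hom_fun (x * y)%g = (hom_fun x * hom_fun y)%g;
  hom_reg : regular_map hom_fun }.

(* The inclusion of a closed subgroup. *)
Definition closed_embedding (k : fieldType) (H G : algGroup k)
    (i : agHom H G) : Prop :=
  forall f : coord H, exists f' : coord G, forall x, ev (i x) f' = ev x f.

(* [G] is the semidirect product of its closed subgroups [H] (normal) and [K]:
   the multiplication H * K -> G is an isomorphism of varieties. *)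
Definition semidirect (k : fieldType) (H K G : algGroup k)
    (iH : agHom H G) (iK : agHom K G) : Prop :=
  [/\ closed_embedding iH, closed_embedding iK,
      forall (g : G) (h : H), exists h' : H, (g * iH h * g^-1)%g = iH h' &
      exists (pH : G -> H) (pK : G -> K),
        [/\ regular_map pH, regular_map pK,
            forall g, (iH (pH g) * iK (pK g))%g = g,
            forall h k, pH (iH h * iK k)%g = h &
            forall h k, pK (iH h * iK k)%g = k]].

Section CoordinateAlgebra.
Variables (k : fieldType) (G : algGroup k).

Lemma evD (x : G) f g : ev x (f + g) = ev x f + ev x g.
Proof. by have [L _ _] := ev_char x; have := L 1 f g; rewrite scale1r mul1r. Qed.
Lemma ev0 (x : G) : ev x 0 = 0.
Proof. by apply: (addrI (ev x 0)); rewrite -evD !addr0. Qed.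
Lemma evZ (x : G) c f : ev x (c *: f) = c * ev x f.
Proof. by have [L _ _] := ev_char x; have := L c f 0; rewrite ev0 !addr0. Qed.
Lemma evM (x : G) f g : ev x (f * g) = ev x f * ev x g.
Proof. by have [_ ->] := ev_char x. Qed.
Lemma ev1 (x : G) : ev x 1 = 1.
Proof. by have [_ _ ->] := ev_char x. Qed.
Lemma ev_sum (x : G) I (r : seq I) (F : I -> coord G) :
  ev x (\sum_(i <- r) F i) = \sum_(i <- r) ev x (F i).
Proof. exact: (big_morph _ (evD x) (ev0 x)). Qed.

Lemma ev_ext (f g : coord G) : (forall x, ev x f = ev x g) -> f = g.
Proof.
move=> fg; apply/eqP; rewrite -subr_eq0; apply/eqP/coord_reduced => x.
by rewrite -[- g]scaleN1r evD evZ fg mulN1r subrr.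
Qed.

(* Comultiplication: a decomposition of f (x y), not unique. *)
Definition comul (f : coord G) : seq (coord G * coord G) :=
  projT1 (cid (ev_mul f)).
Lemma comulE f (x y : G) :
  ev (x * y)%g f = \sum_(p <- comul f) ev x p.1 * ev y p.2.
Proof. exact: (projT2 (cid (ev_mul f))). Qed.

End CoordinateAlgebra.

Section LieAlgebra.
Variables (k : fieldType) (G : algGroup k).

Definition point_derivation (delta : coord G -> k) : Prop :=
  (forall (c : k) f g, delta (c *: f + g) = c * delta f + delta g) /\
  (forall f g, delta (f * g) = delta f * ev 1%g g + ev 1%g f * delta g).

Definition pder : {pred (coord G -> k^o)} := fun delta => `[< point_derivation delta >].

Lemma pder_submod_closed : submod_closed pder.
Proof.
split=> [|c u v /asboolP[uL uM] /asboolP[vL vM]]; last have E f :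
    (c *: u + v) f = c * u f + v f by [].
all: apply/asboolP; split.
- by move=> c f g; rewrite mulr0 addr0.
- by move=> f g; rewrite mul0r mulr0 addr0.
- by move=> a f g; rewrite !E uL vL; ring.
- by move=> f g; rewrite !E uM vM; ring.
Qed.
HB.instance Definition _ :=
  GRing.isSubmodClosed.Build k (coord G -> k^o) pder pder_submod_closed.

(* The Lie algebra of [G]: the tangent space at the identity. *)
Record lie := Lie { lie_fun :> coord G -> k^o; _ : lie_fun \in pder }.
HB.instance Definition _ := [isSub for lie_fun].
HB.instance Definition _ := [Choice of lie by <:].
HB.instance Definition _ := [SubChoice_isSubLmodule of lie by <:].

Lemma lieP (x : lie) : point_derivation x.
Proof. by apply/asboolP; case: x. Qed.
Lemma lieD (x : lie) f g : x (f + g) = x f + x g.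
Proof. by have [L _] := lieP x; have := L 1 f g; rewrite scale1r mul1r. Qed.
Lemma lie0 (x : lie) : x 0 = 0.
Proof. by apply: (addrI (x 0)); rewrite -lieD !addr0. Qed.
Lemma lieZ (x : lie) c f : x (c *: f) = c * x f.
Proof. by have [L _] := lieP x; have := L c f 0; rewrite lie0 !addr0. Qed.
Lemma lieM (x : lie) f g : x (f * g) = x f * ev 1%g g + ev 1%g f * x g.
Proof. by have [_] := lieP x. Qed.
Lemma lie_sum (x : lie) I (r : seq I) (F : I -> coord G) :
  x (\sum_(i <- r) F i) = \sum_(i <- r) x (F i).
Proof. exact: (big_morph _ (lieD x) (lie0 x)). Qed.

(* Applying [x] in the first variable and [y] in the second one to a function
   on G * G does not depend on its decomposition. *)
Lemma lie_tensor (x y : lie) (s t : seq (coord G * coord G)) :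
  (forall a b, \sum_(p <- s) ev a p.1 * ev b p.2 =
               \sum_(p <- t) ev a p.1 * ev b p.2) ->
  \sum_(p <- s) x p.1 * y p.2 = \sum_(p <- t) x p.1 * y p.2.
Proof.
move=> st.
have h1 a : \sum_(p <- s) ev a p.1 *: p.2 = \sum_(p <- t) ev a p.1 *: p.2.
  apply: ev_ext => b; rewrite !ev_sum.
  by under eq_bigr do rewrite evZ; under [RHS]eq_bigr do rewrite evZ.
have h2 : \sum_(p <- s) y p.2 *: p.1 = \sum_(p <- t) y p.2 *: p.1.
  apply: ev_ext => a; rewrite !ev_sum.
  under eq_bigr do rewrite evZ mulrC -lieZ.
  under [RHS]eq_bigr do rewrite evZ mulrC -lieZ.
  by rewrite -!lie_sum h1.
have := congr1 x h2; rewrite !lie_sum.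
by under eq_bigr do rewrite lieZ mulrC; under [RHS]eq_bigr do rewrite lieZ mulrC.
Qed.

Definition tens (x y : lie) (f : coord G) : k := \sum_(p <- comul f) x p.1 * y p.2.

Lemma tensE x y f s :
  (forall a b : G, ev (a * b)%g f = \sum_(p <- s) ev a p.1 * ev b p.2) ->
  tens x y f = \sum_(p <- s) x p.1 * y p.2.
Proof. by move=> fs; apply: lie_tensor => a b; rewrite -comulE fs. Qed.

Lemma comul_counitl f : \sum_(p <- comul f) ev (1 : G)%g p.1 *: p.2 = f.
Proof.
apply: ev_ext => b; rewrite ev_sum -[in RHS](mul1g b) comulE.
by apply: eq_bigr => p _; rewrite evZ.
Qed.
Lemma comul_counitr f : \sum_(p <- comul f) ev (1 : G)%g p.2 *: p.1 = f.
Proof.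
apply: ev_ext => b; rewrite ev_sum -[in RHS](mulg1 b) comulE.
by apply: eq_bigr => p _; rewrite evZ mulrC.
Qed.

Lemma tens_lin x y c f g : tens x y (c *: f + g) = c * tens x y f + tens x y g.
Proof.
rewrite (@tensE _ _ _ ([seq (c *: p.1, p.2) | p <- comul f] ++ comul g)).
  rewrite big_cat big_map /= mulr_sumr; congr (_ + _).
  by apply: eq_bigr => p _; rewrite lieZ mulrA.
move=> a b; rewrite big_cat big_map /= evD evZ !comulE mulr_sumr.
by congr (_ + _); apply: eq_bigr => p _; rewrite evZ mulrA.
Qed.

Lemma tensM x y f g : tens x y (f * g) =
  tens x y f * ev 1%g g + ev 1%g f * tens x y g + (x f * y g + y f * x g).
Proof.
rewrite (@tensE _ _ _ [seq (p.1 * q.1, p.2 * q.2) | p <- comul f, q <- comul g]).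
  have Ef (z : lie) : z f = \sum_(p <- comul f) ev (1 : G)%g p.2 * z p.1.
    rewrite -{1}(comul_counitr f) lie_sum.
    by apply: eq_bigr => p _; rewrite lieZ.
  have Ef' (z : lie) : z f = \sum_(p <- comul f) ev (1 : G)%g p.1 * z p.2.
    rewrite -{1}(comul_counitl f) lie_sum.
    by apply: eq_bigr => p _; rewrite lieZ.
  have Eg (z : lie) : z g = \sum_(p <- comul g) ev (1 : G)%g p.2 * z p.1.
    rewrite -{1}(comul_counitr g) lie_sum.
    by apply: eq_bigr => p _; rewrite lieZ.
  have Eg' (z : lie) : z g = \sum_(p <- comul g) ev (1 : G)%g p.1 * z p.2.
    rewrite -{1}(comul_counitl g) lie_sum.
    by apply: eq_bigr => p _; rewrite lieZ.
  have E1 h : ev 1%g h = \sum_(p <- comul h) ev (1 : G)%g p.1 * ev (1 : G)%g p.2.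
    by rewrite -comulE mul1g.
  rewrite big_allpairs_dep /= {1}(Ef x) (Eg' y) (Ef' y) {1}(Eg x) (E1 f) (E1 g).
  rewrite /tens !big_distrlr /= -!big_split /=; apply: eq_bigr => p _.
  rewrite -!big_split /=; apply: eq_bigr => q _; rewrite !lieM.
  ring.
move=> a b; rewrite big_allpairs_dep /= evM !comulE big_distrlr /=.
by apply: eq_bigr => p _; apply: eq_bigr => q _; rewrite !evM mulrACA.
Qed.

Definition bracket_fun (x y : lie) (f : coord G) : k^o := tens x y f - tens y x f.

Lemma bracket_subproof x y : bracket_fun x y \in pder.
Proof.
apply/asboolP; split=> [c f g|f g]; rewrite /bracket_fun.
  by rewrite !tens_lin mulrBr opprD addrACA.
by rewrite !tensM; ring.
Qed.

(* [x, y] = (x (x) y - y (x) x) o comultiplication, that is the commutator of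
   the associated left invariant derivations, evaluated at the identity. *)
Definition bracket (x y : lie) : lie := Lie (bracket_subproof x y).

End LieAlgebra.
Arguments lie {k} G.

Section Differential.
Variables (k : fieldType) (G H : algGroup k) (phi : agHom G H).

Definition pullback (f : coord H) : coord G := projT1 (cid (hom_reg phi f)).
Lemma pullbackE f x : ev x (pullback f) = ev (phi x) f.
Proof. exact: (projT2 (cid (hom_reg phi f))). Qed.

Lemma hom1 : phi 1%g = 1%g.
Proof. by apply: (mulgI (phi 1%g)); rewrite -homM !mulg1. Qed.

Lemma diff_subproof (x : lie G) : (fun f => x (pullback f)) \in @pder _ H.
Proof.
apply/asboolP; split=> [c f g|f g].
  rewrite -lieZ -lieD; congr (x _); apply: ev_ext => a.
  by rewrite evD evZ !pullbackE evD evZ.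
have -> : pullback (f * g) = pullback f * pullback g.
  by apply: ev_ext => a; rewrite evM !pullbackE evM.
by rewrite lieM !pullbackE hom1.
Qed.

Definition diff (x : lie G) : lie H := Lie (diff_subproof x).

End Differential.

Section Adjoint.
Variables (k : fieldType) (G : algGroup k) (g : G).

Definition conj (x : G) : G := (g * x * g^-1)%g.

Lemma conjM x y : conj (x * y)%g = (conj x * conj y)%g.
Proof. by rewrite /conj !mulgA mulgVK. Qed.

Lemma conj_reg : regular_map conj.
Proof.
move=> f.
exists (\sum_(p <- comul f) ev g^-1%g p.2 *:
          (\sum_(q <- comul p.1) ev g q.1 *: q.2)) => x.
rewrite ev_sum comulE; apply: eq_bigr => p _.
rewrite evZ ev_sum mulrC comulE; congr (_ * _).
by apply: eq_bigr => q _; rewrite evZ.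
Qed.

Definition lieAd : lie G -> lie G := diff (AgHom conjM conj_reg).

End Adjoint.
Inductive uterm (L K : Type) : Type :=
  | UVar of L | UScal of K
  | UAdd of uterm L K & uterm L K | UMul of uterm L K & uterm L K.

Section Enveloping.
Variables (k : fieldType) (L : lmodType k) (brk : L -> L -> L).
Notation fps := (ser k).
Notation term := (uterm L fps).
Notation "s +u t" := (UAdd s t) (at level 50, left associativity).
Notation "s *u t" := (UMul s t) (at level 40, left associativity).
Notation V := (@UVar L fps).
Notation S := (@UScal L fps).

(* The enveloping algebra of L (x) C[[hbar]] with bracket hbar [_, _], presented
   by the elements of L as generators over C[[hbar]]: terms modulo the smallest
   congruence for which they form an algebra over C[[hbar]], L maps to it
   C-linearly, and x y = y x + hbar [x, y]. *)
Inductive ueq : term -> term -> Prop :=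
  | ueq_refl s : ueq s s
  | ueq_sym s t : ueq s t -> ueq t s
  | ueq_trans s t u : ueq s t -> ueq t u -> ueq s u
  | ueq_add s s' t t' : ueq s s' -> ueq t t' -> ueq (s +u t) (s' +u t')
  | ueq_mul s s' t t' : ueq s s' -> ueq t t' -> ueq (s *u t) (s' *u t')
  | ueq_addA s t u : ueq (s +u (t +u u)) (s +u t +u u)
  | ueq_addC s t : ueq (s +u t) (t +u s)
  | ueq_add0 s : ueq (S 0 +u s) s
  | ueq_addN s : ueq (S (- 1) *u s +u s) (S 0)
  | ueq_mulA s t u : ueq (s *u (t *u u)) (s *u t *u u)
  | ueq_mul1 s : ueq (S 1 *u s) s
  | ueq_mulDl s t u : ueq ((s +u t) *u u) (s *u u +u t *u u)
  | ueq_mulDr s t u : ueq (s *u (t +u u)) (s *u t +u s *u u)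
  | ueq_scalD c d : ueq (S (c + d)) (S c +u S d)
  | ueq_scalM c d : ueq (S (c * d)) (S c *u S d)
  | ueq_scalC c s : ueq (S c *u s) (s *u S c)
  | ueq_var (c : k) x y : ueq (V (c *: x + y)) (S (sconst c) *u V x +u V y)
  | ueq_bracket x y : ueq (V x *u V y) (V y *u V x +u S hbar *u V (brk x y)).

HB.instance Definition _ := gen_eqMixin term.
HB.instance Definition _ := gen_choiceMixin term.

Definition ueqb (s t : term) : bool := `[< ueq s t >].

Let ueqb_refl : reflexive ueqb.
Proof. by move=> s; apply/asboolP/ueq_refl. Qed.
Let ueqb_sym : symmetric ueqb.
Proof. by move=> s t; apply/asboolP/asboolP => /ueq_sym. Qed.
Let ueqb_trans : transitive ueqb.
Proof. by move=> t s u /asboolP st /asboolP tu; apply/asboolP/(ueq_trans st tu). Qed.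

Canonical ueqb_equiv := EquivRel ueqb ueqb_refl ueqb_sym ueqb_trans.

Definition Uh : Type := {eq_quot ueqb_equiv}%qT.
HB.instance Definition _ := Choice.on Uh.
HB.instance Definition _ : EqQuotient _ ueqb_equiv Uh := EqQuotient.on Uh.

Let cl (t : term) : Uh := (\pi_Uh t)%qT.

Let clP s t : (cl s = cl t) <-> ueq s t.
Proof. by split=> [/eqmodP/asboolP|st] //; apply/eqmodP/asboolP. Qed.

Let clK s : ueq (repr (cl s)) s.
Proof. by apply/clP; rewrite /cl reprK. Qed.

Let uadd (a b : Uh) : Uh := cl (repr a +u repr b).
Let umul (a b : Uh) : Uh := cl (repr a *u repr b).

Let uaddE s t : uadd (cl s) (cl t) = cl (s +u t).
Proof. by apply/clP; apply: ueq_add; apply: clK. Qed.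
Let umulE s t : umul (cl s) (cl t) = cl (s *u t).
Proof. by apply/clP; apply: ueq_mul; apply: clK. Qed.

Let uind (P : Uh -> Prop) : (forall s, P (cl s)) -> forall a, P a.
Proof. by move=> Ps a; rewrite -[a]reprK; apply: Ps. Qed.

Let uaddA : associative uadd.
Proof.
elim/uind=> s; elim/uind=> t; elim/uind=> u.
by rewrite !uaddE; apply/clP/ueq_addA.
Qed.
Let uaddC : commutative uadd.
Proof. by elim/uind=> s; elim/uind=> t; rewrite !uaddE; apply/clP/ueq_addC. Qed.
Let uadd0 : left_id (cl (S 0)) uadd.
Proof. by elim/uind=> s; rewrite !uaddE; apply/clP/ueq_add0. Qed.
Let uaddN : left_inverse (cl (S 0)) (fun a => cl (S (- 1) *u repr a)) uadd.
Proof.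
elim/uind=> s; rewrite uaddE; apply/clP.
apply: ueq_trans (ueq_addN s); apply: ueq_add; last exact: ueq_refl.
by apply: ueq_mul; [apply: ueq_refl | apply: clK].
Qed.
HB.instance Definition _ :=
  GRing.isZmodule.Build Uh uaddA uaddC uadd0 uaddN.

Let umulA : associative umul.
Proof.
elim/uind=> s; elim/uind=> t; elim/uind=> u.
by rewrite !umulE; apply/clP/ueq_mulA.
Qed.
Let umul1 : left_id (cl (S 1)) umul.
Proof. by elim/uind=> s; rewrite !umulE; apply/clP/ueq_mul1. Qed.
Let u1mul : right_id (cl (S 1)) umul.
Proof.
elim/uind=> s; rewrite !umulE; apply/clP.
exact: ueq_trans (ueq_sym (ueq_scalC 1 s)) (ueq_mul1 s).
Qed.
Let umulDl : left_distributive umul uadd.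
Proof.
elim/uind=> s; elim/uind=> t; elim/uind=> u.
by rewrite !(umulE, uaddE); apply/clP/ueq_mulDl.
Qed.
Let umulDr : right_distributive umul uadd.
Proof.
elim/uind=> s; elim/uind=> t; elim/uind=> u.
by rewrite !(umulE, uaddE); apply/clP/ueq_mulDr.
Qed.
HB.instance Definition _ :=
  GRing.Zmodule_isPzRing.Build Uh umulA umul1 u1mul umulDl umulDr.

Let uscal (c : fps) : Uh := cl (S c).
Let uscalD : {morph uscal : c d / c + d}.
Proof. by move=> c d; rewrite /uscal [RHS]uaddE; apply/clP/ueq_scalD. Qed.
Let uscalM : {morph uscal : c d / c * d}.
Proof. by move=> c d; rewrite /uscal [RHS]umulE; apply/clP/ueq_scalM. Qed.
Let uscal1 : uscal 1 = 1. Proof. by []. Qed.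
Let uscalC c a : uscal c * a = a * uscal c.
Proof.
elim/uind: a => s; rewrite /uscal [LHS]umulE [RHS]umulE.
by apply/clP/ueq_scalC.
Qed.
HB.instance Definition _ :=
  PzRing_isAlgOver.Build fps Uh uscalD uscalM uscal1 uscalC.

Definition uvar (x : L) : Uh := cl (V x).

Section Extension.
Variables (B : algOverType fps) (Phi : L -> B).

Fixpoint ueval (t : term) : B :=
  match t with
  | UVar x => Phi x
  | UScal c => inalg c
  | UAdd s t => ueval s + ueval t
  | UMul s t => ueval s * ueval t
  end.

(* Under the two hypotheses below, this is the algebra morphism from U_hbar(g)
   that extends [Phi]; see [uextP]. *)
Definition uext (u : Uh) : B := ueval (repr u).

Hypothesis PhiL : forall (c : k) x y,
  Phi (c *: x + y) = inalg (sconst c) * Phi x + Phi y.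
Hypothesis PhiM : forall x y,
  Phi x * Phi y - Phi y * Phi x = inalg hbar * Phi (brk x y).

Let inalg0 : inalg 0 = 0 :> B.
Proof. by apply: (addrI (inalg 0)); rewrite -inalgD !addr0. Qed.

Lemma ueval_ueq s t : ueq s t -> ueval s = ueval t.
Proof.
elim=> {s t} //=.
- by move=> s t u _ -> _ ->.
- by move=> s s' t t' _ -> _ ->.
- by move=> s s' t t' _ -> _ ->.
- by move=> s t u; rewrite addrA.
- by move=> s t; rewrite addrC.
- by move=> s; rewrite inalg0 add0r.
- move=> s; have -> : inalg (- 1) = - 1 :> B.
    by apply: (addrI (inalg 1)); rewrite -inalgD subrr inalg0 inalg1 subrr.
  by rewrite mulN1r addNr inalg0.
- by move=> s t u; rewrite mulrA.
- by move=> s; rewrite inalg1 mul1r.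
- by move=> s t u; rewrite mulrDl.
- by move=> s t u; rewrite mulrDr.
- by move=> c d; rewrite inalgD.
- by move=> c d; rewrite inalgM.
- by move=> c s; rewrite inalgC.
- by move=> x y; rewrite -PhiM addrC subrK.
Qed.

Lemma uextP : [/\ {morph uext : u v / u + v}, {morph uext : u v / u * v},
  uext 1 = 1, preserves_scalars uext & forall x, uext (uvar x) = Phi x].
Proof.
have uextE t : uext (cl t) = ueval t by apply/ueval_ueq/clK.
split.
- by move=> u v; apply: uextE.
- by move=> u v; apply: uextE.
- by rewrite [LHS]uextE /= inalg1.
- by move=> c; apply: uextE.
- by move=> x; apply: uextE.
Qed.

End Extension.

End Enveloping.

Definition lideal (B : pzRingType) (X : set B) : set B :=
  [set b | exists n (u x : 'I_n -> B),
    (forall i, X (x i)) /\ b = \sum_i u i * x i].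

Definition ideal2 (B : pzRingType) (X : set B) : set B :=
  [set b | exists n (u x v : 'I_n -> B),
    (forall i, X (x i)) /\ b = \sum_i u i * x i * v i].

Definition coset (B : zmodType) (N : set B) (a : B) : set B :=
  [set b | N (b - a)].

Section Subquotient.
Variables (k : pzRingType) (B : algOverType k).

(* The classes modulo [N] of the elements of [S] form an algebra, with product
   (a + N) (b + N) = a b + N. *)
Record subquo_alg (S N : set B) : Prop := SubquoAlg {
  sqNS : (N `<=` S)%classic;
  sqN0 : N 0;
  sqNB : forall a b, N a -> N b -> N (a - b);
  sqNl : forall a b, S a -> N b -> N (a * b);
  sqNr : forall a b, N a -> S b -> N (a * b);
  sqSB : forall a b, S a -> S b -> S (a - b);
  sqSM : forall a b, S a -> S b -> S (a * b);
  sqSc : forall c, S (inalg c) }.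

Variables (S N : set B).

(* The set of the cosets a + N with a in S; [reps X] is the coset X itself, as
   the set of its representatives. *)
Record subquo (w : subquo_alg S N) := Subquo {
  reps : set B;
  _ : `[< exists2 a, S a & reps = coset N a >] }.

Variable w : subquo_alg S N.
Notation Q := (subquo w).
HB.instance Definition _ := [isSub for @reps w].
HB.instance Definition _ := gen_eqMixin Q.
HB.instance Definition _ := gen_choiceMixin Q.

Let rep (X : Q) : exists2 a, S a & reps X = coset N a.
Proof. by case: X => X /= /asboolP. Qed.

Let mk a (Sa : S a) : Q := @Subquo w (coset N a) (asboolT (ex_intro2 _ _ a Sa erefl)).

Let r (X : Q) : B := projT1 (cid2 (rep X)).
Let rS (X : Q) : S (r X). Proof. by rewrite /r; case: cid2. Qed.
Let rE (X : Q) : reps X = coset N (r X). Proof. by rewrite /r; case: cid2. Qed.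

Let N_opp a : N a -> N (- a).
Proof. by move=> Na; rewrite -sub0r; apply: (sqNB w) => //; apply: (sqN0 w). Qed.
Let N_add a b : N a -> N b -> N (a + b).
Proof. by move=> Na Nb; rewrite -[b]opprK; apply: (sqNB w) => //; apply: N_opp. Qed.

Let coset_eq a b : (coset N a = coset N b) <-> N (a - b).
Proof.
split=> [E|Nab].
  have : coset N a a by rewrite /coset /= subrr; apply: (sqN0 w).
  by rewrite E.
apply/seteqP; split=> c /= Nc.
- by have := N_add Nc Nab; rewrite addrA subrK.
- by have := sqNB w Nc Nab; rewrite opprB addrA subrK.
Qed.

Let mkE a b (Sa : S a) (Sb : S b) : (mk Sa = mk Sb) <-> N (a - b).
Proof.
split=> [/(congr1 (@reps w))/coset_eq //|Nab].
by apply: val_inj; apply/coset_eq.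
Qed.

Let ind (P : Q -> Prop) : (forall a (Sa : S a), P (mk Sa)) -> forall X, P X.
Proof.
move=> h X; suff -> : X = mk (rS X) by apply: h.
by apply: val_inj; rewrite /= {1}rE.
Qed.

Let rmk a (Sa : S a) : N (r (mk Sa) - a).
Proof. by apply/coset_eq; rewrite -rE. Qed.

Let S0 : S 0. Proof. by apply: (sqNS w); apply: (sqN0 w). Qed.
Let S_opp a : S a -> S (- a).
Proof. by move=> Sa; rewrite -sub0r; apply: (sqSB w). Qed.
Let S_add a b : S a -> S b -> S (a + b).
Proof. by move=> Sa Sb; rewrite -[b]opprK; apply: (sqSB w) => //; apply: S_opp. Qed.
Let S1 : S 1. Proof. by rewrite -(inalg1 (s := B)); apply: (sqSc w). Qed.

Let add (X Y : Q) : Q := mk (S_add (rS X) (rS Y)).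
Let opp (X : Q) : Q := mk (S_opp (rS X)).
Let mul (X Y : Q) : Q := mk (sqSM w (rS X) (rS Y)).

Let addE a b (Sa : S a) (Sb : S b) : add (mk Sa) (mk Sb) = mk (S_add Sa Sb).
Proof.
by apply/mkE; rewrite opprD addrACA; apply: N_add; apply: rmk.
Qed.
Let oppE a (Sa : S a) : opp (mk Sa) = mk (S_opp Sa).
Proof. by apply/mkE; rewrite -opprD; apply/N_opp/rmk. Qed.
Let mulE a b (Sa : S a) (Sb : S b) : mul (mk Sa) (mk Sb) = mk (sqSM w Sa Sb).
Proof.
apply/mkE; set x := r _; set y := r _.
have -> : x * y - a * b = (x - a) * y + a * (y - b).
  by rewrite mulrBl mulrBr addrA subrK.
by apply: N_add; [apply: (sqNr w); [apply: rmk | apply: rS]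
                 | apply: (sqNl w); [| apply: rmk]].
Qed.

Let mk_eq a b (Sa : S a) (Sb : S b) : a = b -> mk Sa = mk Sb.
Proof. by move=> ab; apply/mkE; rewrite ab subrr; apply: (sqN0 w). Qed.

Let addA : associative add.
Proof.
by elim/ind=> a Sa; elim/ind=> b Sb; elim/ind=> c Sc; rewrite !addE; apply/mk_eq/addrA.
Qed.
Let addC : commutative add.
Proof. by elim/ind=> a Sa; elim/ind=> b Sb; rewrite !addE; apply/mk_eq/addrC. Qed.
Let add0 : left_id (mk S0) add.
Proof. by elim/ind=> a Sa; rewrite !addE; apply/mk_eq/add0r. Qed.
Let addN : left_inverse (mk S0) opp add.
Proof. by elim/ind=> a Sa; rewrite oppE addE; apply/mk_eq/addNr. Qed.
HB.instance Definition _ := GRing.isZmodule.Build Q addA addC add0 addN.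

Let mulA : associative mul.
Proof.
by elim/ind=> a Sa; elim/ind=> b Sb; elim/ind=> c Sc; rewrite !mulE; apply/mk_eq/mulrA.
Qed.
Let mul1 : left_id (mk S1) mul.
Proof. by elim/ind=> a Sa; rewrite !mulE; apply/mk_eq/mul1r. Qed.
Let mul1' : right_id (mk S1) mul.
Proof. by elim/ind=> a Sa; rewrite !mulE; apply/mk_eq/mulr1. Qed.
Let mulDl : left_distributive mul add.
Proof.
elim/ind=> a Sa; elim/ind=> b Sb; elim/ind=> c Sc.
by rewrite !(addE, mulE); apply/mk_eq/mulrDl.
Qed.
Let mulDr : right_distributive mul add.
Proof.
elim/ind=> a Sa; elim/ind=> b Sb; elim/ind=> c Sc.
by rewrite !(addE, mulE); apply/mk_eq/mulrDr.
Qed.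
HB.instance Definition _ :=
  GRing.Zmodule_isPzRing.Build Q mulA mul1 mul1' mulDl mulDr.

Let sc (c : k) : Q := mk (sqSc w c).
Let scD : {morph sc : c d / c + d}.
Proof. by move=> c d; rewrite /sc [RHS]addE; apply/mk_eq/inalgD. Qed.
Let scM : {morph sc : c d / c * d}.
Proof. by move=> c d; rewrite /sc [RHS]mulE; apply/mk_eq/inalgM. Qed.
Let sc1 : sc 1 = 1. Proof. by apply/mk_eq/inalg1. Qed.
Let scC c X : sc c * X = X * sc c.
Proof.
by elim/ind: X => a Sa; rewrite /sc [LHS]mulE [RHS]mulE; apply/mk_eq/inalgC.
Qed.
HB.instance Definition _ := PzRing_isAlgOver.Build k Q scD scM sc1 scC.

Lemma subquoD (X Y : Q) a b : reps X a -> reps Y b -> reps (X + Y) (a + b).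
Proof.
elim/ind: X => a' Sa' ; elim/ind: Y => b' Sb' Na Nb; rewrite [X in reps X]addE /=.
by rewrite /coset /= opprD addrACA; apply: N_add.
Qed.

Lemma subquoM (X Y : Q) a b : reps X a -> reps Y b -> reps (X * Y) (a * b).
Proof.
elim/ind: X => a' Sa' ; elim/ind: Y => b' Sb' Na Nb; rewrite [X in reps X]mulE /=.
rewrite /coset /=.
have Sb : S b by rewrite -(subrK b' b); apply: S_add => //; apply: (sqNS w).
have -> : a * b - a' * b' = (a - a') * b + a' * (b - b').
  by rewrite mulrBl mulrBr addrA subrK.
by apply: N_add; [apply: (sqNr w) | apply: (sqNl w)].
Qed.

Lemma subquo_inalg c : reps (inalg c : Q) (inalg c).
Proof. by rewrite /= /coset /= subrr; apply: (sqN0 w). Qed.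

End Subquotient.

Section Hamiltonian.
Variables (k : fieldType) (G : algGroup k) (B : algOverType (ser k)).
(* [fil n] is the n-th neighbourhood of 0 for the hbar-adic topology of B. *)
Variable (fil : nat -> set B).

(* Modulo [fil n], the orbit map g |-> Ad g b is the regular function
   \sum_(p <- s) p.1 (x) p.2 with values in B. *)
Definition orbit_map (Ad : G -> B -> B) (b : B) (n : nat)
    (s : seq (coord G * B)) : Prop :=
  forall g : G,
    fil n (Ad g b - \sum_(p <- s) inalg (sconst (ev g p.1)) * p.2).

(* An action by algebra automorphisms of B, which is an algebraic
   representation of G modulo every [fil n]. *)
Record is_action (Ad : G -> B -> B) : Prop := IsAction {
  act1 : forall b, Ad 1%g b = b;
  actM : forall g h b, Ad (g * h)%g b = Ad g (Ad h b);
  act_add : forall g a b, Ad g (a + b) = Ad g a + Ad g b;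
  act_mul : forall g a b, Ad g (a * b) = Ad g a * Ad g b;
  act_inalg : forall g, preserves_scalars (Ad g);
  act_alg : forall b n, exists s, orbit_map Ad b n s }.

(* The derivations induced by the action: differentials at 1 of the orbit
   maps. *)
Record is_induced_derivation (Ad : G -> B -> B) (der : lie G -> B -> B) : Prop :=
    IsInducedDerivation {
  der_add : forall x a b, der x (a + b) = der x a + der x b;
  der_mul : forall x a b, der x (a * b) = der x a * b + a * der x b;
  der_inalg : forall x c, der x (inalg c) = 0;
  der_orbit : forall x b n s, orbit_map Ad b n s ->
    fil n (der x b - \sum_(p <- s) inalg (sconst (x p.1 : k)) * p.2) }.

(* [Phi x, b] / hbar = x_A b is stated without division, since a reduction may
   have hbar-torsion. *)
Record is_comoment (Ad : G -> B -> B) (der : lie G -> B -> B)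
    (Phi : lie G -> B) : Prop := IsComoment {
  com_lin : forall (c : k) x y,
    Phi (c *: x + y) = inalg (sconst c) * Phi x + Phi y;
  com_equiv : forall g x, Phi (lieAd g x) = Ad g (Phi x);
  com_der : forall x b, Phi x * b - b * Phi x = inalg hbar * der x b }.

End Hamiltonian.

(* For A_hbar, [hadic n] is hbar^n A_hbar. *)
Definition hadic (k : fieldType) (A : comAlgType k) (br : poisson A)
    (Q : defquant br) (n : nat) : set (Ahbar Q) :=
  [set a | forall i, (i < n)%N -> a i = 0].

(* On (B / N)^G, the topology induced by that of B / N. *)
Definition subquo_fil (k : pzRingType) (B : algOverType k) (fil : nat -> set B)
    (S N : set B) (w : subquo_alg S N) (n : nat) : set (subquo w) :=
  [set X | exists2 a, reps X a & fil n a].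

Section Reduction.
Variables (k : fieldType) (G : algGroup k) (B : algOverType (ser k)).
Variables (Ad : G -> B -> B) (Phi : lie G -> B) (gamma : lie G -> k).

Definition Igamma : set (Uh (@bracket k G)) :=
  ideal2 [set u | exists x : lie G,
    u = uvar (@bracket k G) x - inalg (sconst (gamma x) * hbar)].

Definition red_ideal : set B := lideal (uext Phi @` Igamma)%classic.

(* The representatives of the G-invariant elements of B / red_ideal. *)
Definition red_inv : set B := [set b | forall g, red_ideal (Ad g b - b)].

(* Right multiplication by G-invariant classes preserves [red_ideal], so that
   (a + red_ideal) (b + red_ideal) = a b + red_ideal is a well-defined product
   on the invariants. This is a property to be proved, and the reduction takes
   its proof as an argument. *)
Definition reducible : Prop := subquo_alg red_inv red_ideal.

Definition reduction (w : reducible) : algOverType (ser k) := subquo w.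

End Reduction.

(* Main.v *)
Require Import Defs.
From HB Require Import structures.
From mathcomp Require Import all_boot all_order all_algebra.
From mathcomp Require Import boolp classical_sets functions reals complex.
From mathcomp Require Import ring lra.
From mathcomp Require Import topology normedtype sequences exp.
Import Defs.

(** Write [phi x] for the shifted element [Phi x - gamma x hbar]. As [gamma] is invariant
    under the coadjoint action it vanishes on brackets, so the [phi x] normalise the
    image of the enveloping algebra, and the ideal of a reduction is the left ideal
    generated by the [phi x] with [x] in the Lie algebra of the group concerned; this is
    [red_idealE]. Since the adjoint representation permutes the [phi x] linearly, this
    ideal is stable under the group. The rest is formal, except for one point, which
    comes up for each of the three groups: the product of a reduction is
    well defined only if [phi x * s] is in the ideal [J] when the class of [s] is
    invariant. For this it is enough that an element [s] with [Ad g s - s] in [J] for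
    all [g] has all its derivatives [der x s] in [J] ([reducible_criterion]). The action is
    algebraic only modulo each power of [hbar], which gives at once that [der x s] is
    in the closure of [J]; but [J] is not known to be closed, because [A] need not be
    Noetherian.

    The way around is to write the tangent vector [x], exactly and not in the limit,
    as a finite combination of differences of translates, with coefficients in the
    full linear dual of the space of functions. Every linear functional [mu] on
    functions acts on the quantisation by averaging translates ([average]), since
    modulo a power of [hbar] the orbit maps have finite rank. The ideal [J] is stable
    under all these averages: it is the image of the sum of finitely many copies of the
    quantisation under an equivariant map, and averages lift along it
    ([average_mul_shifted], [average_lideal]). So it is enough to
    find finitely many group elements [h] such that [x] kills every regular function
    invariant under right translation by them: then [x] factors through the
    differences [F (u h) - F u] by an extension theorem for linear forms
    ([linear_form_factor]), and [der x s] is a sum of averages of the [Ad h s - s]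
    ([finite_invariance]).

    Over the complex numbers two elements suffice. The exponential series of [x]
    converges on each regular function and defines a character of the coordinate
    algebra, hence a one-parameter subgroup [c] ([exp_curve_exists]). A function [F] that is
    invariant under [c 1] and [c theta], with [theta] irrational, has arbitrarily
    small periods along [c], so its derivative along [x] is zero
    ([exp_curve_periods]). With [theta] the inverse of the golden ratio, the powers of
    [theta] are such periods, because [theta^(n+2) + theta^(n+1) = theta^n].

    For the second reduction the averages must also preserve the [H]-invariant classes,
    and this is where the semidirect product enters ([SH_average]). Along the
    one-parameter subgroup [c] of [y] in the Lie algebra of [K], one needs that a
    regular function invariant under [h] and under the exponentials of a basis of the Lie
    algebra of [H] takes the same value at [h c(t)] and at [c(t)]. Now [h c(t) h^-1] is the
    one-parameter subgroup of [Ad h y], and [Ad h y - y] is in the Lie algebra of [H],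
    which is an ideal; so the two exponential series agree on such a function
    ([ideal_invariant]). Then the action, derivations and comoment map of [K]
    descend to classes, and the last homomorphism is induced by the identity,
    because the ideal of the second reduction has its representatives in the ideal for
    [G]. *)

Set Implicit Arguments.
Unset Strict Implicit.
Unset Printing Implicit Defensive.

Import Order.TTheory GRing.Theory Num.Theory.
Import numFieldNormedType.Exports.
Local Open Scope ring_scope.

(** * Linear forms on arbitrary vector spaces *)

Section LinearForms.
Variables (k : fieldType) (V W : lmodType k).

(** A maximal subspace that contains [N] and avoids [w0], which exists by Zorn's lemma, is a
    hyperplane: a vector outside it could otherwise be added. *)
Lemma separating_complement (N : set W) (w0 : W) :
  N 0 -> (forall c u v, N u -> N v -> N (c *: u + v)) -> ~ N w0 ->
  exists U : set W,
    [/\ forall c u v, U u -> U v -> U (c *: u + v), (N `<=` U)%classic, ~ U w0 &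
        forall w, exists c, U (w - c *: w0)].
Proof.
move=> N0 Nlin Nw0.
pose ext (U : set W) := (U `|` N)%classic.
pose P (U : set W) := (forall c u v, ext U u -> ext U v -> ext U (c *: u + v)) /\
                      ~ ext U w0.
have [U [[Ulin Uw0] Umax]] : exists U, P U /\ forall B, (U `<` B)%classic -> ~ P B.
  apply: Zorn_bigcup => F FP Ftot; split; last first.
    by case=> // -[X FX Xw0]; have [_] := FP X FX; apply; left.
  have step X c u v : F X -> ext X u -> ext X v ->
      ext (\bigcup_(X0 in F) X0)%classic (c *: u + v).
    move=> FX Xu Xv; have [Xlin _] := FP X FX.
    by case: (Xlin c u v Xu Xv) => [Xuv|]; [left; exists X | right].
  move=> c u v [[X FX Xu]|Nu] [[Y FY Yv]|Nv].
  - have [XY|YX] := Ftot X Y FX FY.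
      by apply: (step Y) => //; left; [apply: XY|].
    by apply: (step X) => //; left; [|apply: YX].
  - by apply: (step X) => //; [left|right].
  - by apply: (step Y) => //; [right|left].
  - by right; apply: Nlin.
exists (ext U); split=> // [u Nu|w]; first by right.
have E0 : ext U 0 by right.
have [Uw|Uw] := pselect (ext U w); first by exists 0; rewrite scale0r subr0.
(* The subspace spanned by the maximal one and [w] must contain [w0]. *)
pose B := [set v | exists c, ext U (v - c *: w)]%classic.
have UB u : ext U u -> B u by move=> Uu; exists 0; rewrite scale0r subr0.
have NB : ~ P B.
  apply: Umax; split; first by move=> u Uu; apply: UB; left.
  by move=> BU; apply: Uw; left; apply: BU; exists 1; rewrite scale1r subrr.
have Blin c u v : ext B u -> ext B v -> ext B (c *: u + v).
  have extB x : ext B x -> B x by case=> // Nx; apply: UB; right.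
  move=> /extB[a Ua] /extB[b Ub]; left; exists (c * a + b).
  suff -> : c *: u + v - (c * a + b) *: w = c *: (u - a *: w) + (v - b *: w).
    exact: Ulin.
  by rewrite scalerBr scalerDl scalerA opprD addrACA.
have [[c Uc]|Nw] : ext B w0 by apply: contrapT => NBw0; apply: NB.
- have c0 : c != 0.
    by apply/eqP => c0; apply: Uw0; move: Uc; rewrite c0 scale0r subr0.
  exists c^-1.
  have -> : w - c^-1 *: w0 = - c^-1 *: (w0 - c *: w) + 0.
    by rewrite addr0 scalerBr !scaleNr scalerA mulVf // scale1r opprK addrC.
  exact: Ulin.
- by case: Uw0; right.
Qed.

(** This extends a linear form from the image of [T] to all of [W]. The kernel of the
    extension is a hyperplane that contains the image of the kernel of [w] and avoids
    the image of a vector where [w] is nonzero. *)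
Lemma linear_form_factor (T : {linear V -> W}) (w : {linear V -> k^o}) :
  (forall v, T v = 0 -> w v = 0) ->
  exists mu : {linear W -> k^o}, forall v, w v = mu (T v).
Proof.
move=> kerT.
have [[v0 wv0]|w0] := pselect (exists v, w v != 0); last first.
  exists \0%R => v; apply: contrapT => /eqP wv; apply: w0; by exists v.
pose e := (w v0)^-1 *: v0.
have we : w e = 1 by rewrite linearZ /= -[_ *: _]/(_ * _) mulVf.
pose N := [set T v | v in [set v | w v = 0]]%classic.
have [|||U [Ulin NU Ue Uall]] := @separating_complement N (T e).
- by exists 0; rewrite /= linear0.
- move=> c _ _ [u wu <-] [v wv <-]; exists (c *: u + v); rewrite /= linearP //.
  by rewrite wu wv scaler0 addr0.
- case=> v wv /eqP; rewrite -subr_eq0 -linearB => /eqP /kerT /eqP.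
  by rewrite linearB /= wv we sub0r oppr_eq0 oner_eq0.
pose mu x := projT1 (cid (Uall x)).
have muP x : U (x - mu x *: T e) by exact: (projT2 (cid (Uall x))).
have muE x c : U (x - c *: T e) -> mu x = c.
  move=> Ux; apply/eqP; rewrite -subr_eq0; apply: contrapT => /negP nz; apply: Ue.
  have -> : T e = (mu x - c)^-1 *: ((- 1) *: (x - mu x *: T e) + (x - c *: T e)) + 0.
    rewrite addr0 scaleN1r opprB addrA subrK -scalerBl scalerA mulVf // scale1r //.
  by apply: (Ulin); [apply: Ulin | apply: NU; exists 0; rewrite /= linear0].
have mulin : linear_for *%R (mu : W -> k^o).
  move=> c x y; apply: muE.
  have -> : c *: x + y - (c * mu x + mu y) *: T e =
      c *: (x - mu x *: T e) + (y - mu y *: T e).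
    by rewrite scalerBr scalerDl scalerA opprD addrACA.
  exact: Ulin.
pose muL := GRing.isLinear.Build k W k^o *%R mu mulin.
pose M : {linear W -> k^o} := HB.pack mu muL.
exists M => v; apply/esym/muE/NU; exists (v - w v *: e).
  by rewrite /= linearB linearZ /= we -[_ *: _]/(_ * _) mulr1 subrr.
by rewrite linearB linearZ.
Qed.

End LinearForms.

(** * Functions of finite rank *)

Section Interpolation.
Variables (k : fieldType) (X : Type).
Implicit Types (f c : X -> k^o) (q : seq (X * (X -> k^o))).

(** Lagrange interpolation for an arbitrary finite-dimensional space of functions: the
    functions [p.2] play the role of the Lagrange polynomials of the points [p.1]. They can
    be chosen in any subspace [P] that contains [F], for instance among regular
    functions. *)
Lemma interpolation (P : (X -> k^o) -> Prop) (F : seq (X -> k^o)) :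
  (forall a f g, P f -> P g -> P (a *: f + g)) -> P 0 -> {in F, forall f, P f} ->
  exists q, (forall p, List.In p q -> P p.2) /\
    {in F, forall f, forall x, f x = \sum_(p <- q) f p.1 * p.2 x}.
Proof.
move=> Plin P0 PF.
pose proj q f : X -> k^o := fun x => \sum_(p <- q) f p.1 * p.2 x.
suff [q [Pq _ projF]] : exists q, [/\ forall p, List.In p q -> P p.2,
    forall f p, List.In p q -> proj q f p.1 = f p.1 &
    {in F, forall f, forall x, f x = proj q f x}] by exists q.
elim: F PF => [|f0 F IH] PF; first by exists [::]; split.
have [|q [Pq qK qF]] := IH; first by move=> f fF; apply: PF; rewrite inE fF orbT.
have Pproj f q' : (forall p, List.In p q' -> P p.2) -> P (proj q' f).
  elim: q' => [|p q' IHq] Pq'.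
    by rewrite (_ : proj [::] f = 0) //; apply/funext => x; rewrite /proj big_nil.
  have -> : proj (p :: q') f = f p.1 *: p.2 + proj q' f.
    by apply/funext => x; rewrite /proj big_cons.
  by apply: Plin; [apply: Pq'; left | apply: IHq => r rq; apply: Pq'; right].
(* If [f0] is not yet interpolated, add a point where the error [r] is nonzero and
   correct the previous functions to vanish there. *)
pose r : X -> k^o := f0 - proj q f0.
have rE x : r x = f0 x - proj q f0 x by [].
have Pr : P r.
  rewrite /r addrC -scaleN1r; apply: Plin; first exact: Pproj.
  by apply: PF; rewrite inE eqxx.
have [[y ry]|r0] := pselect (exists y, r y != 0); last first.
  exists q; split=> // f; rewrite inE => /predU1P[->|/qF//] x.
  apply/eqP; rewrite -subr_eq0 -rE; apply: contrapT => /negP rx.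
  by apply: r0; exists x.
pose c (p : X * (X -> k^o)) : X -> k^o := p.2 - (p.2 y / r y) *: r.
pose q' := rcons [seq (p.1, c p) | p <- q] (y, (r y)^-1 *: r).
have In_map_c p : List.In p [seq (p.1, c p) | p <- q] ->
    exists2 p', List.In p' q & p = (p'.1, c p').
  elim: (q) => //= p' s IHs [<-|/IHs[p'' p''s ->]]; first by exists p'; [left|].
  by exists p''; [right|].
have In_q' p : List.In p q' -> (exists2 p', List.In p' q & p = (p'.1, c p')) \/
    p = (y, (r y)^-1 *: r).
  rewrite /q' -cats1 => pq'; have [/In_map_c|] := List.in_app_or _ _ _ pq'.
    by left.
  by case=> // <-; right.
have q'E f x : proj q' f x = proj q f x + (f y - proj q f y) / r y * r x.
  rewrite /proj /q' -cats1 big_cat /= big_map big_seq1 /=.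
  have -> : \sum_(p <- q) f p.1 * c p x = proj q f x - proj q f y / r y * r x.
    rewrite /proj !mulr_suml -sumrB; apply: eq_bigr => p _.
    by rewrite /c -[(_ - _ *: _) x]/(p.2 x - p.2 y / r y * r x) mulrBr !mulrA.
  by rewrite -[(_ *: r) x]/((r y)^-1 * r x) /proj; ring.
have rq p : List.In p q -> r p.1 = 0 by move=> pq; rewrite rE qK // subrr.
exists q'; split.
- move=> p /In_q'[[p' p'q ->]|->] /=.
    by rewrite /c addrC -scaleNr; apply: (Plin); [exact: Pr|exact: Pq].
  by rewrite -[_ *: r]addr0; apply: (Plin).
- move=> f p /In_q'[[p' p'q ->]|->] /=; rewrite q'E; last by rewrite mulfVK // addrC subrK.
  by rewrite rq // mulr0 addr0 qK.
- move=> f; rewrite inE => /predU1P[->|fF] x; rewrite q'E.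
    by rewrite -rE mulfV // mul1r addrC subrK.
  by rewrite -[proj q f y]qF // subrr !mul0r addr0 -qF.
Qed.

End Interpolation.

Section FiniteRank.
Variables (k : fieldType) (X : Type).
Local Notation funs := (X -> k^o).

(** The list [s] is an element of the tensor product of the functions on [X] with [V], with
    functions that need not be regular or continuous. Allowing all functions makes
    every linear form on a subspace extend to the space of weights. *)
Definition expands (V : lmodType k) (s : seq (funs * V)) (Psi : X -> V) : Prop :=
  forall x, Psi x = \sum_(p <- s) p.1 x *: p.2.

Definition finite_rank (V : lmodType k) (Psi : X -> V) : Prop :=
  exists s, expands s Psi.

Definition pairing (V : lmodType k) (mu : {linear funs -> k^o}) (s : seq (funs * V)) : V :=
  \sum_(p <- s) mu p.1 *: p.2.

(** The values of finitely many functions of finite rank can be recovered from values at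
    finitely many common points. As the same formula computes the pairing, the
    latter depends only on the function, and not on its expansion. *)
Lemma sampling (V : lmodType k) (ss : seq (seq (funs * V))) :
  exists q : seq (X * funs), forall s Psi, s \in ss -> expands s Psi ->
    (forall x, Psi x = \sum_(p <- q) p.2 x *: Psi p.1) /\
    (forall mu, pairing mu s = \sum_(p <- q) mu p.2 *: Psi p.1).
Proof.
pose F := [seq p.1 | p <- flatten ss].
have [//|q [_ qF]] := @interpolation k X (fun=> True) F (fun _ _ _ _ _ => I) I.
exists q => s Psi sss sPsi.
have {}qF p : p \in s -> p.1 = \sum_(r <- q) p.1 r.1 *: r.2.
  move=> ps; apply/funext => x; rewrite fct_sumE; apply: qF.
  by apply: map_f; apply/flattenP; exists s.
split=> [x|mu].
  rewrite sPsi big_seq; under eq_bigr => p /qF -> do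
    rewrite fct_sumE scaler_suml.
  rewrite -big_seq exchange_big /=; apply: eq_bigr => r _.
  rewrite sPsi scaler_sumr; apply: eq_bigr => p _.
  by rewrite scalerA mulrC.
rewrite /pairing big_seq.
under eq_bigr => p ps.
  rewrite (qF p ps) linear_sum scaler_suml.
  over.
rewrite -big_seq exchange_big /=; apply: eq_bigr => r _.
rewrite sPsi scaler_sumr; apply: eq_bigr => p _.
by rewrite linearZ /= -[X in X *: _]/(p.1 r.1 * mu r.2) scalerA mulrC.
Qed.

(** The sum of the values of [Psi] with weight [mu]. Any expansion gives the same result,
    by [integralE]. *)
Definition integral (V : lmodType k) (mu : {linear funs -> k^o}) (Psi : X -> V) : V :=
  pairing mu (xget [::] [set s | expands s Psi]).

Lemma integralE (V : lmodType k) mu (s : seq (funs * V)) Psi :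
  expands s Psi -> integral mu Psi = pairing mu s.
Proof.
move=> sPsi; rewrite /integral; case: xgetP => [s' _ /= s'Psi|/(_ s)/= //].
have [q qP] := sampling [:: s; s'].
have [|_ ->] := qP s Psi _ sPsi; first by rewrite !inE eqxx.
by have [|_ ->] := qP s' Psi _ s'Psi; first by rewrite !inE eqxx orbT.
Qed.

End FiniteRank.

(** * Weighted sums of values of functions *)

Section FunctionMaps.
Variables (k : fieldType) (X Y : Type).

Definition fmul (c f : X -> k^o) : X -> k^o := fun x => c x * f x.
Lemma fmul_linear c : linear (fmul c).
Proof.
move=> a f g; apply/funext => x; rewrite /fmul.
rewrite -[(a *: f + g) x]/(a * f x + g x).
by rewrite -[RHS]/(a * (c x * f x) + c x * g x) mulrDr mulrCA.
Qed.
HB.instance Definition _ c :=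
  GRing.isLinear.Build k (X -> k^o) (X -> k^o) *:%R (fmul c) (fmul_linear c).

Definition frestr (e : X -> Y) (f : Y -> k^o) : X -> k^o := fun x => f (e x).
Lemma frestr_linear e : linear (frestr e).
Proof. by []. Qed.
HB.instance Definition _ e :=
  GRing.isLinear.Build k (Y -> k^o) (X -> k^o) *:%R (frestr e) (frestr_linear e).

Definition fslice (I : finType) (j : I) (f : X -> k^o) : I * X -> k^o :=
  fun y => if y.1 == j then f y.2 else 0.
Lemma fslice_linear (I : finType) j : linear (@fslice I j).
Proof.
move=> a f g; apply/funext => -[i x]; rewrite /fslice /=.
rewrite -[RHS]/(a * (if i == j then f x else 0) + (if i == j then g x else 0)).
by case: ifP => // _; rewrite mulr0 addr0.
Qed.
HB.instance Definition _ (I : finType) j := GRing.isLinear.Build k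
  (X -> k^o) (I * X -> k^o) *:%R (@fslice I j) (@fslice_linear I j).

End FunctionMaps.

Section Integral.
Variables (k : fieldType) (V : lmodType k).

Lemma integralD X (mu : {linear (X -> k^o) -> k^o}) (Psi Psi' : X -> V) :
  finite_rank Psi -> finite_rank Psi' ->
  finite_rank (Psi + Psi') /\
  integral mu (Psi + Psi') = integral mu Psi + integral mu Psi'.
Proof.
case=> s sP [s' s'P].
have ss' : expands (s ++ s') (Psi + Psi').
  by move=> x; rewrite big_cat /= -sP -s'P.
by split; [exists (s ++ s') | rewrite !(integralE _ sP, integralE _ s'P, integralE _ ss') /pairing big_cat].
Qed.

Lemma integral_mul X (c : X -> k^o) (mu : {linear (X -> k^o) -> k^o}) (Psi : X -> V) :
  finite_rank Psi ->
  finite_rank (fun x => c x *: Psi x) /\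
  integral mu (fun x => c x *: Psi x) = integral (mu \o fmul c) Psi.
Proof.
case=> s sP; have cs : expands [seq (fmul c p.1, p.2) | p <- s] (fun x => c x *: Psi x).
  move=> x; rewrite big_map /= sP scaler_sumr.
  by apply: eq_bigr => p _; rewrite scalerA.
split; first by exists [seq (fmul c p.1, p.2) | p <- s].
by rewrite (integralE _ sP) (integralE _ cs) /pairing big_map.
Qed.

Lemma integral_slices X (I : finType) (mu : {linear (I * X -> k^o) -> k^o})
    (Psi : I -> X -> V) :
  (forall j, finite_rank (Psi j)) ->
  integral mu (fun y => Psi y.1 y.2) = \sum_j integral (mu \o fslice j) (Psi j).
Proof.
move=> /choice[s sP].
pose S := [seq (fslice j p.1, p.2) | j <- index_enum I, p <- s j].
have Se : expands S (fun y => Psi y.1 y.2).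
  move=> [i x]; rewrite big_allpairs_dep /= (bigD1 i) //= sP.
  rewrite [X in _ = _ + X]big1 ?addr0; last first.
    move=> j /negPf ji; rewrite big1 // => p _.
    by rewrite /fslice /= eq_sym ji scale0r.
  by apply: eq_bigr => p _; rewrite /fslice /= eqxx.
rewrite (integralE _ Se) /pairing big_allpairs_dep; apply: eq_bigr => j _.
by rewrite (integralE _ (sP j)).
Qed.

End Integral.

Section SeriesIntegral.
Variables (k : fieldType) (V : lmodType k).
Implicit Types (a b : ser V).

(** Scaling by constants. The canonical scaling of series is by series. *)
Definition cscale (c : k) (a : ser V) : ser V := fun i => c *: a i.

Definition pro_rank X (Psi : X -> ser V) : Prop :=
  forall i, finite_rank (fun x => Psi x i).

Definition sintegral X (mu : {linear (X -> k^o) -> k^o}) (Psi : X -> ser V) : ser V :=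
  fun i => integral mu (fun x => Psi x i).

Lemma sampling_upto X (Psi : X -> ser V) n : pro_rank Psi ->
  exists q : seq (X * (X -> k^o)), forall i, (i < n)%N ->
    (forall x, Psi x i = \sum_(p <- q) p.2 x *: Psi p.1 i) /\
    (forall mu, sintegral mu Psi i = \sum_(p <- q) mu p.2 *: Psi p.1 i).
Proof.
move=> /choice[s sP].
have [q qP] := sampling [seq s i | i <- iota 0 n].
exists q => i i_n; have [|e1 e2] := qP (s i) (fun x => Psi x i) _ (sP i).
  by apply: map_f; rewrite mem_iota.
by split=> // mu; rewrite /sintegral (integralE _ (sP i)).
Qed.

(** Continuity for the adic topology in the strong form that is needed here: a
    coefficient of [L a] depends only on the coefficients of [a] up to the same degree. *)
Definition causal_linear (L : ser V -> ser V) : Prop :=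
  [/\ forall a b, L (a + b) = L a + L b, forall c a, L (cscale c a) = cscale c (L a) &
      forall n a, (forall i, (i <= n)%N -> a i = 0) -> L a n = 0].

(** A coefficient of [L (Psi x)] depends on finitely many coefficients of [Psi x], and these
    are recovered from common sample points. *)
Lemma sintegral_linear X (L : ser V -> ser V) (mu : {linear (X -> k^o) -> k^o})
    (Psi : X -> ser V) :
  causal_linear L -> pro_rank Psi ->
  pro_rank (L \o Psi) /\ sintegral mu (L \o Psi) = L (sintegral mu Psi).
Proof.
move=> [LD LZ Lc] rkPsi.
have L0 : L 0 = 0 by apply: (addrI (L 0)); rewrite -LD !addr0.
have LN a : L (- a) = - L a.
  by apply: (addrI (L a)); rewrite -LD !subrr.
have Lsum (q : seq (X * (X -> k^o))) (c : X * (X -> k^o) -> k) n a :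
    (forall i, (i < n.+1)%N -> a i = \sum_(p <- q) c p *: Psi p.1 i) ->
    L a n = \sum_(p <- q) c p *: L (Psi p.1) n.
  move=> aE; pose b : ser V := \sum_(p <- q) cscale (c p) (Psi p.1).
  have bE (f : X * (X -> k^o) -> ser V) i : (\sum_(p <- q) f p : ser V) i = \sum_(p <- q) f p i.
    by elim: (q) => [|p r IH]; rewrite ?big_nil // !big_cons serD IH.
  have ab i : (i <= n)%N -> (a - b) i = 0.
    by move=> i_n; rewrite serD aE // -[(- b) i]/(- b i) /b bE subrr.
  have := Lc n _ ab; rewrite LD LN serD -[(- L b) n]/(- L b n) => /eqP.
  rewrite subr_eq0 => /eqP ->; rewrite /b (big_morph L LD L0) bE.
  by apply: eq_bigr => p _; rewrite LZ.
have main n : exists q : seq (X * (X -> k^o)),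
   (forall x, L (Psi x) n = \sum_(p <- q) p.2 x *: L (Psi p.1) n) /\
   L (sintegral mu Psi) n = \sum_(p <- q) mu p.2 *: L (Psi p.1) n.
  have [q qP] := sampling_upto n.+1 rkPsi; exists q; split=> [x|].
    by apply: (Lsum q (fun p => p.2 x)) => i /qP[].
  by apply: (Lsum q (fun p => mu p.2)) => i /qP[].
have ex q n : (forall x, L (Psi x) n = \sum_(p <- q) p.2 x *: L (Psi p.1) n) ->
    expands [seq (p.2, L (Psi p.1) n) | p <- q] (fun x => (L \o Psi) x n).
  by move=> qP x; rewrite big_map; apply: qP.
split=> [n|]; first by have [q [/ex qP _]] := main n; eexists; apply: qP.
apply/funext => n; have [q [/ex qP ->]] := main n.
by rewrite /sintegral (integralE _ qP) /pairing big_map.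
Qed.

Lemma sintegralD X (mu : {linear (X -> k^o) -> k^o}) (Psi Psi' : X -> ser V) :
  pro_rank Psi -> pro_rank Psi' ->
  pro_rank (fun x => Psi x + Psi' x) /\
  sintegral mu (fun x => Psi x + Psi' x) = sintegral mu Psi + sintegral mu Psi'.
Proof.
move=> rk rk'; split=> [i|]; first by have [] := integralD mu (rk i) (rk' i).
by apply/funext => i; have [_] := integralD mu (rk i) (rk' i).
Qed.

Lemma sintegral_mul X (c : X -> k^o) (mu : {linear (X -> k^o) -> k^o})
    (Psi : X -> ser V) :
  pro_rank Psi ->
  pro_rank (fun x => cscale (c x) (Psi x)) /\
  sintegral mu (fun x => cscale (c x) (Psi x)) = sintegral (mu \o fmul c) Psi.
Proof.
move=> rk; split=> [i|]; first by have [] := integral_mul c mu (rk i).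
by apply/funext => i; have [_] := integral_mul c mu (rk i).
Qed.

Lemma sintegral_slices X (I : finType) (mu : {linear (I * X -> k^o) -> k^o})
    (Psi : I -> X -> ser V) :
  (forall j, pro_rank (Psi j)) ->
  sintegral mu (fun y => Psi y.1 y.2) = \sum_j sintegral (mu \o fslice j) (Psi j).
Proof.
move=> rk; apply/funext => i.
have bE (f : I -> ser V) : (\sum_j f j : ser V) i = \sum_j f j i.
  by apply: (big_morph (fun a : ser V => a i)).
rewrite bE; have := @integral_slices k V X I mu (fun j x => Psi j x i).
by apply=> j; apply: rk.
Qed.

End SeriesIntegral.

(** * Tangent vectors of an algebraic group *)

Section InvariantDerivations.
Variables (k : fieldType) (G : algGroup k).
Implicit Types (x y : lie G) (f g : coord G) (u v : G).

Lemma lie_eq x y : (forall f, x f = y f) -> x = y.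
Proof. by move=> xy; apply: val_inj; apply/funext. Qed.

Lemma lie_const x c : x (c *: 1) = 0.
Proof.
rewrite lieZ; have := lieM x 1 1; rewrite mul1r !ev1 mulr1 mul1r => /eqP.
by rewrite -subr_eq0 opprD addrA subrr sub0r oppr_eq0 => /eqP->; rewrite mulr0.
Qed.

Lemma lieLE c x y f : (c *: x + y : lie G) f = c * x f + y f.
Proof. by []. Qed.

Lemma lie_sumE (I : Type) (s : seq I) (c : I -> k) (z : I -> lie G) f :
  (\sum_(i <- s) c i *: z i : lie G) f = \sum_(i <- s) c i * z i f.
Proof.
elim: s => [|i s IH]; first by rewrite !big_nil.
by rewrite !big_cons lieLE IH.
Qed.

Definition ltrans u f : coord G := \sum_(p <- comul f) ev u p.1 *: p.2.
Lemma ltransE u f v : ev v (ltrans u f) = ev (u * v)%g f.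
Proof. by rewrite ev_sum comulE; apply: eq_bigr => p _; rewrite evZ. Qed.

(** The left invariant derivation of the coordinate algebra with value [x] at
    the identity. *)
Definition lder x f : coord G := \sum_(p <- comul f) x p.2 *: p.1.

Lemma lderE x f u : ev u (lder x f) = x (ltrans u f).
Proof.
by rewrite ev_sum lie_sum; apply: eq_bigr => p _; rewrite evZ lieZ mulrC.
Qed.

Lemma lder_at1 x f : ev 1%g (lder x f) = x f.
Proof. by rewrite lderE; congr (x _); apply: ev_ext => v; rewrite ltransE mul1g. Qed.

Lemma ltrans_lder u x f : ltrans u (lder x f) = lder x (ltrans u f).
Proof.
apply: ev_ext => v; rewrite ltransE !lderE; congr (x _).
by apply: ev_ext => w; rewrite !ltransE mulgA.
Qed.

Lemma lder_lin x c f g : lder x (c *: f + g) = c *: lder x f + lder x g.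
Proof.
apply: ev_ext => u; rewrite evD evZ !lderE -lieZ -lieD; congr (x _).
by apply: ev_ext => v; rewrite ltransE !evD !evZ !ltransE.
Qed.

Lemma lder0 x : lder x 0 = 0.
Proof.
have := lder_lin x 1 0 0; rewrite !scale1r !addr0 => /esym/eqP.
by rewrite -subr_eq0 addrK => /eqP.
Qed.

Lemma lder_linx x y c f : lder (c *: x + y) f = c *: lder x f + lder y f.
Proof. by apply: ev_ext => u; rewrite evD evZ !lderE. Qed.

Lemma lderM x f g : lder x (f * g) = lder x f * g + f * lder x g.
Proof.
apply: ev_ext => u; rewrite evD !evM !lderE.
have -> : ltrans u (f * g) = ltrans u f * ltrans u g.
  by apply: ev_ext => v; rewrite ltransE !evM !ltransE.
by rewrite lieM !ltransE mulg1.
Qed.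

Lemma lder1 x : lder x 1 = 0.
Proof.
apply: ev_ext => u; rewrite lderE ev0 -(lie_const x 1); congr (x _).
by apply: ev_ext => v; rewrite ltransE evZ !ev1 mulr1.
Qed.

Lemma tens_lder x y f : tens x y f = x (lder y f).
Proof. by rewrite lie_sum; apply: eq_bigr => p _; rewrite lieZ mulrC. Qed.

Lemma bracketE x y f : bracket x y f = x (lder y f) - y (lder x f).
Proof. by rewrite -!tens_lder. Qed.

Lemma lder_bracket x y f :
  lder (bracket x y) f = lder x (lder y f) - lder y (lder x f).
Proof.
apply: ev_ext => u; rewrite -[- _]scaleN1r evD evZ mulN1r !lderE bracketE.
by rewrite !ltrans_lder.
Qed.

End InvariantDerivations.

Section Tangent.
Variables (k : fieldType) (L G : algGroup k).
Implicit Types (x : lie L) (f : coord G) (F : coord L).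

(** Composition with a pointed regular map pushes tangent vectors forward; unlike
    in [diff] the map need not be a homomorphism. *)
Lemma tangent_map (psi : L -> G) x : regular_map psi -> psi 1%g = 1%g ->
  exists x' : lie G, forall f F, (forall u, ev u F = ev (psi u) f) -> x' f = x F.
Proof.
move=> /choice[pb pbE] psi1.
have P : (fun f => x (pb f)) \in @pder _ G.
  apply/asboolP; split=> [c f g|f g].
    rewrite -lieZ -lieD; congr (x _); apply: ev_ext => a.
    by rewrite evD evZ !pbE evD evZ.
  have -> : pb (f * g) = pb f * pb g.
    by apply: ev_ext => a; rewrite evM !pbE evM.
  by rewrite lieM !pbE psi1.
exists (Lie P) => f F FE; rewrite /=; congr (x _).
by apply: ev_ext => u; rewrite pbE FE.
Qed.

(** The product rule, from a decomposition of [f] under comultiplication. *)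
Lemma tangent_product (a b : L -> G) x f Fa Fb Fab :
  regular_map a -> regular_map b -> a 1%g = 1%g -> b 1%g = 1%g ->
  (forall u, ev u Fa = ev (a u) f) -> (forall u, ev u Fb = ev (b u) f) ->
  (forall u, ev u Fab = ev (a u * b u)%g f) ->
  x Fab = x Fa + x Fb.
Proof.
move=> /choice[pa paE] /choice[pb pbE] a1 b1 FaE FbE FabE.
have -> : Fab = \sum_(p <- comul f) pa p.1 * pb p.2.
  apply: ev_ext => u; rewrite FabE comulE ev_sum.
  by apply: eq_bigr => p _; rewrite evM paE pbE.
have -> : Fa = \sum_(p <- comul f) ev 1%g p.2 *: pa p.1.
  apply: ev_ext => u; rewrite FaE -(mulg1 (a u)) comulE ev_sum.
  by apply: eq_bigr => p _; rewrite evZ paE mulrC.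
have -> : Fb = \sum_(p <- comul f) ev 1%g p.1 *: pb p.2.
  apply: ev_ext => u; rewrite FbE -(mul1g (b u)) comulE ev_sum.
  by apply: eq_bigr => p _; rewrite evZ pbE.
rewrite !lie_sum -big_split; apply: eq_bigr => p _ /=.
by rewrite lieM !lieZ paE pbE a1 b1 mulrC.
Qed.

Variable phi : agHom L G.

Lemma diffE x f F : (forall u, ev u F = ev (phi u) f) -> diff phi x f = x F.
Proof.
by move=> FE; rewrite /=; congr (x _); apply: ev_ext => u; rewrite pullbackE FE.
Qed.

Lemma homV u : phi u^-1%g = (phi u)^-1%g.
Proof. by apply: (mulgI (phi u)); rewrite -homM !mulgV hom1. Qed.

Lemma diff_lin c x x' : diff phi (c *: x + x') = c *: diff phi x + diff phi x'.
Proof. exact: lie_eq. Qed.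

Lemma lder_pullback x f : lder x (pullback phi f) = pullback phi (lder (diff phi x) f).
Proof.
apply: ev_ext => u; rewrite pullbackE !lderE /=; congr (x _).
by apply: ev_ext => v; rewrite ltransE !pullbackE ltransE homM.
Qed.

Lemma diff_bracket x x' : diff phi (bracket x x') = bracket (diff phi x) (diff phi x').
Proof.
apply: lie_eq => f; rewrite [RHS]bracketE.
rewrite (_ : diff phi _ f = bracket x x' (pullback phi f)) // bracketE.
by rewrite !lder_pullback.
Qed.

End Tangent.

Section AdjointRepresentation.
Variables (k : fieldType) (G : algGroup k).
Implicit Types (x y : lie G) (f : coord G) (g : G).

Lemma lieAdE g (y : lie G) f (F : coord G) :
  (forall u, ev u F = ev (g * u * g^-1)%g f) -> lieAd g y f = y F.
Proof. by move=> FE; apply: diffE => u; rewrite FE. Qed.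

Lemma id_regular : regular_map (fun u : G => u).
Proof. by move=> f; exists f. Qed.

(** Differentiate the constant map sending [u] to [u u^-1] by the product rule. *)
Lemma lie_inverse x f F : (forall u, ev u F = ev u^-1%g f) -> x F = - x f.
Proof.
move=> FE; apply/eqP; rewrite -addr_eq0; apply/eqP.
rewrite addrC -(@tangent_product _ G G (fun u => u) (fun u => u^-1)%g x f f F
  (ev 1%g f *: 1)).
- exact: lie_const.
- exact: id_regular.
- by move=> h; have [h' h'E] := ev_inv h; exists h'.
- by [].
- exact: invg1.
- by [].
- exact: FE.
- by move=> u; rewrite mulgV evZ ev1 mulr1.
Qed.

(** The differential of the adjoint representation is the bracket: apply the product rule to
    [f (g u g^-1)] as a function of [g]. *)
Lemma lieAd_regular y f : exists m : coord G,
  (forall g, ev g m = lieAd g y f) /\ forall x, x m = bracket x y f.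
Proof.
have /choice[S SE] := @ev_inv _ G.
(* The function [rd h] sends [v] to the derivative along [y] at [u = 1] of [h (u v)]. *)
pose rd (h : coord G) : coord G := \sum_(q <- comul h) y q.1 *: q.2.
have rdE h v F : (forall u, ev u F = ev (u * v)%g h) -> ev v (rd h) = y F.
  move=> FE; have -> : F = \sum_(q <- comul h) ev v q.2 *: q.1.
    apply: ev_ext => u; rewrite FE comulE ev_sum.
    by apply: eq_bigr => q _; rewrite evZ mulrC.
  by rewrite ev_sum lie_sum; apply: eq_bigr => q _; rewrite evZ lieZ mulrC.
exists (\sum_(p <- comul f) p.1 * S (rd p.2)); split=> [g|x].
  have [F FE] := conj_reg g f; rewrite (lieAdE y FE) ev_sum.
  have /choice[r rE] : forall h : coord G, exists F, forall u, ev u F = ev (u * g^-1)%g h.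
    move=> h; exists (\sum_(q <- comul h) ev g^-1%g q.2 *: q.1) => u.
    by rewrite comulE ev_sum; apply: eq_bigr => q _; rewrite evZ mulrC.
  have -> : F = \sum_(p <- comul f) ev g p.1 *: r p.2.
    apply: ev_ext => u; rewrite FE /conj -mulgA comulE ev_sum.
    by apply: eq_bigr => p _; rewrite evZ rE.
  rewrite lie_sum; apply: eq_bigr => p _.
  by rewrite evM lieZ SE (rdE _ _ _ (rE _)).
rewrite bracketE -!tens_lder.
have xS h : x (S h) = - x h by apply: lie_inverse => u; rewrite SE.
have rd1 h : ev 1%g (S (rd h)) = y h.
  by rewrite SE invg1 (rdE h _ h) // => u; rewrite mulg1.
have xrd h : x (rd h) = tens y x h.
  by rewrite lie_sum; apply: eq_bigr => q _; rewrite lieZ.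
rewrite lie_sum.
under eq_bigr => p _ do rewrite lieM rd1 xS xrd mulrN.
rewrite sumrB; congr (_ - _).
rewrite [RHS]tens_lder -[in RHS](comul_counitl f).
elim: (comul f) => [|p s IH]; last first.
  by rewrite !big_cons lder_lin lieD lieZ -IH tens_lder.
by rewrite !big_nil lder0 lie0.
Qed.

(** A tangent vector is determined by its values on generators of the coordinate algebra,
    so interpolation between tangent vectors on these generators is exact. *)
Lemma lie_findim : exists s : seq (coord G * lie G),
  forall x, x = \sum_(p <- s) (x p.1 : k) *: p.2.
Proof.
have [gens gensP] := coord_fg G.
have gens_eq x y : (forall f, f \in gens -> x f = y f) -> x = y.
  move=> xy; apply: lie_eq; apply: gensP => //.
  - by rewrite -[1]scale1r !lie_const.
  - by move=> c f g fE gE; rewrite !lieD !lieZ fE gE.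
  - by move=> f g fE gE; rewrite !lieM fE gE.
pose at_ (f : coord G) : lie G -> k^o := fun x => x f.
have [|||q [qP qE]] := @interpolation k (lie G)
    (fun F => exists f, F = at_ f) [seq at_ f | f <- gens].
- move=> a _ _ [f ->] [g ->]; exists (a *: f + g).
  by apply/funext => x; rewrite /at_ lieD lieZ.
- by exists 0; apply/funext => x; rewrite /at_ lie0.
- by move=> _ /mapP[f _ ->]; exists f.
have [s sq] : exists s : seq (coord G * lie G), q = [seq (p.2, at_ p.1) | p <- s].
  elim: q qP {qE} => [|[y F] q IH] qP; first by exists [::].
  have [|s ->] := IH; first by move=> p pq; apply: qP; right.
  have [|f /= ->] := qP (y, F); first by left.
  by exists ((f, y) :: s).
exists s => x; apply: gens_eq => f fgens; rewrite lie_sumE.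
rewrite -[LHS]/(at_ f x) qE ?map_f // sq big_map.
by apply: eq_bigr => p _; rewrite mulrC.
Qed.

(** Linear forms on the coordinate algebra agree on [F] with combinations of evaluations at
    points. This replaces limits in the arguments about derivatives. *)
Lemma coord_interpolation (F : seq (coord G)) : exists r : seq (coord G * G),
  {in F, forall f, f = \sum_(p <- r) ev p.2 f *: p.1}.
Proof.
pose fn (f : coord G) : G -> k^o := fun g => ev g f.
have [|||q [qP qE]] := @interpolation k G
    (fun h => exists f, h = fn f) [seq fn f | f <- F].
- move=> a _ _ [f ->] [h ->]; exists (a *: f + h).
  by apply/funext => u; rewrite /fn evD evZ.
- by exists 0; apply/funext => u; rewrite /fn ev0.
- by move=> _ /mapP[f _ ->]; exists f.
have [r rq] : exists r : seq (coord G * G), q = [seq (p.2, fn p.1) | p <- r].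
  elim: q qP {qE} => [|[g h] q IH] qP; first by exists [::].
  have [|r ->] := IH; first by move=> p pq; apply: qP; right.
  have [|f /= ->] := qP (g, h); first by left.
  by exists ((f, g) :: r).
exists r => f fF; apply: ev_ext => u; rewrite -[LHS]/(fn f u) qE ?map_f //.
by rewrite rq big_map ev_sum; apply: eq_bigr => p _; rewrite evZ.
Qed.

(** A tangent vector is, on finitely many functions, a combination of
    evaluations at points; so the differential of the adjoint representation is a
    combination of translates. *)
Lemma bracket_span y x : exists q : seq (k * G),
  bracket y x = \sum_(p <- q) p.1 *: lieAd p.2 x /\ \sum_(p <- q) p.1 = 0.
Proof.
have /choice[m mP] := lieAd_regular x.
have [s sE] := lie_findim.
pose F : seq (coord G) := 1 :: [seq m p.1 | p <- s].
have [r FE] := coord_interpolation F.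
exists [seq (y p.1, p.2) | p <- r]; rewrite !big_map /=; split; last first.
  rewrite -[RHS](lie_const y 1) scale1r (FE 1) ?inE ?eqxx // lie_sum.
  by apply: eq_bigr => p _; rewrite lieZ ev1 mul1r.
rewrite [LHS]sE [RHS]sE; rewrite big_seq [RHS]big_seq.
apply: eq_bigr => p ps; congr (_ *: _).
have [mE yE] := mP p.1; rewrite -yE lie_sumE {1}(FE (m p.1)).
  by rewrite lie_sum; apply: eq_bigr => j _; rewrite lieZ mE mulrC.
by rewrite inE map_f ?orbT.
Qed.

End AdjointRepresentation.

Lemma diff_lieAd (k : fieldType) (L G : algGroup k) (phi : agHom L G) h (x : lie L) :
  diff phi (lieAd h x) = lieAd (phi h) (diff phi x).
Proof.
apply: lie_eq => f; rewrite /=; congr (x _); apply: ev_ext => u.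
by rewrite !pullbackE /= /conj !homM homV.
Qed.

(** * Complex series *)

Section ComplexSeries.
Variable R : realType.
Implicit Types (z w : R[i]) (a b : nat -> R[i]) (t M C : R).

Local Notation Re := (@complex.Re R).
Local Notation Im := (@complex.Im R).

Definition cabs z : R := Re `|z|.
Lemma cabsE z : `|z| = (cabs z)%:C%C.
Proof. by rewrite /cabs normc_def. Qed.
Lemma cabs_ge0 z : 0 <= cabs z.
Proof. by rewrite -lecR -cabsE normr_ge0. Qed.
Lemma cabsD z w : cabs (z + w) <= cabs z + cabs w.
Proof. by rewrite -lecR rmorphD /= -!cabsE ler_normD. Qed.
Lemma cabsM z w : cabs (z * w) = cabs z * cabs w.
Proof. by apply: complexI; rewrite rmorphM /= -!cabsE normrM. Qed.
Lemma cabsN z : cabs (- z) = cabs z.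
Proof. by rewrite /cabs normrN. Qed.
Lemma cabsB z w : cabs (z - w) = cabs (w - z).
Proof. by rewrite -cabsN opprB. Qed.
Lemma cabs0 : cabs 0 = 0.
Proof. by rewrite /cabs normr0. Qed.
Lemma cabs_eq0 z : cabs z = 0 -> z = 0.
Proof. by move=> z0; apply/eqP; rewrite -normr_eq0 cabsE z0. Qed.
Lemma cabs_real t : cabs t%:C%C = `|t|.
Proof. by rewrite /cabs normc_def /= expr0n addr0 sqrtr_sqr. Qed.
Lemma cabsX z n : cabs (z ^+ n) = cabs z ^+ n.
Proof. by apply: complexI; rewrite rmorphXn /= -!cabsE normrX. Qed.
Lemma cabs_sum I (s : seq I) (P : pred I) (F : I -> R[i]) :
  cabs (\sum_(i <- s | P i) F i) <= \sum_(i <- s | P i) cabs (F i).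
Proof.
elim/big_rec2: _ => [|i y x _ xy]; first by rewrite cabs0.
by apply: (le_trans (cabsD _ _)); rewrite lerD2l.
Qed.
Lemma cabs_Re z : `|Re z| <= cabs z.
Proof. by rewrite -lecR -cabsE normc_ge_Re. Qed.
Lemma cabs_Im z : `|Im z| <= cabs z.
Proof.
have := cabs_Re (z * 'i%C); rewrite ReiNIm normrN => /le_trans; apply.
by rewrite cabsM (_ : cabs 'i%C = 1) ?mulr1 // /cabs normc_def /= expr0n add0r expr1n sqrtr1.
Qed.
Lemma cabs_ReIm z : cabs z <= `|Re z| + `|Im z|.
Proof.
rewrite [X in cabs X]complexE; apply: (le_trans (cabsD _ _)).
by rewrite cabsM !cabs_real (_ : cabs 'i%C = 1) ?mul1r // /cabs normc_def /= expr0n add0r expr1n sqrtr1.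
Qed.

Definition psum a n : R[i] := \sum_(0 <= i < n) a i.

(** Complex numbers are handled through their real modulus, so that only real
    sequences have to converge. *)
Definition has_sum a z : Prop := ((fun n => cabs (psum a n - z)) @ \oo --> (0 : R))%classic.

(** This class of series, unlike that of all absolutely convergent ones, has an explicit
    bound for the remainder of a product. *)
Definition exp_bounded a : Prop :=
  exists M C, [/\ 0 <= M, 0 <= C & forall n, cabs (a n) <= M * exp_coeff C n].

Lemma squeeze0 (f g : nat -> R) : (forall n, 0 <= f n <= g n) ->
  (g @ \oo --> (0 : R))%classic -> (f @ \oo --> (0 : R))%classic.
Proof.
move=> fg g0; apply: (@squeeze_cvgr _ _ _ _ (cst 0) g) => //.
  by near=> n; apply: fg.
exact: cvg_cst.
Unshelve. all: by end_near. Qed.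

Lemma has_sum_unique a z w : has_sum a z -> has_sum a w -> z = w.
Proof.
move=> az aw; apply/eqP; rewrite -subr_eq0; apply/eqP/cabs_eq0.
have := cvgD az aw; rewrite addr0 => zw.
apply/eqP; rewrite eq_le cabs_ge0 andbT; apply: (cvgr_to_ge (zw _)).
near=> n; rewrite (_ : z - w = (z - psum a n) + (psum a n - w)); last by rewrite addrA subrK.
by apply: (le_trans (cabsD _ _)); rewrite cabsB.
Unshelve. all: by end_near. Qed.

Lemma has_sum_lin c a b z w : has_sum a z -> has_sum b w ->
  has_sum (fun n => c * a n + b n) (c * z + w).
Proof.
move=> az bw; apply: (@squeeze0 _ (fun n => cabs c * cabs (psum a n - z) + cabs (psum b n - w))).
  move=> n; rewrite cabs_ge0 /=.
  have -> : psum (fun n => c * a n + b n) n - (c * z + w) =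
      c * (psum a n - z) + (psum b n - w).
    rewrite /psum big_split /= -mulr_sumr mulrBr opprD; ring.
  by apply: (le_trans (cabsD _ _)); rewrite cabsM.
rewrite -[0](addr0 (0 : R)) -[X in X + _](mulr0 (cabs c)).
by apply: cvgD => //; apply: cvgM => //; apply: cvg_cst.
Qed.

Lemma has_sum_finite a N : (forall n, (N <= n)%N -> a n = 0) -> has_sum a (psum a N).
Proof.
move=> a0; apply: cvg_near_cst.
exists N => // n /= Nn; rewrite /psum (@big_cat_nat _ _ _ N) //=.
rewrite addrAC subrr add0r big_nat_cond big1 ?cabs0 // => i.
by rewrite andbT => /andP[/a0].
Qed.

Lemma has_sum0 : has_sum (fun=> 0) 0.
Proof. by have := @has_sum_finite (fun=> 0) 0 (fun _ _ => erefl); rewrite /psum big_nil. Qed.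

Lemma has_sum_sum (I : Type) (s : seq I) (F : I -> nat -> R[i]) (z : I -> R[i]) :
  (forall i, has_sum (F i) (z i)) ->
  has_sum (fun n => \sum_(i <- s) F i n) (\sum_(i <- s) z i).
Proof.
move=> Fz; elim: s => [|i s IH].
  rewrite big_nil (_ : (fun _ => _) = fun=> 0); first exact: has_sum0.
  by apply/funext => n; rewrite big_nil.
rewrite big_cons (_ : (fun _ => _) = fun n => 1 * F i n + \sum_(j <- s) F j n).
  by rewrite -[z i]mul1r; apply: has_sum_lin.
by apply/funext => n; rewrite big_cons mul1r.
Qed.

Lemma bounded_series_cvg (u : nat -> R) M C : 0 <= M -> 0 <= C ->
  (forall n, `|u n| <= M * exp_coeff C n) -> cvgn (series u).
Proof.
move=> M0 C0 uM; apply: normed_cvg.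
apply: (@series_le_cvg _ (fun n => `|u n|) (fun n => M * exp_coeff C n)) => //.
  by move=> n; rewrite mulr_ge0 ?exp_coeff_ge0.
have := @is_cvg_seriesZ R (exp_coeff C) M; apply.
exact: is_cvg_series_exp_coeff.
Qed.

Lemma exp_bounded_has_sum a : exp_bounded a -> exists z, has_sum a z.
Proof.
move=> [M [C [M0 C0 aM]]].
have /cvg_ex[r ur] : cvgn (series (fun n => Re (a n))).
  apply: (bounded_series_cvg M0 C0) => n.
  exact: (le_trans (cabs_Re _) (aM n)).
have /cvg_ex[s vs] : cvgn (series (fun n => Im (a n))).
  apply: (bounded_series_cvg M0 C0) => n.
  exact: (le_trans (cabs_Im _) (aM n)).
exists (r +i* s)%C.
have ReE n : Re (psum a n) = series (fun n => Re (a n)) n.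
  by rewrite /psum /series /=; apply: (big_morph Re) => // -[? ?] [? ?].
have ImE n : Im (psum a n) = series (fun n => Im (a n)) n.
  by rewrite /psum /series /=; apply: (big_morph Im) => // -[? ?] [? ?].
apply: (@squeeze0 _ (fun n => `|series (fun n => Re (a n)) n - r| +
  `|series (fun n => Im (a n)) n - s|)).
  move=> n; rewrite cabs_ge0 /= (le_trans (cabs_ReIm _)) //.
  by rewrite -ReE -ImE; case: (psum a n).
rewrite -[0](addr0 (0 : R)) -[in X in X + _](normr0 R) -[in X in _ + X](normr0 R).
by apply: cvgD; apply: cvg_norm; [rewrite -(subrr r)|rewrite -(subrr s)];
  apply: cvgB => //; apply: cvg_cst.
Qed.

(** The partial sums of a Cauchy product cover a triangle, the products of partial sums a
    square. *)
Lemma product_remainder (T : pzRingType) (a b : nat -> T) n :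
  (\sum_(0 <= i < n) a i) * (\sum_(0 <= j < n) b j) - \sum_(0 <= m < n) conv *%R a b m =
  \sum_(0 <= i < n) \sum_(n - i <= j < n) a i * b j.
Proof.
case: n => [|n]; first by rewrite !big_nil mul0r subrr.
have -> : \sum_(0 <= m < n.+1) conv *%R a b m =
    \sum_(0 <= i < n.+1) \sum_(0 <= j < n.+1 - i) a i * b j.
  rewrite !big_mkord (sum_assoc (fun i j _ => a i * b j)).
  by apply: eq_bigr => i _; rewrite big_mkord subSn // -ltnS.
rewrite big_distrlr /= -sumrB; apply: eq_bigr => i _.
by rewrite (@big_cat_nat _ _ _ (n.+1 - i)) ?leq_subr //= addrC addrK.
Qed.

Lemma exp_coeff_conv (x y : R) :
  conv *%R (exp_coeff x) (exp_coeff y) = exp_coeff (x + y).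
Proof.
apply/funext => n; rewrite /conv /exp_coeff /= addrC exprDn mulr_suml.
apply: eq_bigr => i _; have i_n : (i <= n)%N by rewrite -ltnS.
rewrite -mulr_natr -(bin_fact i_n) !natrM.
have i0 : i`!%:R != 0 :> R by rewrite pnatr_eq0 -lt0n fact_gt0.
have ni0 : (n - i)`!%:R != 0 :> R by rewrite pnatr_eq0 -lt0n fact_gt0.
have b0 : 'C(n, i)%:R != 0 :> R by rewrite pnatr_eq0 -lt0n bin_gt0.
by field; rewrite i0 ni0 b0.
Qed.

Lemma psum_cvg0 a z : has_sum a z -> forall w b, has_sum b w ->
  ((fun n => cabs (psum a n * psum b n - z * w)) @ \oo --> (0 : R))%classic.
Proof.
move=> az w b bw.
pose p n := cabs (psum a n - z); pose q n := cabs (psum b n - w).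
apply: (@squeeze0 _ (fun n => p n * q n + p n * cabs w + cabs z * q n)).
  move=> n; rewrite cabs_ge0 /=.
  have -> : psum a n * psum b n - z * w = (psum a n - z) * (psum b n - w) +
      (psum a n - z) * w + z * (psum b n - w) by ring.
  apply: (le_trans (cabsD _ _)); apply: lerD; last by rewrite cabsM.
  by apply: (le_trans (cabsD _ _)); rewrite !cabsM.
have -> : 0 = 0 * 0 + 0 * cabs w + cabs z * 0 :> R by ring.
by apply: cvgD; [apply: cvgD|]; apply: cvgM => //; apply: cvg_cst.
Qed.

(** The remainder is bounded by the same remainder for the real exponential series, which
    tends to zero by the functional equation of the exponential. *)
Lemma has_sum_conv a b z w : exp_bounded a -> exp_bounded b ->
  has_sum a z -> has_sum b w -> has_sum (conv *%R a b) (z * w).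
Proof.
move=> [M [C [M0 C0 aM]]] [M' [C' [M'0 C'0 bM]]] az bw.
pose S x n := series (@exp_coeff R x) n.
pose g n := M * M' * (S C n * S C' n - S (C + C') n) +
  cabs (psum a n * psum b n - z * w).
apply: (@squeeze0 _ g).
  move=> n; rewrite cabs_ge0 /=.
  have -> : psum (conv *%R a b) n - z * w =
      - (psum a n * psum b n - psum (conv *%R a b) n) + (psum a n * psum b n - z * w).
    by ring.
  apply: (le_trans (cabsD _ _)); rewrite /g lerD2r cabsN.
  rewrite /S /series /= -exp_coeff_conv product_remainder.
  rewrite /psum product_remainder.
  rewrite mulr_sumr (le_trans (cabs_sum _ _ _)) //; apply: ler_sum => i _.
  rewrite mulr_sumr (le_trans (cabs_sum _ _ _)) //; apply: ler_sum => j _.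
  by rewrite cabsM mulrACA ler_pM ?cabs_ge0.
have Scvg x : (S x @ \oo --> expR x)%classic by exact: is_cvg_series_exp_coeff.
have -> : 0 = M * M' * (expR C * expR C' - expR (C + C')) + 0 :> R.
  by rewrite expRD subrr mulr0 addr0.
apply: cvgD; last exact: psum_cvg0.
apply: cvgM; first exact: cvg_cst.
by apply: cvgB => //; apply: cvgM.
Qed.

Lemma has_sum_le a z B N : has_sum a z ->
  (forall n, (N <= n)%N -> cabs (psum a n) <= B) -> cabs z <= B.
Proof.
move=> az aB; rewrite -subr_le0 -oppr_ge0 opprB.
have : ((fun n => B - cabs z + cabs (psum a n - z)) @ \oo --> B - cabs z + 0)%classic.
  by apply: cvgD => //; apply: cvg_cst.
rewrite addr0 => /cvgr_to_ge; apply; exists N => // n /= /aB nB.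
rewrite -addrA; have := cabsD (z - psum a n) (psum a n); rewrite subrK cabsB; lra.
Qed.

End ComplexSeries.

(** * Exponential curves *)

Section Exponential.
Variables (R : realType) (L : algGroup R[i]).
Implicit Types (x y : lie L) (f g : coord L) (s t : R) (c : R -> L).

Lemma iter_lder_lin x n a f g :
  iter n (lder x) (a *: f + g) = a *: iter n (lder x) f + iter n (lder x) g.
Proof. by elim: n => //= n ->; rewrite lder_lin. Qed.

Lemma iter_lder0 x n : iter n (lder x) 0 = 0.
Proof. by elim: n => //= n ->; rewrite lder0. Qed.

Lemma iter_lder_sum x n (I : Type) (r : seq I) (a : I -> R[i]) (F : I -> coord L) :
  iter n (lder x) (\sum_(i <- r) a i *: F i) = \sum_(i <- r) a i *: iter n (lder x) (F i).
Proof.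
by elim: r => [|i r IH]; rewrite ?big_nil ?iter_lder0 // !big_cons iter_lder_lin IH.
Qed.

Lemma ltrans_iter u x n f : ltrans u (iter n (lder x) f) = iter n (lder x) (ltrans u f).
Proof. by elim: n => //= n IH; rewrite ltrans_lder IH. Qed.

(** The coefficients of the Taylor expansion at the identity, along [x]. *)
Definition tcoef x n f : R[i] := n`!%:R^-1 * ev 1%g (iter n (lder x) f).

Lemma tcoef_lin x n a f g : tcoef x n (a *: f + g) = a * tcoef x n f + tcoef x n g.
Proof. by rewrite /tcoef iter_lder_lin evD evZ; ring. Qed.

Lemma fact_unit n : n`!%:R != 0 :> R[i].
Proof. by rewrite pnatr_eq0 -lt0n fact_gt0. Qed.

(** The Leibniz rule for divided powers of a derivation. *)
Lemma iter_lder_mul x n f g :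
  n`!%:R^-1 *: iter n (lder x) (f * g) = \sum_(i < n.+1)
    (i`!%:R^-1 *: iter i (lder x) f) * ((n - i)`!%:R^-1 *: iter (n - i) (lder x) g).
Proof.
pose E i h : coord L := i`!%:R^-1 *: iter i (lder x) h.
rewrite -/(E n (f * g)) -[RHS]/(\sum_(i < n.+1) E i f * E (n - i)%N g).
have DE i h : lder x (E i h) = i.+1%:R *: E i.+1 h.
  rewrite /E -[X in lder x X]addr0 lder_lin lder0 addr0 /= scalerA factS natrM.
  by rewrite invfM mulrA mulfV ?mul1r // pnatr_eq0.
elim: n => [|n IH]; first by rewrite big_ord_recl big_ord0 addr0 /E /= fact0 invr1 !scale1r.
have n0 : n.+1%:R != 0 :> R[i] by rewrite pnatr_eq0.
apply: (scalerI n0); rewrite -DE IH.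
have -> : lder x (\sum_(i < n.+1) E i f * E (n - i)%N g) =
    \sum_(i < n.+1) i.+1%:R *: (E i.+1 f * E (n - i)%N g) +
    \sum_(i < n.+1) (n - i).+1%:R *: (E i f * E (n - i).+1 g).
  rewrite -big_split /= (big_morph (lder x) (id1 := 0) (op1 := +%R)).
  - by apply: eq_bigr => i _; rewrite lderM !DE scalerAl scalerAr.
  - by move=> a b; have := lder_lin x 1 a b; rewrite !scale1r.
  - exact: lder0.
have -> : n.+1%:R *: (\sum_(i < n.+2) E i f * E (n.+1 - i)%N g) =
    \sum_(i < n.+2) i%:R *: (E i f * E (n.+1 - i)%N g) +
    \sum_(i < n.+2) (n.+1 - i)%:R *: (E i f * E (n.+1 - i)%N g).
  rewrite -big_split scaler_sumr; apply: eq_bigr => i _ /=.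
  by rewrite -scalerDl -natrD subnKC // -ltnS.
congr (_ + _).
  by rewrite [RHS]big_ord_recl scale0r add0r; apply: eq_bigr => i _; rewrite subSS.
rewrite [RHS]big_ord_recr /= subnn scale0r addr0; apply: eq_bigr => i _.
by rewrite subSn // -ltnS.
Qed.

Lemma tcoefM x n f g :
  tcoef x n (f * g) = \sum_(i < n.+1) tcoef x i f * tcoef x (n - i) g.
Proof.
rewrite /tcoef -evZ iter_lder_mul ev_sum.
by apply: eq_bigr => i _; rewrite evM !evZ.
Qed.

(** A left invariant derivation acts on the second factor of a decomposition, and
    commutes with left translations. *)
Lemma comul_iter x n f :
  \sum_(p <- comul f) ev 1%g (iter n (lder x) p.2) *: p.1 = iter n (lder x) f.
Proof.
apply: ev_ext => u; rewrite -[u in RHS]mulg1 -ltransE ltrans_iter /ltrans.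
rewrite iter_lder_sum !ev_sum; apply: eq_bigr => p _.
by rewrite !evZ mulrC.
Qed.

Lemma tcoef_comul x i j f : \sum_(p <- comul f) tcoef x i p.1 * tcoef x j p.2 =
  i`!%:R^-1 * j`!%:R^-1 * ev 1%g (iter (i + j) (lder x) f).
Proof.
rewrite iterD -[iter j _ f in RHS]comul_iter iter_lder_sum ev_sum mulr_sumr.
by apply: eq_bigr => p _; rewrite evZ /tcoef; ring.
Qed.

Lemma sum_mul_le (I : Type) (r : seq I) (a b : I -> R) :
  (forall i, 0 <= a i) -> (forall i, 0 <= b i) ->
  \sum_(i <- r) a i * b i <= (\sum_(i <- r) a i) * (\sum_(i <- r) b i).
Proof.
move=> a0 b0; elim: r => [|i r IH]; first by rewrite !big_nil mulr0.
rewrite !big_cons.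
have A0 : 0 <= \sum_(i <- r) a i by apply: sumr_ge0.
have B0 : 0 <= \sum_(i <- r) b i by apply: sumr_ge0.
have := mulr_ge0 (a0 i) B0; have := mulr_ge0 A0 (b0 i).
by rewrite mulrDl !mulrDr; lra.
Qed.

(** All iterates are combinations of the finitely many first components of a
    decomposition of [f], so their growth is at most geometric. *)
Lemma iter_lder_bound x f : exists M C, [/\ 0 <= M, 0 <= C &
  forall n, cabs (ev 1%g (iter n (lder x) f)) <= M * C ^+ n].
Proof.
have [r rE] := coord_interpolation [seq p.1 | p <- comul f].
pose D n := iter n (lder x) f.
have DE n : D n = \sum_(p <- r) ev p.2 (D n) *: p.1.
  rewrite {1}/D -comul_iter big_seq.
  under eq_bigr => p pf do rewrite (rE p.1 (map_f _ pf)) scaler_sumr.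
  rewrite -big_seq exchange_big; apply: eq_bigr => j _ /=.
  rewrite /D -[in RHS]comul_iter ev_sum scaler_suml.
  by apply: eq_bigr => p _; rewrite evZ scalerA.
(* The values of the iterates at the interpolation points evolve by a fixed matrix. *)
pose N n : R := \sum_(p <- r) cabs (ev p.2 (D n)).
pose row (p : coord L * L) : R := \sum_(p' <- r) cabs (ev p'.2 (lder x p.1)).
pose C := \sum_(p <- r) row p.
pose B := \sum_(p <- r) cabs (ev 1%g p.1).
have row0 p : 0 <= row p by apply: sumr_ge0 => *; apply: cabs_ge0.
have C0 : 0 <= C by apply: sumr_ge0.
have B0 : 0 <= B by apply: sumr_ge0 => *; apply: cabs_ge0.
have N0 n : 0 <= N n by apply: sumr_ge0 => *; apply: cabs_ge0.
have NS n : N n.+1 <= N n * C.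
  apply: le_trans (sum_mul_le r (fun p => cabs_ge0 (ev p.2 (D n))) row0).
  rewrite /row; under [leRHS]eq_bigr do rewrite mulr_sumr.
  rewrite exchange_big /=; apply: ler_sum => p _.
  rewrite {1}/D iterS -/(D n) {1}DE -[X in lder x X]addr0.
  rewrite -[lder x _]/(iter 1 (lder x) _) addr0 iter_lder_sum ev_sum.
  apply: (le_trans (cabs_sum _ _ _)); apply: ler_sum => j _.
  by rewrite evZ cabsM.
have NC n : N n <= N 0%N * C ^+ n.
  elim: n => [|n IH]; first by rewrite mulr1.
  by apply: (le_trans (NS n)); rewrite exprSr mulrA ler_wpM2r.
exists (N 0%N * B), C; split=> //; first exact: mulr_ge0.
move=> n; rewrite -/(D n) DE ev_sum; apply: (le_trans (cabs_sum _ _ _)).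
under eq_bigr do rewrite evZ cabsM.
have := sum_mul_le r (fun p => cabs_ge0 (ev p.2 (D n))) (fun p => cabs_ge0 (ev 1%g p.1)).
by move=> /le_trans; apply; rewrite -/(N n) -/B mulrAC ler_wpM2r.
Qed.

Lemma tcoef_bound x f : exists M C, [/\ 0 <= M, 0 <= C &
  forall t n, cabs (t%:C%C ^+ n * tcoef x n f) <= M * (`|t| ^+ n * exp_coeff C n)].
Proof.
have [M [C [M0 C0 MC]]] := iter_lder_bound x f; exists M, C; split=> // t n.
rewrite /tcoef !cabsM cabsX cabs_real.
have -> : cabs n`!%:R^-1 = n`!%:R^-1 :> R.
  have -> : n`!%:R^-1 = (n`!%:R^-1 : R)%:C%C :> R[i].
    by rewrite fmorphV rmorph_nat.
  by rewrite cabs_real ger0_norm // invr_ge0 ler0n.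
rewrite /exp_coeff /= [leRHS]mulrCA ler_wpM2l ?exprn_ge0 //.
by rewrite mulrC mulrA ler_wpM2r // invr_ge0 ler0n.
Qed.

Definition exp_curve x c : Prop :=
  forall t f, has_sum (fun n => t%:C%C ^+ n * tcoef x n f) (ev (c t) f).

Lemma tcoef_exp_bounded x t f : exp_bounded (fun n => t%:C%C ^+ n * tcoef x n f).
Proof.
have [M [C [M0 C0 MC]]] := tcoef_bound x f; exists M, (`|t| * C).
split=> // [|n]; first exact: mulr_ge0.
by rewrite (le_trans (MC t n)) // /exp_coeff /= exprMn !mulrA.
Qed.

(** The sum of the exponential series is a character of the coordinate algebra,
    hence evaluation at a point of the group. *)
Lemma exp_curve_exists x : exists c, exp_curve x c.
Proof.
have /choice[chi chiE] (tf : R * coord L) : exists z,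
    has_sum (fun n => tf.1%:C%C ^+ n * tcoef x n tf.2) z.
  exact/exp_bounded_has_sum/tcoef_exp_bounded.
suff /choice[c cE] t : exists u : L, forall f, ev u f = chi (t, f).
  by exists c => t f; rewrite cE; apply: chiE (t, f).
apply: ev_surj; split=> [a f g|f g|].
- apply: has_sum_unique (chiE (t, a *: f + g)) _ => /=.
  have := has_sum_lin a (chiE (t, f)) (chiE (t, g)) => /=; congr has_sum.
  by apply/funext => n; rewrite tcoef_lin; ring.
- apply: has_sum_unique (chiE (t, f * g)) _ => /=.
  have := has_sum_conv (tcoef_exp_bounded x t f) (tcoef_exp_bounded x t g)
    (chiE (t, f)) (chiE (t, g)); congr has_sum.
  apply/funext => n; rewrite tcoefM mulr_sumr; apply: eq_bigr => i _.
  have i_n : (i <= n)%N by rewrite -ltnS.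
  by rewrite mulrACA -exprD subnKC.
- apply: has_sum_unique (chiE (t, 1)) _ => /=.
  have := @has_sum_finite _ (fun n => t%:C%C ^+ n * tcoef x n 1) 1.
  rewrite /psum big_nat1 expr0 mul1r /tcoef /= fact0 invr1 mul1r ev1; apply.
  by case=> // n _; rewrite iterSr lder1 iter_lder0 ev0 !mulr0.
Qed.

(** The addition formula comes from the Cauchy product, as the coefficients of the two
    factors combine by [tcoef_comul]. *)
Lemma exp_curveD x c s t : exp_curve x c -> c (s + t) = (c s * c t)%g.
Proof.
move=> xc; apply: ev_inj => f; apply: has_sum_unique (xc (s + t) f) _.
rewrite comulE.
have := has_sum_sum (comul f) (fun p => has_sum_conv (tcoef_exp_bounded x s p.1)
  (tcoef_exp_bounded x t p.2) (xc s p.1) (xc t p.2)); congr has_sum.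
apply/funext => n; rewrite /conv exchange_big /=.
under eq_bigr => i _.
  under eq_bigr do rewrite mulrACA.
  rewrite -mulr_sumr tcoef_comul subnKC; last by rewrite -ltnS.
  over.
rewrite /tcoef rmorphD /= addrC exprDn mulr_suml; apply: eq_bigr => i _.
have i_n : (i <= n)%N by rewrite -ltnS.
rewrite -mulr_natr -(bin_fact i_n) !natrM.
have i0 := fact_unit i; have ni0 := fact_unit (n - i).
have b0 : 'C(n, i)%:R != 0 :> R[i] by rewrite pnatr_eq0 -lt0n bin_gt0.
by field; rewrite i0 ni0 b0.
Qed.

Lemma exp_curve0 x c : exp_curve x c -> c 0 = 1%g.
Proof.
by move=> xc; apply: (mulgI (c 0)); rewrite -(exp_curveD _ _ xc) addr0 mulg1.
Qed.

(** The bound is uniform in [t], which is what makes small periods useful. *)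
Lemma exp_curve_derivative x c f : exp_curve x c ->
  exists2 B, 0 <= B & forall t, `|t| <= 1 ->
    cabs (ev (c t) f - (ev 1%g f + t%:C%C * x f)) <= `|t| ^+ 2 * B.
Proof.
move=> xc; have [M [C [M0 C0 MC]]] := tcoef_bound x f.
exists (M * expR C) => [|t t1]; first by rewrite mulr_ge0 ?expR_ge0.
pose a n := t%:C%C ^+ n * tcoef x n f.
have a01 : psum a 2 = ev 1%g f + t%:C%C * x f.
  rewrite /psum big_nat_recr // big_nat1 /a /tcoef /= fact0 invr1 expr0 !mul1r expr1.
  by rewrite lder_at1.
rewrite -a01; pose b n := if (n < 2)%N then a n else 0.
have b2 : has_sum b (psum a 2).
  rewrite -(_ : psum b 2 = psum a 2).
    by apply: has_sum_finite => n n2; rewrite /b ltnNge n2.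
  by rewrite /psum; apply: eq_big_nat => n /andP[_ n2]; rewrite /b n2.
have := has_sum_lin (- 1) b2 (xc t f); rewrite mulN1r addrC => ab.
apply: (has_sum_le (N := 0) ab) => n _.
have term i : cabs (- 1 * b i + a i) <= `|t| ^+ 2 * M * exp_coeff C i.
  rewrite /b; case: ltnP => i2.
    rewrite mulN1r addNr cabs0; apply: mulr_ge0; last exact: exp_coeff_ge0.
    by apply: mulr_ge0; rewrite ?exprn_ge0.
  rewrite mulr0 add0r (le_trans (MC t i)) // mulrA [M * _]mulrC.
  rewrite ler_wpM2r ?exp_coeff_ge0 // ler_wpM2r //.
  by rewrite ler_wiXn2l.
apply: (le_trans (cabs_sum _ _ _)).
apply: (@le_trans _ _ (\sum_(0 <= i < n) `|t| ^+ 2 * M * exp_coeff C i)).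
  by apply: ler_sum => i _; apply: term.
rewrite -mulr_sumr -mulrA ler_wpM2l ?exprn_ge0 // ler_wpM2l //.
rewrite -[X in X <= _]/(series (exp_coeff C) n).
apply: nondecreasing_cvgn_le; last exact: is_cvg_series_exp_coeff.
by apply: nondecreasing_series => i _; rewrite exp_coeff_ge0.
Qed.

End Exponential.

(** * Functions invariant under exponentials *)

Section Periods.
Variables (R : realType).

Definition golden : R := (Num.sqrt 5 - 1) / 2.

Lemma goldenP : [/\ 0 < golden, golden < 1 & golden ^+ 2 + golden = 1].
Proof.
have s5 : Num.sqrt 5 ^+ 2 = 5 :> R by rewrite sqr_sqrtr // ler0n.
have s0 : 0 <= Num.sqrt 5 :> R by apply: sqrtr_ge0.
have s1 : 1 < Num.sqrt 5 :> R.
  by rewrite ltNge; apply/negP => s1; move: s5 s0 s1; rewrite expr2; nra.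
have s3 : Num.sqrt 5 < 3 :> R.
  by rewrite ltNge; apply/negP => s3; move: s5 s0 s3; rewrite expr2; nra.
rewrite /golden; move: s5 s1 s3; move: (Num.sqrt 5) => s s5 s1 s3.
by split; [lra|lra|move: s5; rewrite !expr2; lra].
Qed.

Variables (L : algGroup R[i]) (x : lie L) (c : R -> L).
Hypothesis xc : exp_curve x c.

(** Two incommensurable periods generate arbitrarily small ones, and this forces
    the derivative to vanish. *)
Lemma exp_curve_periods f :
  (forall t, ev (c (t + 1)) f = ev (c t) f) ->
  (forall t, ev (c (t + golden)) f = ev (c t) f) -> x f = 0.
Proof.
move=> per1 per2; have [g0 g1 g2] := goldenP.
have per n : (forall t, ev (c (t + golden ^+ n)) f = ev (c t) f) /\
    (forall t, ev (c (t + golden ^+ n.+1)) f = ev (c t) f).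
  elim: n => [|n [IH1 IH2]]; first by rewrite expr0 expr1.
  split=> // t; rewrite -IH2 -addrA -[in RHS]IH1; congr (ev (c (t + _)) f).
  by rewrite -[RHS]mulr1 -g2 !exprS; ring.
have [B B0 xB] := exp_curve_derivative f xc.
have small n : cabs (x f) <= golden ^+ n * B.
  have gn0 : 0 < golden ^+ n by apply: exprn_gt0.
  have gn1 : golden ^+ n <= 1 by rewrite exprn_ile1 // ltW.
  have := xB (golden ^+ n); rewrite ger0_norm ?(ltW gn0) // => /(_ gn1).
  have [/(_ 0) + _] := per n; rewrite add0r (exp_curve0 xc) => ->.
  rewrite opprD addrA subrr sub0r cabsN cabsM cabs_real ger0_norm ?(ltW gn0) //.
  by rewrite expr2 -mulrA ler_pM2l.
apply/cabs_eq0/eqP; rewrite eq_le cabs_ge0 andbT.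
have gB : ((fun n => golden ^+ n * B) @ \oo --> 0 * B)%classic.
  apply: cvgM; last exact: cvg_cst.
  by apply: cvg_expr; rewrite ger0_norm // ltW.
rewrite mul0r in gB; apply: (cvgr_to_ge gB); by near=> n; apply: small.
Unshelve. all: by end_near. Qed.

End Periods.

Section CurvesInGroups.
Variables (R : realType) (L G : algGroup R[i]).

Lemma exp_curve_diff (phi : agHom L G) (x : lie L) (c : R -> L) :
  exp_curve x c -> exp_curve (diff phi x) (fun t => phi (c t)).
Proof.
move=> xc t f; rewrite -pullbackE; have := xc t (pullback phi f); congr has_sum.
apply/funext => n; rewrite /tcoef; congr (_ * (_ * _)).
rewrite (_ : iter n (lder x) (pullback phi f) =
  pullback phi (iter n (lder (diff phi x)) f)) ?pullbackE ?hom1 //.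
by elim: n => //= n ->; rewrite lder_pullback.
Qed.

End CurvesInGroups.

Section InvariantFunctions.
Variables (R : realType) (G : algGroup R[i]).
Implicit Types (x y z : lie G) (c : R -> G) (F : coord G) (g h : G).

Lemma exp_curve_conj h y c :
  exp_curve y c -> exp_curve (lieAd h y) (fun t => h * c t * h^-1)%g.
Proof. exact: exp_curve_diff. Qed.

(** The hypotheses pass to all left translates of [F], so the derivative vanishes at every
    point. *)
Lemma lder_eq0 x c F : exp_curve x c ->
  (forall g, ev (g * c 1%R)%g F = ev g F) ->
  (forall g, ev (g * c (golden R))%g F = ev g F) -> lder x F = 0.
Proof.
move=> xc F1 F2; apply: ev_ext => g; rewrite lderE ev0.
by apply: (exp_curve_periods xc) => t; rewrite (exp_curveD _ _ xc) !ltransE mulgA.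
Qed.

(** Functions that are killed by an ideal do not see a change of [y] by an
    element of the ideal. *)
Lemma ideal_invariant (P : lie G -> Prop) y h c F :
  (forall x, P x -> P (bracket x y)) -> P (lieAd h y - y) ->
  exp_curve y c ->
  (forall x, P x -> lder x F = 0) -> (forall g, ev (g * h)%g F = ev g F) ->
  forall t, ev (h * c t)%g F = ev (c t) F.
Proof.
move=> Pbr Pz yc PF Fh t; have hyc := exp_curve_conj h yc.
have -> : ev (h * c t)%g F = ev (h * c t * h^-1)%g F.
  by rewrite -[RHS]Fh mulgVK.
apply: has_sum_unique (hyc t F) _; have := yc t F; congr has_sum.
apply/funext => n; rewrite /tcoef; congr (_ * (_ * ev _ _)).
suff [] : iter n (lder y) F = iter n (lder (lieAd h y)) F /\
    forall x, P x -> lder x (iter n (lder y) F) = 0 by [].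
elim: n => [//|n [IH PIH]] /=; split.
  rewrite -IH -[lieAd h y](subrK y) -[lieAd h y - y]scale1r lder_linx scale1r.
  by rewrite (PIH _ Pz) add0r.
move=> x Px; have := lder_bracket x y (iter n (lder y) F).
by rewrite (PIH _ (Pbr _ Px)) (PIH _ Px) lder0 subr0 => <-.
Qed.

End InvariantFunctions.

(** * Left ideals and quantum Hamiltonian reduction *)

Section LeftIdeals.
Variables (B : pzRingType) (X : set B).

Lemma lideal0 : lideal X 0.
Proof.
by exists 0%N, (fun=> 0), (fun=> 0); split=> [[]//|]; rewrite big_ord0.
Qed.

Lemma lidealD a b : lideal X a -> lideal X b -> lideal X (a + b).
Proof.
move=> [n [u [x [Xx ->]]]] [m [v [y [Xy ->]]]]; exists (n + m)%N.
exists (fun i => match fintype.split i with inl j => u j | inr j => v j end).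
exists (fun i => match fintype.split i with inl j => x j | inr j => y j end).
split=> [i|]; first by case: (fintype.split i) => j.
rewrite big_split_ord /=; congr (_ + _); apply: eq_bigr => i _.
  by rewrite -[lshift m i]/(unsplit (inl i)) unsplitK.
by rewrite -[rshift n i]/(unsplit (inr i)) unsplitK.
Qed.

Lemma lidealMl c a : lideal X a -> lideal X (c * a).
Proof.
move=> [n [u [x [Xx ->]]]]; exists n, (fun i => c * u i), x; split=> //.
by rewrite mulr_sumr; apply: eq_bigr => i _; rewrite mulrA.
Qed.

Lemma lidealN a : lideal X a -> lideal X (- a).
Proof. by move=> Xa; rewrite -mulN1r; apply: lidealMl. Qed.

Lemma lidealB a b : lideal X a -> lideal X b -> lideal X (a - b).
Proof. by move=> Xa Xb; apply: lidealD => //; apply: lidealN. Qed.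

Lemma lideal_gen a : X a -> lideal X a.
Proof.
by move=> Xa; exists 1%N, (fun=> 1), (fun=> a); rewrite big_ord1 mul1r.
Qed.

Lemma lideal_sum (I : Type) (s : seq I) (F : I -> B) :
  (forall i, lideal X (F i)) -> lideal X (\sum_(i <- s) F i).
Proof.
by move=> XF; elim/big_ind: _ => //; [exact: lideal0 | exact: lidealD].
Qed.

Lemma lideal_ind (P : B -> Prop) : P 0 -> (forall a b, P a -> P b -> P (a + b)) ->
  (forall u x, X x -> P (u * x)) -> forall a, lideal X a -> P a.
Proof.
move=> P0 PD Pgen a [n [u [x [Xx ->]]]].
by elim/big_ind: _ => // i _; apply: Pgen.
Qed.

End LeftIdeals.

Section AlgOver.
Variables (k : fieldType) (B : algOverType (ser k)).

Definition scal (c : k) : B := inalg (sconst c).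

Lemma inalg0 : inalg 0 = 0 :> B.
Proof. by apply: (addrI (inalg 0)); rewrite -inalgD !addr0. Qed.
Lemma inalgN c : inalg (- c) = - inalg c :> B.
Proof. by apply: (addrI (inalg c)); rewrite -inalgD !subrr inalg0. Qed.
Lemma sconst0 : sconst (0 : k) = 0.
Proof. by apply/funext; case. Qed.
Lemma scal0 : scal 0 = 0.
Proof. by rewrite /scal sconst0 inalg0. Qed.
Lemma scal1 : scal 1 = 1.
Proof. by rewrite /scal -fps1 inalg1. Qed.
Lemma scalD c d : scal (c + d) = scal c + scal d.
Proof.
by rewrite /scal -inalgD; congr inalg; apply/funext; case=> [//|n]; rewrite serD addr0.
Qed.
Lemma scalM c d : scal (c * d) = scal c * scal d.
Proof.
rewrite /scal -inalgM fpsM conv_const_l; last exact: mul0r.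
by congr inalg; apply/funext => -[|n] //=; rewrite mulr0.
Qed.
Lemma scal_suml (I : Type) (s : seq I) (c : I -> k) (b : B) :
  scal (\sum_(i <- s) c i) * b = \sum_(i <- s) scal (c i) * b.
Proof.
elim: s => [|i s IH]; first by rewrite !big_nil scal0 mul0r.
by rewrite !big_cons scalD mulrDl IH.
Qed.
Lemma scalC c (b : B) : scal c * b = b * scal c.
Proof. exact: inalgC. Qed.

End AlgOver.

Section ReductionIdeal.
Variables (k : fieldType) (G : algGroup k) (B : algOverType (ser k)).
Variables (Phi : lie G -> B) (gamma : lie G -> k).

(** The image of the generator [x - gamma x hbar] of the ideal. *)
Definition shifted (x : lie G) : B := Phi x - inalg (sconst (gamma x) * hbar).

Hypothesis PhiL : forall (c : k) x y,
  Phi (c *: x + y) = inalg (sconst c) * Phi x + Phi y.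
Hypothesis PhiM : forall x y,
  Phi x * Phi y - Phi y * Phi x = inalg hbar * Phi (bracket x y).
Hypothesis gamma_bracket : forall x y, gamma (bracket x y) = 0.

(** As [gamma] vanishes on brackets, the shifted generators normalise the algebra
    generated by the image of [Phi], and right factors can be moved to the left. *)
Lemma red_idealE : red_ideal Phi gamma = lideal [set shifted x | x in setT]%classic.
Proof.
have [uD uM u1 uc uv] := uextP PhiL PhiM.
set J := lideal _.
have u0 : uext Phi (0 : Uh (@bracket k G)) = 0.
  by apply: (addrI (uext Phi (0 : Uh (@bracket k G)))); rewrite -uD !addr0.
have uN (u : Uh (@bracket k G)) : uext Phi (- u) = - uext Phi u.
  by apply: (addrI (uext Phi u)); rewrite -uD !subrr u0.
have uS x : uext Phi (uvar (@bracket k G) x - inalg (sconst (gamma x) * hbar)) = shifted x.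
  by rewrite uD uN uv uc.
have shiftM x y : shifted x * Phi y = Phi y * shifted x + inalg hbar * shifted (bracket x y).
  rewrite /shifted gamma_bracket sconst0 mul0r inalg0 subr0 -PhiM.
  by rewrite mulrBl mulrBr inalgC [RHS]addrC addrA subrK.
have Jr a t : J a -> J (a * ueval Phi t).
  elim: t a => [y|c|s IHs t IHt|s IHs t IHt] a Ja /=.
  - move: a Ja; apply: lideal_ind => [|a b Ja Jb|u _ [x _ <-]].
    + by rewrite mul0r; apply: lideal0.
    + by rewrite mulrDl; apply: lidealD.
    + rewrite -mulrA shiftM mulrDr; apply: lidealD.
        by rewrite mulrA; apply/lidealMl/lideal_gen; exists x.
      by rewrite mulrA; apply/lidealMl/lideal_gen; exists (bracket x y).
  - by rewrite -inalgC; apply: lidealMl.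
  - by rewrite mulrDr; apply: lidealD; [apply: IHs|apply: IHt].
  - by rewrite mulrA; apply/IHt/IHs.
apply/seteqP; split=> b.
- apply: lideal_ind => [|a c|u _ [_ [n [v [x [w [Xx ->]]]]] <-]].
  + exact: lideal0.
  + exact: lidealD.
  + apply: lidealMl; rewrite (big_morph (uext Phi) uD u0); apply: lideal_sum => i.
    have [y ->] := Xx i; rewrite !uM uS -mulrA; apply: lidealMl.
    by apply: Jr; apply: lideal_gen; exists y.
- apply: lideal_ind => [|a c|u _ [x _ <-]].
  + exact: lideal0.
  + exact: lidealD.
  + apply/lidealMl/lideal_gen; rewrite -uS; eexists; last reflexivity.
    exists 1%N, (fun=> 1), (fun=> uvar (@bracket k G) x - inalg (sconst (gamma x) * hbar)), (fun=> 1).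
    split; first by exists x.
    by rewrite big_ord1 mul1r mulr1.
Qed.

Lemma red_ideal_shifted x : red_ideal Phi gamma (shifted x).
Proof. by rewrite red_idealE; apply: lideal_gen; exists x. Qed.

Variables (fil : nat -> set B) (Ad : G -> B -> B) (der : lie G -> B -> B).
Hypothesis AdP : is_action fil Ad.
Hypothesis PhiP : is_comoment Ad der Phi.
Hypothesis gamma_inv : forall g x, gamma (lieAd g x) = gamma x.

Lemma act0 g : Ad g 0 = 0.
Proof. by apply: (addrI (Ad g 0)); rewrite -(act_add AdP) !addr0. Qed.
Lemma actN g b : Ad g (- b) = - Ad g b.
Proof. by apply: (addrI (Ad g b)); rewrite -(act_add AdP) !subrr act0. Qed.
Lemma actB g a b : Ad g (a - b) = Ad g a - Ad g b.
Proof. by rewrite (act_add AdP) actN. Qed.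

Lemma act_shifted g x : Ad g (shifted x) = shifted (lieAd g x).
Proof.
by rewrite /shifted actB (act_inalg AdP) gamma_inv (com_equiv PhiP).
Qed.

Lemma act_lideal (P : set (lie G)) g b : (forall x, P x -> P (lieAd g x)) ->
  lideal (shifted @` P)%classic b -> lideal (shifted @` P)%classic (Ad g b).
Proof.
move=> PAd; move: b; apply: lideal_ind => [|a c|u _ [x Px <-]].
- by rewrite act0; apply: lideal0.
- by rewrite (act_add AdP); apply: lidealD.
- rewrite (act_mul AdP) act_shifted.
  by apply/lidealMl/lideal_gen; exists (lieAd g x) => //; apply: PAd.
Qed.

Lemma act_red_ideal g b : red_ideal Phi gamma b -> red_ideal Phi gamma (Ad g b).
Proof. by rewrite red_idealE; apply: act_lideal. Qed.

(** The only axiom that is not formal is the stability of the ideal under right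
    multiplication by invariants. Since [shifted x * s] is [s * shifted x] plus
    [hbar] times [der x s], it follows from the hypothesis on derivations. *)
Lemma reducible_criterion :
  (forall x s, red_inv Ad Phi gamma s -> red_ideal Phi gamma (der x s)) ->
  reducible Ad Phi gamma.
Proof.
move=> derS.
have J0 : red_ideal Phi gamma 0 by apply: lideal0.
have Jr a b : red_ideal Phi gamma a -> red_inv Ad Phi gamma b -> red_ideal Phi gamma (a * b).
  move=> + Sb; rewrite [in X in X -> _]red_idealE; move: a.
  apply: lideal_ind => [|a c Ja Jc|u _ [x _ <-]].
  - by rewrite mul0r.
  - by rewrite mulrDl; apply: lidealD.
  - rewrite -mulrA; apply: lidealMl.
    have -> : shifted x * b = b * shifted x + inalg hbar * der x b.
      by rewrite -(com_der PhiP) /shifted mulrBl mulrBr inalgC [RHS]addrC addrA subrK.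
    apply: lidealD; first exact/lidealMl/red_ideal_shifted.
    exact/lidealMl/derS.
split=> //.
- by move=> b Jb g; apply: lidealB => //; apply: act_red_ideal.
- by move=> a b; apply: lidealB.
- by move=> a b _; apply: lidealMl.
- move=> a b Sa Sb g; rewrite actB.
  have -> : Ad g a - Ad g b - (a - b) = (Ad g a - a) - (Ad g b - b).
    by rewrite !opprB addrACA [RHS]addrACA [- a - _]addrC.
  by apply: lidealB; [apply: Sa | apply: Sb].
- move=> a b Sa Sb g; rewrite (act_mul AdP).
  have -> : Ad g a * Ad g b - a * b = Ad g a * (Ad g b - b) + (Ad g a - a) * b.
    by rewrite mulrBr mulrBl addrA subrK.
  by apply: lidealD; [apply/lidealMl/Sb | apply: Jr].
- by move=> c g; rewrite (act_inalg AdP) subrr.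
Qed.

End ReductionIdeal.

(** * Averages of an action on a deformation quantisation *)

Section QuantisationCoefficients.
Variables (k : fieldType) (A : comAlgType k) (br : poisson A) (Q : defquant br).
Implicit Types (a b : Ahbar Q).

Lemma star_coefE a b n :
  (a * b) n = \sum_(j < n.+1) \sum_(i < (n - j).+1) dq_coef Q j (a i) (b (n - j - i)%N).
Proof. by []. Qed.

Lemma dq_coef0l n f : dq_coef Q n 0 f = 0.
Proof.
have := dq_linl Q n 1 0 0 f; rewrite !scale1r addr0 => /esym/eqP.
by rewrite -subr_eq0 addrK => /eqP.
Qed.

Lemma dq_coefZl n c f g : dq_coef Q n (c *: f) g = c *: dq_coef Q n f g.
Proof. by have := dq_linl Q n c f 0 g; rewrite dq_coef0l !addr0. Qed.

Lemma cscale_mull c a b : (cscale c a : Ahbar Q) * b = cscale c (a * b).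
Proof.
apply/funext => n; rewrite star_coefE /cscale star_coefE scaler_sumr.
apply: eq_bigr => j _; rewrite scaler_sumr; apply: eq_bigr => i _.
exact: dq_coefZl.
Qed.

Lemma scalE c b : scal (Ahbar Q) c * b = cscale c b.
Proof.
have -> : scal (Ahbar Q) c = cscale c (1 : Ahbar Q).
  rewrite /scal -[LHS]/(sconst c *: ((1 : Ahbar Q) : ser A)) serZ conv_const_l //.
  exact: scale0r.
by rewrite cscale_mull mul1r.
Qed.

Definition hshift a : Ahbar Q := fun n => if n is m.+1 then a m else 0.

Lemma hbar_mul b : inalg hbar * b = hshift b.
Proof.
have -> : inalg hbar = hshift 1.
  rewrite -[LHS]/(hbar *: ((1 : Ahbar Q) : ser A)) serZ; apply/funext => -[|n].
    by rewrite /conv big_ord1 scale0r.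
  rewrite /conv big_ord_recl scale0r add0r big_ord_recl scale1r subSS subn0.
  by rewrite big1 ?addr0 // => i _; rewrite scale0r.
apply/funext => -[|n].
  by rewrite star_coefE big_ord1 big_ord1 dq_coef0l.
rewrite -[RHS]/(b n) -[b in RHS]mul1r [RHS]star_coefE star_coefE big_ord_recr /= subnn.
rewrite big_ord1 dq_coef0l addr0; apply: eq_bigr => j _.
rewrite subSn ?big_ord_recl ?dq_coef0l ?add0r; last by rewrite -ltnS.
by [].
Qed.

Lemma hadic_divisible a n : hadic n a ->
  a = (inalg hbar) ^+ n * ((fun i => a (i + n)%N) : Ahbar Q).
Proof.
elim: n a => [|n IH] a an.
  by rewrite mul1r; apply/funext => i; rewrite addn0.
rewrite exprS -mulrA hbar_mul.
have := IH (fun i => a i.+1 : A); rewrite /hshift => IH'.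
apply/funext => -[|i]; first by rewrite an.
have {}/IH' /(congr1 (fun f : Ahbar Q => f i)) : @hadic _ _ _ Q n (fun i => a i.+1).
  by move=> j jn; apply: an.
move=> ->; congr ((_ * _ : Ahbar Q) i).
by apply/funext => j; rewrite addnS.
Qed.

Lemma hadic_separated a : (forall n, hadic n a) -> a = 0.
Proof. by move=> a0; apply/funext => i; apply: (a0 i.+1). Qed.

Lemma ahbar_sumE (I : Type) (s : seq I) (F : I -> Ahbar Q) i :
  (\sum_(j <- s) F j) i = \sum_(j <- s) F j i.
Proof. by apply: (big_morph (fun a : Ahbar Q => a i)). Qed.

Lemma causal_mulr b : causal_linear (fun a : Ahbar Q => a * b).
Proof.
split=> [a c|c a|n a an].
- exact: (mulrDl (a : Ahbar Q) (c : Ahbar Q) b).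
- exact: cscale_mull.
- rewrite star_coefE big1 // => j _; rewrite big1 // => i _.
  rewrite an ?dq_coef0l //; apply: leq_trans (leq_subr j n).
  by rewrite -ltnS.
Qed.

End QuantisationCoefficients.

Section IntegralSum.
Variables (k : fieldType) (V : lmodType k).

Lemma sintegral_sum X (I : Type) (s : seq I) (mu : {linear (X -> k^o) -> k^o})
    (F : I -> X -> ser V) : (forall i, pro_rank (F i)) ->
  pro_rank (fun t => \sum_(i <- s) F i t) /\
  sintegral mu (fun t => \sum_(i <- s) F i t) = \sum_(i <- s) sintegral mu (F i).
Proof.
move=> rk; elim: s => [|i s [IH1 IH2]].
  have e0 j : expands [::] (fun t : X => (\sum_(i <- [::]) F i t : ser V) j).
    by move=> t; rewrite !big_nil.
  split=> [j|]; first by exists [::]; apply: e0.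
  by apply/funext => j; rewrite big_nil /sintegral (integralE _ (e0 j)) /pairing big_nil.
have E : (fun t => \sum_(j <- i :: s) F j t) = (fun t => F i t + \sum_(j <- s) F j t).
  by apply/funext => t; rewrite big_cons.
by have [D1 D2] := sintegralD mu (rk i) IH1; rewrite E D2 IH2 big_cons.
Qed.

End IntegralSum.

Section EvaluationMap.
Variables (k : fieldType) (G : algGroup k).

Definition evfun (f : coord G) : G -> k^o := fun g => ev g f.
Lemma evfun_linear : linear evfun.
Proof. by move=> c f g; apply/funext => u; rewrite /evfun evD evZ. Qed.
HB.instance Definition _ :=
  GRing.isLinear.Build k (coord G) (G -> k^o) *:%R evfun evfun_linear.

End EvaluationMap.

Section ActionIntegral.
Variables (k : fieldType) (A : comAlgType k) (br : poisson A) (Q : defquant br).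
Variables (G : algGroup k) (Ad : G -> Ahbar Q -> Ahbar Q).
Hypothesis AdP : is_action (@hadic _ _ _ Q) Ad.
Implicit Types (b : Ahbar Q) (g : G).

Lemma act_scal g c : Ad g (scal _ c) = scal _ c.
Proof. exact: (act_inalg AdP). Qed.

(** An algebra automorphism over the power series preserves divisibility by powers of
    [hbar]. *)
Lemma act_causal g : causal_linear (Ad g).
Proof.
split=> [a b|c a|n a an].
- exact: (act_add AdP).
- by rewrite -!(@scalE _ _ _ Q) (act_mul AdP) act_scal.
- have aE := @hadic_divisible _ _ _ Q a n.+1 an; rewrite aE (act_mul AdP).
  have -> : Ad g (inalg hbar ^+ n.+1) = inalg hbar ^+ n.+1.
    elim: n.+1 => [|m IH]; last by rewrite !exprS (act_mul AdP) (act_inalg AdP) IH.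
    by rewrite expr0 -(inalg1 (s := Ahbar Q)) (act_inalg AdP).
  move: (Ad g _) => c; elim: n {an aE} c => [|n IH] c.
    by rewrite expr1 hbar_mul.
  by rewrite exprS -mulrA hbar_mul /=; apply: IH.
Qed.

Definition orbit_coef b i (s : seq (coord G * A)) : Prop :=
  forall g, Ad g b i = \sum_(p <- s) ev g p.1 *: p.2.

Lemma orbit_mapE b n s : orbit_map (@hadic _ _ _ Q) Ad b n s ->
  forall i, (i < n)%N -> orbit_coef b i [seq (p.1, p.2 i) | p <- s].
Proof.
move=> sP i i_n g; have := sP g i i_n.
rewrite -[X in X = _]/(Ad g b i - (\sum_(p <- s) _) i) => /eqP.
rewrite subr_eq0 => /eqP ->; rewrite ahbar_sumE big_map.
by apply: eq_bigr => p _; rewrite -/(scal _ _) scalE.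
Qed.

Lemma orbit_coef_exists b i : exists s, orbit_coef b i s.
Proof.
have [s /orbit_mapE sP] := act_alg AdP b i.+1.
by eexists; apply: sP; apply: ltnSn.
Qed.

Lemma orbit_expands X (e : X -> G) b i s : orbit_coef b i s ->
  expands [seq (frestr e (evfun p.1), p.2) | p <- s] (fun t => Ad (e t) b i).
Proof. by move=> sP t; rewrite sP big_map. Qed.

Lemma orbit_pro_rank X (e : X -> G) b : pro_rank (fun t => Ad (e t) b).
Proof.
by move=> i; have [s /(orbit_expands e) sP] := orbit_coef_exists b i; eexists; apply: sP.
Qed.

(** The convolution action on [b] of a functional on the functions on the group, given by
    [mu] on the restrictions to [e]. *)
Definition average X (e : X -> G) (mu : {linear (X -> k^o) -> k^o}) b : Ahbar Q :=
  sintegral mu (fun t => Ad (e t) b).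

Lemma averageE X (e : X -> G) mu b i s : orbit_coef b i s ->
  average e mu b i = \sum_(p <- s) mu (frestr e (evfun p.1)) *: p.2.
Proof.
by move=> /(orbit_expands e)/integralE eE; rewrite /average /sintegral eE /pairing big_map.
Qed.

Lemma averageD X (e : X -> G) mu a b : average e mu (a + b) = average e mu a + average e mu b.
Proof.
have [_ <-] := sintegralD mu (orbit_pro_rank e a) (orbit_pro_rank e b).
by congr sintegral; apply/funext => t; rewrite (act_add AdP).
Qed.

Lemma act_average X (e : X -> G) mu g b :
  Ad g (average e mu b) = average (fun t => (g * e t)%g) mu b.
Proof.
have [_ <-] := sintegral_linear mu (act_causal g) (orbit_pro_rank e b).
by congr sintegral; apply/funext => t /=; rewrite (actM AdP).
Qed.

(** A linear functional on the coordinate algebra that kills the functions invariant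
    under finitely many right translations is a combination of differences of
    translates. So it maps [b] into any average-stable subgroup that contains the
    differences of [b] with its translates by these finitely many elements. *)
Lemma finite_invariance X (e : X -> G) (I : finType) (h : I -> G)
    (omega : {linear coord G -> k^o}) (J : set (Ahbar Q)) b :
  J 0 -> (forall a c, J a -> J c -> J (a + c)) ->
  (forall mu a, J a -> J (average e mu a)) ->
  (forall j, J (Ad (h j) b - b)) ->
  (forall F, (forall x j, ev (e x * h j)%g F = ev (e x) F) -> omega F = 0) ->
  exists c, J c /\ forall i s, orbit_coef b i s -> c i = \sum_(p <- s) omega p.1 *: p.2.
Proof.
move=> J0 JD Jav Jb omegaP.
(* The functional factors through the differences of translates, restricted to [e]. *)
pose T (F : coord G) : I * X -> k^o := fun y => ev (e y.2 * h y.1)%g F - ev (e y.2) F.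
have TE F y : T F y = ev (e y.2 * h y.1)%g F - ev (e y.2) F by [].
have Tlin : linear T.
  move=> a F F'; apply/funext => y; rewrite -[RHS]/(a * T F y + T F' y) !TE !evD !evZ; ring.
pose TL := GRing.isLinear.Build k (coord G) (I * X -> k^o) *:%R T Tlin.
pose TM : {linear coord G -> (I * X -> k^o)} := HB.pack T TL.
have [mu muE] : exists mu : {linear (I * X -> k^o) -> k^o}, forall F, omega F = mu (TM F).
  apply: linear_form_factor => F TF; apply: omegaP => x j.
  apply/eqP; rewrite -subr_eq0; apply/eqP.
  by rewrite -[LHS]/(TM F (j, x)) TF.
pose Psi j x := Ad (e x) (Ad (h j) b - b).
have rk j : pro_rank (Psi j) by apply: orbit_pro_rank.
exists (sintegral mu (fun y => Psi y.1 y.2)); split.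
  rewrite sintegral_slices //; elim/big_ind: _ => // j _.
  exact: (Jav (mu \o @fslice k X I j)).
move=> i s sP.
have ex : expands [seq (T p.1, p.2) | p <- s] (fun y => Psi y.1 y.2 i).
  move=> y; rewrite big_map /Psi (actB AdP) -(actM AdP).
  rewrite -[LHS]/(Ad (e y.2 * h y.1)%g b i - Ad (e y.2) b i) !sP -sumrB.
  by apply: eq_bigr => p _; rewrite -scalerBl.
rewrite /sintegral (integralE _ ex) /pairing big_map.
by apply: eq_bigr => p _; rewrite muE.
Qed.

Variables (der : lie G -> Ahbar Q -> Ahbar Q) (Phi : lie G -> Ahbar Q).
Hypothesis derP : is_induced_derivation (@hadic _ _ _ Q) Ad der.
Hypothesis PhiP : is_comoment Ad der Phi.

(** The definition of [der] gives this for the expansions that come from the quantisation.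
    Extending [x] to a linear form on all functions makes the right-hand side an average,
    which does not depend on the expansion. *)
Lemma der_coef x b i s : orbit_coef b i s -> der x b i = \sum_(p <- s) x p.1 *: p.2.
Proof.
move=> sP; have [s' s'P] := act_alg AdP b i.+1.
have xlin : linear (x : coord G -> k^o) by move=> c f g; rewrite lieD lieZ.
pose xL := GRing.isLinear.Build k (coord G) k^o *:%R (x : coord G -> k^o) xlin.
pose xM : {linear coord G -> k^o} := HB.pack (x : coord G -> k^o) xL.
have [mu muE] : exists mu : {linear (G -> k^o) -> k^o}, forall f, xM f = mu (evfun f).
  apply: linear_form_factor => f f0; rewrite (_ : f = 0) ?linear0 //.
  by apply: ev_ext => g; rewrite ev0 -[LHS]/(evfun f g) f0.
have E s1 : orbit_coef b i s1 ->
    average (fun g => g) mu b i = \sum_(p <- s1) x p.1 *: p.2.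
  move=> s1P; rewrite (averageE _ _ s1P); apply: eq_bigr => p _.
  by rewrite -[frestr _ _]/(evfun p.1) -muE.
have s'i := orbit_mapE s'P (ltnSn i).
rewrite -(E _ sP) (E _ s'i) big_map.
have := der_orbit derP x s'P i (ltnSn i).
rewrite -[X in X = _]/(der x b i - (\sum_(p <- s') _) i) => /eqP.
rewrite subr_eq0 => /eqP ->; rewrite ahbar_sumE.
by apply: eq_bigr => p _; rewrite -/(scal _ _) scalE.
Qed.

Lemma comoment0 : Phi 0 = 0.
Proof.
have := com_lin PhiP 1 0 0; rewrite -/(scal _ _) scal1 mul1r scale1r addr0 => /esym/eqP.
by rewrite -subr_eq0 addrK => /eqP.
Qed.

Lemma comoment_sum (I : Type) (s : seq I) (c : I -> k) (x : I -> lie G) :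
  Phi (\sum_(i <- s) c i *: x i) = \sum_(i <- s) scal _ (c i) * Phi (x i).
Proof.
elim: s => [|i s IH]; first by rewrite !big_nil comoment0.
by rewrite !big_cons (com_lin PhiP) IH.
Qed.

(** By equivariance the orbit map of [Phi y] is the image under [Phi] of the adjoint orbit
    of [y], whose differential is the bracket. *)
Lemma der_comoment x y : der x (Phi y) = Phi (bracket x y).
Proof.
have /choice[m mP] := lieAd_regular y.
have [s sE] := lie_findim G.
have orb n : orbit_map (@hadic _ _ _ Q) Ad (Phi y) n [seq (m p.1, Phi p.2) | p <- s].
  move=> g; rewrite -(com_equiv PhiP) (sE (lieAd g y)) comoment_sum big_map.
  have -> : \sum_(p <- s) scal (Ahbar Q) (lieAd g y p.1) * Phi p.2 =
     \sum_(p <- s) inalg (sconst (ev g (m p.1))) * Phi p.2.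
    by apply: eq_bigr => p _; have [-> _] := mP p.1.
  by rewrite subrr.
apply/eqP; rewrite -subr_eq0; apply/eqP/hadic_separated => n.
have := der_orbit derP x (orb n); rewrite big_map (sE (bracket x y)) comoment_sum.
congr (hadic n (_ - _)); apply: eq_bigr => p _.
by have [_ ->] := mP p.1.
Qed.

Lemma comoment_bracket x y :
  Phi x * Phi y - Phi y * Phi x = inalg hbar * Phi (bracket x y).
Proof. by rewrite (com_der PhiP) der_comoment. Qed.

Variable gamma : {linear lie G -> k^o}.
Hypothesis gamma_inv : forall g x, gamma (lieAd g x) = gamma x.

(** The bracket is a combination of translates with coefficients of sum zero, and [gamma]
    takes the same value on all translates. *)
Lemma gamma_bracket x y : gamma (bracket x y) = 0.
Proof.
have [q [-> q0]] := bracket_span x y; rewrite linear_sum.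
under eq_bigr => p _ do rewrite linearZ /= gamma_inv.
by rewrite -scaler_suml q0 scale0r.
Qed.

Lemma shifted_sum (I : Type) (s : seq I) (c : I -> k) (x : I -> lie G) :
  shifted Phi gamma (\sum_(i <- s) c i *: x i) =
  \sum_(i <- s) scal _ (c i) * shifted Phi gamma (x i).
Proof.
rewrite /shifted comoment_sum.
under [RHS]eq_bigr do rewrite mulrBr.
rewrite sumrB; congr (_ - _); rewrite linear_sum /=.
elim: s => [|i s IH].
  by rewrite !big_nil sconst0 mul0r inalg0.
rewrite !big_cons !inalgM -/(scal _ _) scalD mulrDl -IH inalgM linearZ /=; congr (_ + _).
rewrite mulrA; congr (_ * _); rewrite /scal -inalgM; congr inalg.
by rewrite fpsM conv_const_l; [apply/funext; case=> // n; rewrite mulr0 | exact: mul0r].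
Qed.

(** Multiplication by a generator commutes with averages up to moving the group
    element across the generator, which turns it into a combination, with
    coefficients depending on the group element, of fixed generators. *)
Lemma average_mul_shifted X (e : X -> G) mu u x : exists q : seq (X * (X -> k^o)),
  average e mu (u * shifted Phi gamma x) =
  \sum_(p <- q) average e (mu \o fmul p.2) u * shifted Phi gamma (lieAd (e p.1) x).
Proof.
have [s sE] := lie_findim G.
pose s' := [seq ((fun t => lieAd (e t) x p.1) : X -> k^o, p.2) | p <- s].
have ex : expands s' (fun t => lieAd (e t) x).
  by move=> t; rewrite big_map; apply: sE.
have [q qP] := sampling [:: s'].
have [|adE _] := qP _ _ _ ex; first by rewrite inE.
exists q; pose r (p : X * (X -> k^o)) (a : Ahbar Q) : Ahbar Q :=
  a * shifted Phi gamma (lieAd (e p.1) x).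
have rk (p : X * (X -> k^o)) := sintegral_linear mu (causal_mulr (shifted Phi gamma (lieAd (e p.1) x)))
  (orbit_pro_rank e u).
pose F (p : X * (X -> k^o)) (t : X) : Ahbar Q := cscale (p.2 t) (r p (Ad (e t) u)).
have AdE : (fun t => Ad (e t) (u * shifted Phi gamma x)) = fun t => \sum_(p <- q) F p t.
  apply/funext => t; rewrite (act_mul AdP) (act_shifted AdP PhiP gamma_inv).
  rewrite adE shifted_sum mulr_sumr; apply: eq_bigr => p _.
  by rewrite mulrA -scalC -mulrA scalE.
have rkF p : pro_rank (F p) by have [] := sintegral_mul p.2 mu (rk p).1.
rewrite /average AdE; have [_ ->] := sintegral_sum q mu rkF.
apply: eq_bigr => p _; have [_ ->] := sintegral_mul p.2 mu (rk p).1.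
by have [_ E] := sintegral_linear (mu \o fmul p.2)
  (causal_mulr (shifted Phi gamma (lieAd (e p.1) x))) (orbit_pro_rank e u).
Qed.

(** The ideal is the image of an equivariant map to which averages lift. *)
Lemma average_lideal (P : set (lie G)) X (e : X -> G) mu b :
  (forall g x, P x -> P (lieAd g x)) ->
  lideal (shifted Phi gamma @` P)%classic b ->
  lideal (shifted Phi gamma @` P)%classic (average e mu b).
Proof.
move=> PAd; move: b; apply: lideal_ind => [|a b Ja Jb|u _ [x Px <-]].
- rewrite (_ : average e mu 0 = 0); first exact: lideal0.
  by apply: (addrI (average e mu 0)); rewrite -averageD !addr0.
- by rewrite averageD; apply: lidealD.
have [q ->] := average_mul_shifted e mu u x.
apply: lideal_sum => p; apply/lidealMl/lideal_gen.
by exists (lieAd (e p.1) x) => //; apply: PAd.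
Qed.

End ActionIntegral.

(** * Subquotient algebras *)

Section Subquotients.
Variables (k : fieldType) (B : algOverType (ser k)) (S N : set B).
Variable w : subquo_alg S N.
Implicit Types (X Y : subquo w) (a b : B).

Lemma sqND a b : N a -> N b -> N (a + b).
Proof.
move=> Na Nb; rewrite -[b]opprK; apply: (sqNB w) => //.
by rewrite -sub0r; apply: (sqNB w) => //; apply: sqN0 w.
Qed.

Lemma sqSD a b : S a -> S b -> S (a + b).
Proof.
move=> Sa Sb; rewrite -[b]opprK; apply: (sqSB w) => //.
by rewrite -sub0r; apply: (sqSB w) => //; apply/(sqNS w)/(sqN0 w).
Qed.

Lemma coset_self a : coset N a a.
Proof. by rewrite /coset /= subrr; apply: sqN0 w. Qed.

Lemma subquo_of a : S a -> exists X, reps X a.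
Proof.
move=> Sa; have P : `[< exists2 b, S b & coset N a = coset N b >].
  by apply/asboolP; exists a.
by exists (@Subquo (ser k) B S N w (coset N a) P); apply: coset_self.
Qed.

Lemma reps_ex X : exists a, S a /\ reps X a.
Proof.
case: X => X /= /asboolP XP; have [a Sa ->] := XP.
by exists a; split=> //; apply: coset_self.
Qed.

Lemma repsE X a : reps X a -> reps X = coset N a.
Proof.
case: X => X /= /asboolP XP; have [b Sb ->] := XP => Nab.
apply/seteqP; split=> c Nc; rewrite /coset /=.
  by have := sqNB w Nc Nab; rewrite opprB addrA subrK.
by have := sqND Nc Nab; rewrite addrA subrK.
Qed.

Lemma reps_S X a : reps X a -> S a.
Proof.
move=> Xa; have [b [Sb Xb]] := reps_ex X.
rewrite -(subrK b a); apply: sqSD => //; apply: (sqNS w).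
by move: Xa; rewrite (repsE Xb).
Qed.

Lemma reps_eqmod X a b : reps X a -> reps X b -> N (a - b).
Proof. by move=> Xa /repsE XE; move: Xa; rewrite XE. Qed.

Lemma reps_mod X a b : reps X a -> N (b - a) -> reps X b.
Proof. by move=> /repsE->. Qed.

Lemma reps_inj X Y a : reps X a -> reps Y a -> X = Y.
Proof. by move=> Xa Ya; apply: val_inj; rewrite /= (repsE Xa) (repsE Ya). Qed.

Lemma reps0 : reps (0 : subquo w) 0.
Proof. by have := subquo_inalg w 0; rewrite !inalg0. Qed.
Lemma reps1 : reps (1 : subquo w) 1.
Proof. by have := subquo_inalg w 1; rewrite !inalg1. Qed.
Lemma repsN X a : reps X a -> reps (- X) (- a).
Proof.
by move=> Xa; have := subquoM (subquo_inalg w (- 1)) Xa; rewrite !inalgN !inalg1 !mulN1r.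
Qed.
Lemma repsB X Y a b : reps X a -> reps Y b -> reps (X - Y) (a - b).
Proof. by move=> Xa Yb; apply: subquoD => //; apply: repsN. Qed.
Lemma repsM_inalg c X a : reps X a -> reps (inalg c * X) (inalg c * a).
Proof. by move=> Xa; apply: subquoM => //; apply: subquo_inalg. Qed.
Lemma reps_sum (I : Type) (s : seq I) (F : I -> subquo w) (f : I -> B) :
  (forall i, reps (F i) (f i)) -> reps (\sum_(i <- s) F i) (\sum_(i <- s) f i).
Proof.
move=> Ff; elim: s => [|i s IH]; first by rewrite !big_nil; apply: reps0.
by rewrite !big_cons; apply: subquoD.
Qed.
Lemma reps0E a : reps (0 : subquo w) a <-> N a.
Proof. by rewrite (repsE reps0) /coset /= subr0. Qed.

(** An additive map that preserves both [S] and [N] descends to classes; the index [I] allows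
    for families. *)
Lemma subquo_lift (I : Type) (F : I -> B -> B) :
  (forall i a b, F i (a - b) = F i a - F i b) ->
  (forall i a, S a -> S (F i a)) -> (forall i a, N a -> N (F i a)) ->
  exists Fq : I -> subquo w -> subquo w, forall i X a, reps X a -> reps (Fq i X) (F i a).
Proof.
move=> FB FS FN.
have /choice[f fP] (iX : I * subquo w) : exists Y : subquo w,
    forall a, reps iX.2 a -> reps Y (F iX.1 a).
  case: iX => i X; have [a [Sa Xa]] := reps_ex X.
  have [Y Ya] := subquo_of (FS i a Sa); exists Y => b Xb /=.
  by apply: (reps_mod Ya); rewrite -FB; apply/FN/(reps_eqmod Xb Xa).
by exists (fun i X => f (i, X)) => i X a /(fP (i, X)).
Qed.

End Subquotients.

(** * Restriction to subgroups and semidirect products *)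

Section RestrictedAction.
Variables (k : fieldType) (L G : algGroup k) (phi : agHom L G).
Variables (B : algOverType (ser k)) (fil : nat -> set B).
Variables (Ad : G -> B -> B) (der : lie G -> B -> B) (Phi : lie G -> B).

Lemma restrict_orbit_map b n s : orbit_map fil Ad b n s ->
  orbit_map fil (fun h => Ad (phi h)) b n [seq (pullback phi p.1, p.2) | p <- s].
Proof.
move=> sP h; rewrite big_map; have := sP (phi h); congr (fil n (_ - _)).
by apply: eq_bigr => p _; rewrite pullbackE.
Qed.

Lemma restrict_action : is_action fil Ad -> is_action fil (fun h => Ad (phi h)).
Proof.
move=> AdP; split.
- by move=> b; rewrite hom1 (act1 AdP).
- by move=> g h b; rewrite homM (actM AdP).
- by move=> g; apply: act_add AdP _.
- by move=> g; apply: act_mul AdP _.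
- by move=> g; apply: act_inalg AdP _.
- move=> b n; have [s /restrict_orbit_map sP] := act_alg AdP b n.
  by eexists; apply: sP.
Qed.

Lemma restrict_comoment : is_comoment Ad der Phi ->
  is_comoment (fun h => Ad (phi h)) (fun x => der (diff phi x)) (fun x => Phi (diff phi x)).
Proof.
move=> PhiP; split.
- by move=> c x y; rewrite diff_lin (com_lin PhiP).
- by move=> g x; rewrite diff_lieAd (com_equiv PhiP).
- by move=> x b; rewrite (com_der PhiP).
Qed.

End RestrictedAction.

Section SemidirectLie.
Variables (k : fieldType) (G H K : algGroup k) (iH : agHom H G) (iK : agHom K G).
Hypothesis semi : semidirect iH iK.

Lemma closed_embedding_inj u v : iH u = iH v -> u = v.
Proof.
move=> uv; apply: ev_inj => f; have [iHc _ _ _] := semi.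
by have [f' f'E] := iHc f; rewrite -!f'E uv.
Qed.

Definition sublie : set (lie G) := [set diff iH x | x in setT]%classic.

Lemma sublieB x y : sublie x -> sublie y -> sublie (x - y).
Proof.
move=> [x' _ <-] [y' _ <-]; exists (- 1 *: y' + x') => //.
by rewrite diff_lin scaleN1r addrC.
Qed.

Lemma sublieN x : sublie x -> sublie (- x).
Proof.
move=> Sx; rewrite -[- x]add0r; apply: sublieB => //.
by have := sublieB Sx Sx; rewrite subrr.
Qed.

Lemma sublie_sum (I : Type) (s : seq I) (c : I -> k) (x : I -> lie G) :
  (forall i, sublie (x i)) -> sublie (\sum_(i <- s) c i *: x i).
Proof.
move=> Sx; elim: s => [|i s [y _ yE]].
  by rewrite big_nil; exists 0 => //; apply: lie_eq => f.
have [z _ zE] := Sx i; rewrite big_cons -yE -zE -diff_lin.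
by exists (c i *: z + y).
Qed.

(** The Lie algebra of a closed normal subgroup is stable under the adjoint
    representation: restrict conjugation to the subgroup and differentiate. *)
Lemma sublie_Ad g x : sublie x -> sublie (lieAd g x).
Proof.
move=> [{}x _ <-]; have [iHc _ normH _] := semi.
have /choice[psi psiE] := normH g.
have psi_reg : regular_map psi.
  move=> f; have [f' f'E] := iHc f; have [F FE] := conj_reg g f'.
  exists (pullback iH F) => u; rewrite pullbackE FE -f'E -psiE //.
have psi1 : psi 1%g = 1%g.
  by apply: closed_embedding_inj; rewrite -psiE !hom1 mulg1 mulgV.
have [x' x'E] := tangent_map x psi_reg psi1.
exists x' => //; apply: lie_eq => f.
have [F FE] := conj_reg g f.
rewrite (lieAdE _ FE) -[LHS]/(x' (pullback iH f)).
apply: x'E => u; rewrite !pullbackE FE -psiE //.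
Qed.

Lemma sublie_bracketl x y : sublie x -> sublie (bracket y x).
Proof.
move=> Sx; have [q [-> _]] := bracket_span y x.
by apply: sublie_sum => p; apply: sublie_Ad.
Qed.

Lemma sublie_bracketr x y : sublie x -> sublie (bracket x y).
Proof.
move=> Sx; have -> : bracket x y = - bracket y x.
  by apply: lie_eq => f; rewrite -[RHS]/(- (bracket y x f)) !bracketE opprB.
by apply/sublieN/sublie_bracketl.
Qed.

(** The map sending [u] to [h u h^-1 u^-1] goes from [K] to [H], and its differential is
    the difference in the statement. *)
Lemma lieAd_complement h y : sublie (lieAd (iH h) (diff iK y) - diff iK y).
Proof.
have [iHc iKc normH [pH [pK [pHr pKr HK pHE _]]]] := semi.
have normK u : exists v, (iK u * iH h^-1 * (iK u)^-1)%g = iH v by apply: normH.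
have /choice[c cE] := normK.
pose psi u := (h * c u)%g.
have psiE u : (iH (psi u) * iK u)%g = (iH h * iK u * (iH h)^-1)%g.
  by rewrite /psi homM -cE homV !mulgA mulgVK.
have psi_reg : regular_map psi.
  move=> f; have [f1 f1E] := pHr f; have [f2 f2E] := conj_reg (iH h) f1.
  exists (pullback iK f2) => u; rewrite pullbackE f2E f1E /conj -psiE pHE //.
have psi1 : psi 1%g = 1%g.
  apply: closed_embedding_inj; have := psiE 1%g.
  by rewrite !hom1 !mulg1 mulgV.
have [x xE] := tangent_map y psi_reg psi1.
exists x => //; apply: lie_eq => f.
have [F FE] := conj_reg (iH h) f.
rewrite -[RHS]/(lieAd (iH h) (diff iK y) f - diff iK y f).
have FE' u : ev u (pullback iK F) = ev (iH (psi u) * iK u)%g f.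
  by rewrite pullbackE FE /conj -psiE.
have [f1 f1E] := psi_reg (pullback iH f).
rewrite (lieAdE _ FE) -[LHS]/(x (pullback iH f)) (xE _ _ f1E).
rewrite -[diff iK y F]/(y (pullback iK F)) -[diff iK y f]/(y (pullback iK f)).
rewrite (@tangent_product _ K G (fun u => iH (psi u)) iK y f f1 (pullback iK f) _ _ _ _ _ _ _ FE').
- by rewrite addrK.
- move=> f'; have [f'' f''E] := psi_reg (pullback iH f').
  by exists f'' => u; rewrite f''E pullbackE.
- exact: hom_reg.
- by rewrite psi1 hom1.
- exact: hom1.
- by move=> u; rewrite f1E pullbackE.
- by move=> u; rewrite pullbackE.
Qed.

End SemidirectLie.

(** * Reduction in stages *)

Section DerivativeInStableSubgroup.
Variables (R : realType) (A : comAlgType R[i]) (br : poisson A) (Q : defquant br).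
Variables (G : algGroup R[i]) (Ad : G -> Ahbar Q -> Ahbar Q).
Variable der : lie G -> Ahbar Q -> Ahbar Q.
Hypothesis AdP : is_action (@hadic _ _ _ Q) Ad.
Hypothesis derP : is_induced_derivation (@hadic _ _ _ Q) Ad der.

(** A regular function invariant under the exponentials at the two periods is killed by
    [x], so [finite_invariance] applies with these two elements. *)
Lemma der_in_stable (x : lie G) (c : R -> G) (J : set (Ahbar Q)) b : exp_curve x c ->
  J 0 -> (forall a a', J a -> J a' -> J (a + a')) ->
  (forall mu a, J a -> J (average Ad c mu a)) ->
  (forall t, J (Ad (c t) b - b)) -> J (der x b).
Proof.
move=> xc J0 JD Jav Jb.
have xlin : linear (x : coord G -> R[i]^o) by move=> a f g; rewrite lieD lieZ.
pose xL := GRing.isLinear.Build R[i] (coord G) R[i]^o *:%R (x : coord G -> R[i]^o) xlin.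
pose xM : {linear coord G -> R[i]^o} := HB.pack (x : coord G -> R[i]^o) xL.
have [||d [Jd dE]] := @finite_invariance _ _ _ _ _ _ AdP _ c bool
  (fun j => c (if j then 1 else golden R)) xM J b J0 JD Jav.
- by move=> j; apply: Jb.
- move=> F Finv; apply: (exp_curve_periods xc) => t.
    by rewrite (exp_curveD _ _ xc) (Finv t true).
  by rewrite (exp_curveD _ _ xc) (Finv t false).
suff -> : der x b = d by [].
apply/funext => i; have [s sP] := orbit_coef_exists AdP b i.
by rewrite (der_coef AdP derP x sP) (dE i s sP).
Qed.

End DerivativeInStableSubgroup.

Section ReductionInStages.
Variables (R : realType) (A : comAlgType R[i]) (br : poisson A) (Q : defquant br).
Variables (G H K : algGroup R[i]) (iH : agHom H G) (iK : agHom K G).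
Hypothesis semi : semidirect iH iK.
Variables (Ad : G -> Ahbar Q -> Ahbar Q) (der : lie G -> Ahbar Q -> Ahbar Q).
Variable Phi : lie G -> Ahbar Q.
Hypothesis AdP : is_action (@hadic _ _ _ Q) Ad.
Hypothesis derP : is_induced_derivation (@hadic _ _ _ Q) Ad der.
Hypothesis PhiP : is_comoment Ad der Phi.
Variable gamma : {linear lie G -> R[i]^o}.
Hypothesis gamma_inv : forall g x, gamma (lieAd g x) = gamma x.

Local Notation B := (Ahbar Q).

Lemma red_ideal_pull (L : algGroup R[i]) (phi : agHom L G) (eta : lie L -> R[i]) :
  (forall x, gamma (diff phi x) = eta x) ->
  red_ideal (fun x => Phi (diff phi x)) eta =
  lideal (shifted Phi gamma @` [set diff phi x | x in setT])%classic.
Proof.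
move=> etaE; rewrite red_idealE.
- congr lideal; apply/seteqP; split=> b.
    move=> [x _ <-]; exists (diff phi x); first by exists x.
    by rewrite /shifted etaE.
  move=> [_ [x _ <-] <-]; exists x => //.
  by rewrite /shifted etaE.
- by move=> c x y; rewrite diff_lin (com_lin PhiP).
- by move=> x y; rewrite (comoment_bracket derP PhiP) diff_bracket.
- by move=> x y; rewrite -etaE diff_bracket (gamma_bracket gamma_inv).
Qed.

Lemma red_idealG : red_ideal Phi gamma = lideal (shifted Phi gamma @` setT)%classic.
Proof.
apply: red_idealE; [exact: com_lin PhiP|exact: comoment_bracket derP PhiP|].
exact: gamma_bracket gamma_inv.
Qed.

Lemma reducible_whole : reducible Ad Phi gamma.
Proof.
apply: (reducible_criterion (com_lin PhiP) (comoment_bracket derP PhiP)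
  (gamma_bracket gamma_inv) AdP PhiP gamma_inv) => x s Ss.
have [c xc] := exp_curve_exists x.
apply: (der_in_stable AdP derP xc) => [|a b|mu a|t].
- exact: lideal0.
- exact: lidealD.
- rewrite red_idealG; exact: (average_lideal AdP PhiP gamma_inv).
- exact: Ss.
Qed.

Variables (eta : {linear lie H -> R[i]^o}) (kappa : {linear lie K -> R[i]^o}).
Hypothesis gamma_eta : forall x, gamma (diff iH x) = eta x.
Hypothesis gamma_kappa : forall y, gamma (diff iK y) = kappa y.

Local Notation AdH := (fun h => Ad (iH h)).
Local Notation PhiH := (fun x => Phi (diff iH x)).
Local Notation JH := (red_ideal PhiH eta).
Local Notation SH := (red_inv AdH PhiH eta).

Lemma JHE : JH = lideal (shifted Phi gamma @` (sublie iH))%classic.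
Proof. exact: red_ideal_pull. Qed.

Lemma JH_average X (e : X -> G) mu a : JH a -> JH (average Ad e mu a).
Proof.
rewrite JHE; apply: (average_lideal AdP PhiP gamma_inv) => g x.
exact: sublie_Ad semi _ _.
Qed.

Lemma JH_Ad g a : JH a -> JH (Ad g a).
Proof.
rewrite JHE; apply: (act_lideal AdP PhiP gamma_inv) => x Sx.
exact: (sublie_Ad semi).
Qed.

Lemma JH_JG a : JH a -> red_ideal Phi gamma a.
Proof.
rewrite JHE red_idealG; apply: lideal_ind => [|b c|u _ [x _ <-]].
- exact: lideal0.
- exact: lidealD.
- by apply/lidealMl/lideal_gen; exists x.
Qed.

Lemma reducibleH : reducible AdH PhiH eta.
Proof.
have AdHP := restrict_action iH AdP.
have PhiHP := restrict_comoment iH PhiP.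
apply: (reducible_criterion _ _ _ AdHP PhiHP) => [||x y|h x|x s Ss].
- exact: com_lin PhiHP.
- by move=> x y; rewrite (comoment_bracket derP PhiP) diff_bracket.
- by rewrite -gamma_eta diff_bracket (gamma_bracket gamma_inv).
- by rewrite -!gamma_eta diff_lieAd gamma_inv.
have [c xc] := exp_curve_exists x.
apply: (der_in_stable AdP derP (exp_curve_diff iH xc)) => [|a b|mu a|t].
- exact: lideal0.
- exact: lidealD.
- exact: JH_average.
- exact: Ss.
Qed.

Lemma SH_Ad k a : SH a -> SH (Ad (iK k) a).
Proof.
move=> Sa h; have [_ _ normH _] := semi.
have [h' h'E] := normH (iK k)^-1%g h.
have -> : Ad (iH h) (Ad (iK k) a) = Ad (iK k) (Ad (iH h') a).
  by rewrite -!(actM AdP) -h'E invgK !mulgA mulgV mul1g.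
by rewrite -(actB AdP); apply/JH_Ad/Sa.
Qed.

Lemma lder_eq0_span (x : lie H) (s : seq (coord H * lie H)) F :
  x = \sum_(p <- s) (x p.1 : R[i]) *: p.2 ->
  (forall p, p \in s -> lder (diff iH p.2) F = 0) -> lder (diff iH x) F = 0.
Proof.
move=> -> sF; apply: ev_ext => u; rewrite lderE ev0 /= lie_sumE big_seq big1 // => p ps.
by have := congr1 (ev u) (sF p ps); rewrite lderE ev0 /= => ->; rewrite mulr0.
Qed.

(** Averages of [H]-invariant classes along one-parameter subgroups of [K] are
    [H]-invariant: the functions on the group that are invariant under [h] and
    under the exponentials of a basis of the Lie algebra of [H] do not distinguish
    [h c(t)] from [c(t)]. *)
Lemma SH_average (y : lie K) (c : R -> K) mu a : exp_curve y c ->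
  SH a -> SH (average Ad (fun t => iK (c t)) mu a).
Proof.
move=> yc Sa h; rewrite (act_average AdP).
have /choice[curve curveP] := @exp_curve_exists R H.
have [s sE] := lie_findim H.
(* The group elements: [h] itself and, for each basis vector, its exponentials at the two
   periods. *)
pose hh (o : option ('I_(size s) * bool)) : H := if o is Some (i, j) then
  curve (nth (0, 0) s i).2 (if j then 1 else golden R) else h.
pose e t := iK (c t).
pose diffF (F : coord G) : R -> R[i]^o := fun t => ev (iH h * e t)%g F - ev (e t) F.
pose omega (F : coord G) : R[i]^o := mu (diffF F).
have omega_lin : linear omega.
  move=> z F F'; rewrite /omega -linearP; congr (mu _); apply/funext => t.
  rewrite -[RHS]/(z * diffF F t + diffF F' t) /diffF !evD !evZ; ring.
pose oL := GRing.isLinear.Build R[i] (coord G) R[i]^o *:%R omega omega_lin.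
pose oM : {linear coord G -> R[i]^o} := HB.pack omega oL.
have [|||||d [Jd dE]] := @finite_invariance _ _ _ _ _ _ AdP G id _ (fun o => iH (hh o))
  oM JH a.
- exact: lideal0.
- by move=> ? ?; apply: lidealD.
- by move=> ? ?; apply: JH_average.
- by move=> o; apply: Sa.
- move=> F Finv; have F0 : diffF F = 0; last first.
    by rewrite -[LHS]/(omega F) /omega F0 linear0.
  apply/funext => t; rewrite /diffF; apply/eqP; rewrite subr_eq0; apply/eqP.
  apply: (ideal_invariant (P := sublie iH) _ _ (exp_curve_diff iK yc)) => [x||x [x' _ <-]|g].
  + exact: sublie_bracketr semi _ _.
  + exact: lieAd_complement.
  + apply: (lder_eq0_span (sE x')) => p /(nthP (0, 0))[i i_s <-].
    by apply: (lder_eq0 (exp_curve_diff iH (curveP _))) => g;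
      [apply: (Finv g (Some (Ordinal i_s, true))) | apply: (Finv g (Some (Ordinal i_s, false)))].
  + exact: (Finv g None).
rewrite (_ : _ - _ = d) //; apply/funext => i.
have [s' s'P] := orbit_coef_exists AdP a i; rewrite (dE i s' s'P).
rewrite -[LHS]/(average Ad (fun t => (iH h * e t)%g) mu a i - average Ad e mu a i).
rewrite !(averageE _ _ s'P) -sumrB; apply: eq_bigr => p _.
by rewrite -scalerBl -linearB.
Qed.

(** The group [K] preserves the invariants, and so do averages along its one-parameter
    subgroups; hence derivatives stay among the invariants. *)
Lemma SH_der y a : SH a -> SH (der (diff iK y) a).
Proof.
move=> Sa; have [c yc] := exp_curve_exists y.
have w := reducibleH.
apply: (der_in_stable AdP derP (exp_curve_diff iK yc)) => [|b b'|mu b|t].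
- exact/(sqNS w)/(sqN0 w).
- exact: sqSD w _ _.
- exact: SH_average.
- by apply: (sqSB w) => //; apply: SH_Ad.
Qed.

Lemma JH_der y a : JH a -> JH (der (diff iK y) a).
Proof.
move=> Ja; have [c yc] := exp_curve_exists y.
apply: (der_in_stable AdP derP (exp_curve_diff iK yc)) => [|b b'|mu b|t].
- exact: lideal0.
- exact: lidealD.
- exact: JH_average.
- by apply: lidealB => //; apply: JH_Ad.
Qed.

(** Moving [y] by [h] changes it by an element of the Lie algebra of [H] on which [gamma]
    vanishes, and such an element lies in the ideal. *)
Lemma SH_Phi y : SH (Phi (diff iK y)).
Proof.
move=> h; rewrite -(com_equiv PhiP).
have PhiB x x' : Phi (x - x') = Phi x - Phi x'.
  have := com_lin PhiP 1 (x - x') x'.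
  by rewrite scale1r subrK -/(scal _ _) scal1 mul1r => ->; rewrite addrK.
rewrite -PhiB; have [x _ xE] := lieAd_complement semi h y.
rewrite -xE JHE.
have -> : Phi (diff iH x) = shifted Phi gamma (diff iH x).
  by rewrite /shifted xE linearB /= gamma_inv subrr sconst0 mul0r inalg0 subr0.
by apply: lideal_gen; exists (diff iH x) => //; exists x.
Qed.


Section SecondStage.
Variable w : reducible AdH PhiH eta.
Local Notation Red := (reduction w).
Local Notation filH := (subquo_fil (@hadic _ _ _ Q) (w := w)).

Variables (AdK : K -> Red -> Red) (derK : lie K -> Red -> Red) (PhiK : lie K -> Red).
Hypothesis AdKE : forall k X a, reps X a -> reps (AdK k X) (Ad (iK k) a).
Hypothesis derKE : forall y X a, reps X a -> reps (derK y X) (der (diff iK y) a).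
Hypothesis PhiKE : forall y, reps (PhiK y) (Phi (diff iK y)).

Lemma filH_add n X Y : filH n X -> filH n Y -> filH n (X + Y).
Proof.
move=> [a Xa an] [b Yb bn]; exists (a + b); first exact: subquoD.
by move=> i i_n; rewrite -[LHS]/(a i + b i) an ?bn ?addr0.
Qed.

Lemma filH_scal n c X : filH n X -> filH n (scal Red c * X).
Proof.
move=> [a Xa an]; exists (scal B c * a); first exact: repsM_inalg.
by move=> i i_n; rewrite scalE /cscale an ?scaler0.
Qed.

Lemma filH_sum n (I : Type) (s : seq I) (F : I -> Red) :
  (forall i, filH n (F i)) -> filH n (\sum_(i <- s) F i).
Proof.
move=> Fn; elim/big_ind: _ => //; last exact: filH_add.
by exists 0; [exact: reps0|].
Qed.

(** An expansion of the orbit of [b] whose vectors are translates of [b]. Such vectors stay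
    among the [H]-invariants, while those of an arbitrary expansion need not, so this is
    what shows that the action of [K] on the reduction is algebraic. The interpolation
    is stated for any list that contains the given functions, so that a second
    expansion can be compared on the same points. *)
Lemma orbit_interpolation b n : exists F : seq (coord K), forall r : seq (coord K * K),
  {in F, forall f, f = \sum_(p <- r) ev p.2 f *: p.1} ->
  (forall k, hadic n (Ad (iK k) b - \sum_(p <- r) scal B (ev k p.1) * Ad (iK p.2) b)) /\
  (forall y, hadic n (der (diff iK y) b - \sum_(p <- r) scal B (y p.1) * Ad (iK p.2) b)).
Proof.
have [s sP] := act_alg AdP b n.
exists [seq pullback iK p.1 | p <- s] => r rE.
have {}rE p : p \in s -> pullback iK p.1 = \sum_(q <- r) ev q.2 (pullback iK p.1) *: q.1.
  by move=> ps; apply: rE; apply: map_f.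
have sum_swap i (d : coord K -> R[i]) (dlin : forall p, p \in s -> d (pullback iK p.1) =
    \sum_(q <- r) ev q.2 (pullback iK p.1) * d q.1) : (i < n)%N ->
    \sum_(p <- s) d (pullback iK p.1) *: p.2 i =
    \sum_(q <- r) d q.1 *: Ad (iK q.2) b i.
  move=> i_n; have sPi := orbit_mapE sP i_n.
  under [RHS]eq_bigr do rewrite sPi big_map scaler_sumr.
  rewrite exchange_big /= big_seq [RHS]big_seq; apply: eq_bigr => p ps.
  rewrite dlin // scaler_suml; apply: eq_bigr => q _.
  by rewrite scalerA pullbackE mulrC.
have coefE (c : coord K -> R[i]) i : (\sum_(p <- r) scal B (c p.1) * Ad (iK p.2) b) i =
    \sum_(p <- r) c p.1 *: Ad (iK p.2) b i.
  by rewrite ahbar_sumE; apply: eq_bigr => p _; rewrite scalE.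
split=> [k|y] i i_n; apply/eqP.
  rewrite -[X in X == _]/(Ad (iK k) b i - (\sum_(p <- r) _) i) subr_eq0; apply/eqP.
  rewrite (coefE (fun f => ev k f)) -(sum_swap i (fun f => ev k f)) //.
    rewrite (orbit_mapE sP i_n) big_map; apply: eq_bigr => p _.
    by rewrite pullbackE.
  by move=> p ps; rewrite {1}rE // ev_sum; apply: eq_bigr => q _; rewrite evZ.
rewrite -[X in X == _]/(der (diff iK y) b i - (\sum_(p <- r) _) i) subr_eq0; apply/eqP.
rewrite (coefE (fun f => y f)) -(sum_swap i (fun f => y f)) //.
  by rewrite (der_coef AdP derP _ (orbit_mapE sP i_n)) big_map.
by move=> p ps; rewrite {1}rE // lie_sum; apply: eq_bigr => q _; rewrite lieZ.
Qed.

Lemma AdK_action : is_action filH AdK.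
Proof.
split.
- move=> X; have [a [_ Xa]] := reps_ex X; apply: (reps_inj _ Xa).
  by have := AdKE 1%g Xa; rewrite hom1 (act1 AdP).
- move=> g h X; have [a [_ Xa]] := reps_ex X; apply: (reps_inj (AdKE _ Xa)).
  by rewrite homM (actM AdP); do 2!apply: AdKE.
- move=> g X Y; have [a [_ Xa]] := reps_ex X; have [b [_ Yb]] := reps_ex Y.
  apply: (reps_inj (AdKE _ (subquoD Xa Yb))); rewrite (act_add AdP).
  by apply: subquoD; apply: AdKE.
- move=> g X Y; have [a [_ Xa]] := reps_ex X; have [b [_ Yb]] := reps_ex Y.
  apply: (reps_inj (AdKE _ (subquoM Xa Yb))); rewrite (act_mul AdP).
  by apply: subquoM; apply: AdKE.
- move=> g c; apply: (reps_inj (AdKE _ (subquo_inalg w c))).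
  by rewrite (act_inalg AdP); apply: subquo_inalg.
- move=> X n; have [a [_ Xa]] := reps_ex X.
  have [F FP] := orbit_interpolation a n; have [r /FP[rA _]] := coord_interpolation F.
  exists [seq (p.1, AdK p.2 X) | p <- r] => k; rewrite big_map /=.
  exists (Ad (iK k) a - \sum_(p <- r) scal B (ev k p.1) * Ad (iK p.2) a) => //.
  apply: repsB; first exact: AdKE.
  by apply: reps_sum => p; apply: repsM_inalg; apply: AdKE.
Qed.

Lemma derK_induced : is_induced_derivation filH AdK derK.
Proof.
split.
- move=> y X Y; have [a [_ Xa]] := reps_ex X; have [b [_ Yb]] := reps_ex Y.
  apply: (reps_inj (derKE _ (subquoD Xa Yb))); rewrite (der_add derP).
  by apply: subquoD; apply: derKE.
- move=> y X Y; have [a [_ Xa]] := reps_ex X; have [b [_ Yb]] := reps_ex Y.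
  apply: (reps_inj (derKE _ (subquoM Xa Yb))); rewrite (der_mul derP).
  by apply: subquoD; apply: subquoM => //; apply: derKE.
- move=> y c; apply: (reps_inj (derKE _ (subquo_inalg w c))).
  by rewrite (der_inalg derP); apply: reps0.
- move=> y X n s sP; have [a [_ Xa]] := reps_ex X.
  have [F FP] := orbit_interpolation a n.
  have [r rE] := coord_interpolation (F ++ [seq p.1 | p <- s]).
  have [|_ /(_ y) rD] := FP r; first by move=> f fF; apply: rE; rewrite mem_cat fF.
  pose Z := \sum_(p <- r) scal Red (y p.1) * AdK p.2 X.
  have ZE : \sum_(q <- r) scal Red (y q.1) *
        (AdK q.2 X - \sum_(p <- s) inalg (sconst (ev q.2 p.1)) * p.2) =
      Z - \sum_(p <- s) inalg (sconst (y p.1 : R[i])) * p.2.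
    rewrite (eq_bigr _ (fun _ _ => mulrBr _ _ _)) sumrB; congr (_ - _).
    rewrite (eq_bigr _ (fun _ _ => mulr_sumr _ _ _ _)) exchange_big /=.
    rewrite big_seq [RHS]big_seq; apply: eq_bigr => p ps.
    rewrite [in RHS](rE p.1); last by rewrite mem_cat map_f ?orbT.
    rewrite lie_sum -/(scal Red _) scal_suml; apply: eq_bigr => q _.
    by rewrite lieZ -/(scal Red _) mulrA -scalM mulrC.
  rewrite -[derK y X](subrK Z) -addrA -ZE.
  apply: filH_add; last by apply: filH_sum => q; apply/filH_scal/sP.
  exists (der (diff iK y) a - \sum_(p <- r) scal B (y p.1) * Ad (iK p.2) a) => //.
  apply: repsB; first exact: derKE.
  by apply: reps_sum => p; apply: repsM_inalg; apply: AdKE.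
Qed.

Lemma PhiK_comoment : is_comoment AdK derK PhiK.
Proof.
split.
- move=> c x y; apply: (reps_inj (PhiKE _)); rewrite diff_lin (com_lin PhiP).
  by apply: subquoD => //; apply: repsM_inalg.
- move=> g x; apply: (reps_inj (PhiKE _)); rewrite diff_lieAd (com_equiv PhiP).
  exact: AdKE.
- move=> y X; have [a [_ Xa]] := reps_ex X.
  have lhs := repsB (subquoM (PhiKE y) Xa) (subquoM Xa (PhiKE y)).
  apply: (reps_inj lhs); rewrite (com_der PhiP).
  by apply: repsM_inalg; apply: derKE.
Qed.

Lemma PhiK_bracket x y :
  PhiK x * PhiK y - PhiK y * PhiK x = inalg hbar * PhiK (bracket x y).
Proof.
rewrite (com_der PhiK_comoment); congr (_ * _).
apply: (reps_inj (derKE _ (PhiKE y))).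
by rewrite (der_comoment derP PhiP) -diff_bracket.
Qed.

Lemma kappa_bracket x y : kappa (bracket x y) = 0.
Proof. by rewrite -gamma_kappa diff_bracket (gamma_bracket gamma_inv). Qed.

Local Notation JK := (red_ideal PhiK kappa).

Lemma JKE : JK = lideal (shifted PhiK kappa @` setT)%classic.
Proof.
by apply: red_idealE; [exact: com_lin PhiK_comoment|exact: PhiK_bracket|exact: kappa_bracket].
Qed.

Lemma reps_shifted y : reps (shifted PhiK kappa y) (shifted Phi gamma (diff iK y)).
Proof. by rewrite /shifted gamma_kappa; apply: repsB => //; apply: subquo_inalg. Qed.

(** Passing to representatives brings the second ideal into the quantisation, where
    averages are defined. *)
Definition preJK : set B := [set b | exists2 X, JK X & reps X b].

Lemma preJK0 : preJK 0.
Proof. by exists 0; [exact: lideal0|exact: reps0]. Qed.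

Lemma preJKD a b : preJK a -> preJK b -> preJK (a + b).
Proof.
move=> [X JX Xa] [Y JY Yb]; exists (X + Y); [exact: lidealD|exact: subquoD].
Qed.

Lemma preJK_JH a : JH a -> preJK a.
Proof. by move=> Ja; exists 0; [exact: lideal0|apply/reps0E]. Qed.

Lemma preJK_mul u y : SH u -> preJK (u * shifted Phi gamma (diff iK y)).
Proof.
move=> Su; have [U Uu] := subquo_of w Su.
exists (U * shifted PhiK kappa y); last exact: subquoM Uu (reps_shifted y).
by rewrite JKE; apply/lidealMl/lideal_gen; exists y.
Qed.

Lemma preJK_ind (P : set B) :
  (forall a, JH a -> P a) -> (forall a b, P a -> P b -> P (a + b)) ->
  (forall u y, SH u -> P (u * shifted Phi gamma (diff iK y))) ->
  forall a, preJK a -> P a.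
Proof.
move=> PJ PD Pgen a [X + Xa]; rewrite JKE => JX; move: X JX a Xa.
apply: lideal_ind => [a /reps0E/PJ //|X Y PX PY a XYa|U _ [y _ <-] a Ua].
  have [b [_ Xb]] := reps_ex X; have [b' [_ Yb']] := reps_ex Y.
  rewrite -(subrK (b + b') a); apply: (PD); last by apply: PD; [apply: PX|apply: PY].
  by apply: PJ; apply: reps_eqmod XYa (subquoD Xb Yb').
have [u [Su Uu]] := reps_ex U.
rewrite -(subrK (u * shifted Phi gamma (diff iK y)) a); apply: PD; last exact: Pgen.
by apply: PJ; apply: reps_eqmod Ua (subquoM Uu (reps_shifted y)).
Qed.

(** Moving a generator across [c t] keeps it among the generators for [K], and the
    coefficients remain [H]-invariant by [SH_average]. *)
Lemma preJK_average (y : lie K) (c : R -> K) mu a : exp_curve y c ->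
  preJK a -> preJK (average Ad (fun t => iK (c t)) mu a).
Proof.
move=> yc; move: a; apply: preJK_ind => [a Ja|a b Ja Jb|u z Su].
- by apply/preJK_JH/JH_average.
- by rewrite (averageD AdP); apply: preJKD.
- have [q ->] := average_mul_shifted AdP PhiP gamma_inv (fun t => iK (c t)) mu u (diff iK z).
  elim/big_ind: _ => [||p _]; [exact: preJK0|exact: preJKD|].
  by rewrite -diff_lieAd; apply/preJK_mul/SH_average.
Qed.

Lemma preJK_JG a : preJK a -> red_ideal Phi gamma a.
Proof.
apply: preJK_ind => [b /JH_JG //|b c|u y _]; first exact: lidealD.
by rewrite red_idealG; apply/lidealMl/lideal_gen; exists (diff iK y).
Qed.

Lemma preJK_orbit X a k : red_inv AdK PhiK kappa X -> reps X a ->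
  preJK (Ad (iK k) a - a).
Proof.
by move=> SX Xa; exists (AdK k X - X); [exact: SX|apply: repsB => //; apply: AdKE].
Qed.

Lemma reducibleK : reducible AdK PhiK kappa.
Proof.
apply: (reducible_criterion (com_lin PhiK_comoment) PhiK_bracket kappa_bracket
  AdK_action PhiK_comoment) => [k x|y X SX].
  by rewrite -!gamma_kappa diff_lieAd gamma_inv.
have [c yc] := exp_curve_exists y; have [a [_ Xa]] := reps_ex X.
have [Y JY Ya] : preJK (der (diff iK y) a); last first.
  by rewrite (reps_inj (derKE y Xa) Ya).
apply: (der_in_stable AdP derP (exp_curve_diff iK yc)) => [|b b'|mu b|t].
- exact: preJK0.
- exact: preJKD.
- exact: preJK_average.
- exact: preJK_orbit SX Xa.
Qed.

(** Write [g] as a product of elements of [H] and [K], and use that the ideal for [G] contains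
    the other two. *)
Lemma second_invariants X a : red_inv AdK PhiK kappa X -> reps X a ->
  red_inv Ad Phi gamma a.
Proof.
move=> SX Xa g; have [_ _ _ [pH [pK [_ _ gE _ _]]]] := semi.
have -> : Ad g a - a = Ad (iH (pH g)) (Ad (iK (pK g)) a - a) + (Ad (iH (pH g)) a - a).
  by rewrite (actB AdP) -(actM AdP) gE addrA subrK.
apply: lidealD; last exact/JH_JG/(reps_S Xa).
apply: (act_red_ideal (com_lin PhiP) (comoment_bracket derP PhiP)
  (gamma_bracket gamma_inv) AdP PhiP gamma_inv).
exact/preJK_JG/(preJK_orbit _ SX Xa).
Qed.

Lemma natural_morphism (wK : reducible AdK PhiK kappa) (wG : reducible Ad Phi gamma) :
  exists f : {rmorphism reduction wK -> reduction wG},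
    preserves_scalars f /\ forall Z X a, reps Z X -> reps X a -> reps (f Z) a.
Proof.
have /choice[f fE] (Z : reduction wK) : exists W : reduction wG,
    forall X a, reps Z X -> reps X a -> reps W a.
  have [X [SX ZX]] := reps_ex Z; have [a [_ Xa]] := reps_ex X.
  have [W Wa] := subquo_of wG (second_invariants SX Xa).
  exists W => X' a' ZX' X'a'; apply: (reps_mod Wa); apply: preJK_JG.
  by exists (X' - X); [apply: reps_eqmod ZX' ZX | apply: repsB].
have rep2 (Z : reduction wK) : exists X a, reps Z X /\ reps X a.
  have [X [_ ZX]] := reps_ex Z; have [a [_ Xa]] := reps_ex X.
  by exists X, a.
have fB : zmod_morphism f.
  move=> Z Z'; have [X [a [ZX Xa]]] := rep2 Z; have [X' [a' [ZX' Xa']]] := rep2 Z'.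
  by apply: (reps_inj (fE _ _ _ (repsB ZX ZX') (repsB Xa Xa'))); apply: repsB; apply: fE; eassumption.
have fM : monoid_morphism f.
  split=> [|Z Z']; first by apply: (reps_inj (fE _ _ _ (reps1 wK) (reps1 w))); apply: reps1.
  have [X [a [ZX Xa]]] := rep2 Z; have [X' [a' [ZX' Xa']]] := rep2 Z'.
  by apply: (reps_inj (fE _ _ _ (subquoM ZX ZX') (subquoM Xa Xa'))); apply: subquoM; apply: fE; eassumption.
pose fZ := GRing.isZmodMorphism.Build (reduction wK) (reduction wG) f fB.
pose fR := GRing.isMonoidMorphism.Build (reduction wK) (reduction wG) f fM.
exists (HB.pack f fZ fR : {rmorphism reduction wK -> reduction wG}).
split=> [c|]; last exact: fE.
apply: (reps_inj (fE _ _ _ (subquo_inalg wK c) (subquo_inalg w c))).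
exact: subquo_inalg.
Qed.

End SecondStage.

End ReductionInStages.

Theorem theorem2p6 (R : realType) (A : comAlgType R[i]) (br : poisson A)
    (Q : defquant br)
    (G H K : algGroup R[i]) (iH : agHom H G) (iK : agHom K G)
    (semi : semidirect iH iK)
    (Ad : G -> Ahbar Q -> Ahbar Q) (der : lie G -> Ahbar Q -> Ahbar Q)
    (Phi : lie G -> Ahbar Q)
    (AdP : is_action (@hadic _ _ _ Q) Ad)
    (derP : is_induced_derivation (@hadic _ _ _ Q) Ad der)
    (PhiP : is_comoment Ad der Phi)
    (gamma : {linear lie G -> R[i]^o})
    (gamma_inv : forall g x, gamma (lieAd g x) = gamma x)
    (eta : {linear lie H -> R[i]^o}) (kappa : {linear lie K -> R[i]^o})
    (gamma_eta : forall x, gamma (diff iH x) = eta x)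
    (gamma_kappa : forall y, gamma (diff iK y) = kappa y) :
  exists (wH : reducible (fun h => Ad (iH h)) (fun x => Phi (diff iH x)) eta),
  exists (AdK : K -> reduction wH -> reduction wH)
         (derK : lie K -> reduction wH -> reduction wH)
         (PhiK : lie K -> reduction wH),
    [/\ is_action (subquo_fil (@hadic _ _ _ Q) (w := wH)) AdK,
        is_induced_derivation (subquo_fil (@hadic _ _ _ Q) (w := wH)) AdK derK,
        is_comoment AdK derK PhiK,
        (forall k X a, reps X a -> reps (AdK k X) (Ad (iK k) a)) /\
        (forall y X a, reps X a -> reps (derK y X) (der (diff iK y) a)) /\
        (forall y, reps (PhiK y) (Phi (diff iK y))) &
        exists (wK : reducible AdK PhiK kappa) (wG : reducible Ad Phi gamma)
               (f : {rmorphism reduction wK -> reduction wG}),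
          preserves_scalars f /\
          forall Z X a, reps Z X -> reps X a -> reps (f Z) a].
Proof.
have w := reducibleH semi AdP derP PhiP gamma_inv gamma_eta; exists w.
have [AdK AdKE] := subquo_lift w (fun k => actB AdP (iK k))
  (SH_Ad semi AdP derP PhiP gamma_inv gamma_eta)
  (fun k => JH_Ad semi AdP derP PhiP gamma_inv gamma_eta (iK k)).
have derB y a b : der (diff iK y) (a - b) = der (diff iK y) a - der (diff iK y) b.
  have := der_add derP (diff iK y) (a - b) b; rewrite subrK => ->.
  by rewrite addrK.
have [derK derKE] := subquo_lift w derB
  (SH_der semi AdP derP PhiP gamma_inv gamma_eta)
  (JH_der semi AdP derP PhiP gamma_inv gamma_eta).
have /choice[PhiK PhiKE] (y : lie K) := subquo_of w (SH_Phi semi derP PhiP gamma_inv gamma_eta y).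
exists AdK, derK, PhiK; split.
- exact: (AdK_action AdP derP AdKE).
- exact: (derK_induced AdP derP AdKE derKE).
- exact: (PhiK_comoment PhiP AdKE derKE PhiKE).
- by [].
- exists (reducibleK semi AdP derP PhiP gamma_inv gamma_eta gamma_kappa AdKE derKE PhiKE).
  exists (reducible_whole AdP derP PhiP gamma_inv).
  exact: (natural_morphism semi AdP derP PhiP gamma_inv gamma_eta gamma_kappa AdKE derKE PhiKE).
Qed.
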